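(* Let $\mathbf i$ be a reduced word for $w_0$ and $a\in[n-1]$. Then $$f_{\chi,a}\big|_{\mathbb T_{\mathbf i}}=\varrho_{a,\mathbf i}\circ\mathrm{NA}_{\mathbf i}.$$ Furthermore, the BK-potential $f_\chi|_{\mathbb T_{\mathbf i}}=\sum_{a\in[n-1]}\varrho_{a,\mathbf i}\circ\mathrm{NA}_{\mathbf i}$ is, under the change of variables $\mathrm{NA}_{\mathbf i}$ (i.e. written in the variables $x_T=x_{\ell(T)}/x_{r(T)}$, $T\in\mathcal T_{\mathbf i}$), a Laurent polynomial with coefficients in $\{0,1\}$ and exponents in $\{-1,0,1\}$.
   Context: Let $n\ge2$, $[m]=\{1,\dots,m\}$, $N=n(n-1)/2$, $\sigma_i=(i,i+1)\in\mathfrak S_n$, $w_0$ the longest element. **Tilings and reduced words.** A tiling is a tiling of the regular $2n$-gon $P_0$ of side length $1$ (with a unique lowest vertex $v_0$) by rhombi (tiles) of side length $1$. The left boundary runs clockwise from $v_0$ to the highest vertex; its edges are labelled $1,\dots,n$ clockwise from $v_0$, and parallel edges have equal labels. A vertex is written $v_S$ and identified with $S\subseteq[n]$, the set of labels of a minimal edge path from $v_0$ to it. For $s\ne t$ exactly one tile has edges labelled $s,t$, denoted $[s,t]=[s,t;S]$, with vertices $S,S\cup\{s\},S\cup\{t\},S\cup\{s,t\}$. For $T=[s,t;S]$, $s<t$: $\ell(T)=S\cup\{s\}$, $r(T)=S\cup\{t\}$. Define $\le_n$ on tiles: let $B_1$ be the left boundary; $\mathcal T_k$ is the set of tiles not in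 $\mathcal T_1\cup\dots\cup\mathcal T_{k-1}$ having two edges in $B_k$; $B_{k+1}$ arises from $B_k$ by replacing for each tile of $\mathcal T_k$ these two edges by its other two edges. $T\le_nT'$ iff there is a sequence of tiles from $T$ to $T'$, consecutive ones sharing an edge, along which the index $k$ strictly increases. A reduced word is $\mathbf i=(i_1,\dots,i_N)$ with $\sigma_{i_1}\cdots\sigma_{i_N}=w_0$; it gives the total order $\alpha_{i_1}\le_{\mathbf i}\sigma_{i_1}(\alpha_{i_2})\le_{\mathbf i}\cdots\le_{\mathbf i}\sigma_{i_1}\cdots\sigma_{i_{N-1}}(\alpha_{i_N})$ on positive roots of $\mathfrak{sl}_n$. $\mathcal T_{\mathbf i}$ is the unique tiling such that $\le_{\mathbf i}$ refines $\le_n$ when $[s,t]$ ($s<t$) is identified with $\epsilon_s-\epsilon_t$. **The functions $\varrho_{a,\mathbf i}$.** Transition maps $\phi^{\mathbf i}_{\mathbf j}:\mathbb N^{\mathcal T_{\mathbf i}}\to\mathbb N^{\mathcal T_{\mathbf j}}$: for a commutation move, $(\phi x)_{[s,t]}=x_{[s,t]}$; for a braid move, $\mathcal T_{\mathbf j}$ is obtained by flipping a hexagon formed by tiles $[s,t],[s,u],[t,u]$ ($s<t<u$), and $y=\phi x$ has $y_{[s,t]}=x_{[s,t]}+x_{[s,u]}-m$, $y_{[s,u]}=m$, $y_{[t,u]}=x_{[t,u]}+x_{[s,u]}-m$, $m=\min(x_{[s,t]},x_{[t,u]})$, other coordinates unchanged; in general compose. The operator $f_a^*$ on $\mathbb N^{\mathcal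 T_{\mathbf i}}$: if $i_N=n-a$ it increases $x_{[a,a+1]}$ by one; in general $f^*_a=\phi^{\mathbf j}_{\mathbf i}\circ f^*_a\circ\phi^{\mathbf i}_{\mathbf j}$. Put $\mathbf R_a^*(\mathcal T_{\mathbf i})=\{f_a^*x-x\mid x\in\mathbb N^{\mathcal T_{\mathbf i}}\}\subset\mathbb Z^{\mathcal T_{\mathbf i}}$. On the torus $\widehat{\mathbb L}_{\mathbf i}=\mathbb G_m^{\mathcal T_{\mathbf i}}$ let $\varrho_{a,\mathbf i}(x)=\sum_{y\in\mathbf R_a^*(\mathcal T_{\mathbf i})}\prod_{T}x_T^{y_T}$. **$\mathcal A$-tori and BK potential.** Let $\mathcal N\subset SL_n(\mathbb C)$ be the group of upper unitriangular matrices and $L^{e,w_0}=\mathcal N\cap B_-w_0B_-$ ($B_-$ the lower triangular matrices). $\Delta_S$ is the minor with rows $1,\dots,\#S$ and columns $S$. $V(\mathcal T_{\mathbf i})$ is the set of vertices not on the left boundary. $\mathbb T_{\mathbf i}=\mathbb G_m^{V(\mathcal T_{\mathbf i})}$ is the cluster torus, embedded as an open subset of $L^{e,w_0}$ with coordinate functions $x_S=\Delta_S$, $v_S\in V(\mathcal T_{\mathbf i})$; put $x_v=1$ for $v$ on the left boundary (there $\Delta_{[k]}=1$ on $\mathcal N$). The Berenstein–Kazhdan (BK) potential is $f_\chi=\sum_{a\in[n-1]}f_{\chi,a}$ with $f_{\chi,a}=\Delta_{\{a,a+2,\dots,n\}}/\Delta_{\{a+1,\dots,n\}}$. **The map.**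 $\mathrm{NA}_{\mathbf i}:\mathbb T_{\mathbf i}\to\widehat{\mathbb L}_{\mathbf i}$, $x\mapsto\left(x_{\ell(T)}/x_{r(T)}\right)_{T\in\mathcal T_{\mathbf i}}$. *)

(* Defs.v *)
From HB Require Import structures.
From mathcomp Require Import all_boot all_order all_algebra all_fingroup.
From mathcomp Require Import finmap complex.
From mathcomp Require Import boolp classical_sets functions cardinality fsbigop.
From mathcomp Require Import reals trigo.
From Stdlib Require Import Relation_Operators.

Set Implicit Arguments.
Unset Strict Implicit.
Unset Printing Implicit Defensive.

Import Order.TTheory GRing.Theory Num.Theory.

Local Open Scope ring_scope.

(* Everything is 0-based: the label k of [n] is the ordinal k - 1 of 'I_n and
   the index a of [n-1] is the ordinal a - 1 of 'I_n.-1. *)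

Section ReducedWords.
Variable n : nat.

Lemma hi_subproof (p : 'I_n.-1) : (p.+1 < n)%N.
Proof. by case: p => p /=; case: n. Qed.

Definition lo (p : 'I_n.-1) : 'I_n := widen_ord (leq_pred n) p.
Definition hi (p : 'I_n.-1) : 'I_n := Ordinal (hi_subproof p).

Definition sigma (p : 'I_n.-1) : 'S_n := tperm (lo p) (hi p).

Definition w0 : 'S_n := perm (@rev_ord_inj n).

(* The composite sigma_{i_1} o ... o sigma_{i_k}.  The product of 'S_n is
   composition from left to right, hence the reversed order. *)
Fixpoint word_perm (i : seq 'I_n.-1) : 'S_n :=
  if i is p :: i' then (word_perm i' * sigma p)%g else 1%g.

Definition reduced_word (i : seq 'I_n.-1) : Prop :=
  size i = (n * n.-1)./2 /\ word_perm i = w0.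

(* The positive root epsilon_s - epsilon_t, s < t. *)
Definition pos_root := {st : 'I_n * 'I_n | (st.1 < st.2)%N}.

Definition simple_root (p : 'I_n.-1) : pos_root :=
  exist _ (lo p, hi p) (ltnSn p).

(* The roots alpha_{i_1}, sigma_{i_1}(alpha_{i_2}), ..., where (s, t) stands
   for epsilon_s - epsilon_t. *)
Fixpoint word_roots (i : seq 'I_n.-1) : seq ('I_n * 'I_n) :=
  if i is p :: i' then
    (lo p, hi p) :: [seq (sigma p b.1, sigma p b.2) | b <- word_roots i']
  else [::].

Definition word_le (i : seq 'I_n.-1) (r r' : pos_root) : Prop :=
  (index (val r) (word_roots i) <= index (val r') (word_roots i))%N.

End ReducedWords.

Section Tilings.
Variable n : nat.

(* A vertex v_S is represented by its set of labels S, the edge joining v_S to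
   v_(S u {r}) by (S, r), and the tile [s,t;S] with s < t by ((s, t), S). *)
Definition edge := ({set 'I_n} * 'I_n)%type.

Definition tile := (pos_root n * {set 'I_n})%type.

Definition tile_root (X : tile) : pos_root n := X.1.
Definition tile_s (X : tile) : 'I_n := (val X.1).1.
Definition tile_t (X : tile) : 'I_n := (val X.1).2.

Definition tile_left (X : tile) : {set 'I_n} := tile_s X |: X.2.
Definition tile_right (X : tile) : {set 'I_n} := tile_t X |: X.2.

Definition tile_verts (X : tile) : {set {set 'I_n}} :=
  [set X.2; tile_left X; tile_right X; tile_s X |: (tile_t X |: X.2)].

Definition tile_edges (X : tile) : {set edge} :=
  [set (X.2, tile_s X); (X.2, tile_t X);
       (tile_left X, tile_t X); (tile_right X, tile_s X)].

Definition initial (k : nat) : {set 'I_n} := [set j : 'I_n | (j < k)%N].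

Definition left_verts : {set {set 'I_n}} :=
  [set initial k | k : 'I_n.+1].
Definition right_verts : {set {set 'I_n}} :=
  [set ~: initial k | k : 'I_n.+1].
Definition left_edges : {set edge} := [set (initial k, k) | k : 'I_n].

(* The k-th edge (k = 1, ..., n) of the left boundary of the regular 2n-gon
   with vertical symmetry axis makes the angle pi - (2k - 1) pi / 2n with the
   horizontal axis. *)
Definition edge_vec (R : realType) (r : 'I_n) : 'rV[R]_2 :=
  let theta := pi - (r.*2.+1)%:R * pi / (n.*2)%:R in
  \row_(c < 2) (if c == 0 then cos theta else sin theta).

Definition vertex_pt (R : realType) (S : {set 'I_n}) : 'rV[R]_2 :=
  \sum_(r in S) edge_vec R r.

Definition hull (R : realType) (A : {set {set 'I_n}}) (p : 'rV[R]_2) : Prop :=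
  exists c : {set 'I_n} -> R,
    [/\ forall S, 0 <= c S, \sum_(S in A) c S = 1
      & p = \sum_(S in A) c S *: vertex_pt R S].

(* Edge-to-edge tilings of the 2n-gon.  The intersection condition is on
   labelled vertices: two distinct tiles have at most two vertices in common,
   so they meet in nothing, a vertex or an edge, and a point which is a vertex
   of both carries the same label in both.  As the tiles cover the polygon, it
   follows that S is the set of labels of an edge path from v_0 to v_S: every
   vertex other than v_0 is the upper end of some edge. *)
Definition is_tiling (R : realType) (T : {set tile}) : Prop :=
  [/\ forall X, X \in T -> (tile_s X \notin X.2) && (tile_t X \notin X.2),
      forall p : 'rV[R]_2, hull (left_verts :|: right_verts) p <->
        exists2 X, X \in T & hull (tile_verts X) p
    & forall X Y, X \in T -> Y \in T -> X != Y -> forall p : 'rV[R]_2,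
        hull (tile_verts X) p -> hull (tile_verts Y) p ->
        hull (tile_verts X :&: tile_verts Y) p].

Definition next_layer (T U : {set tile}) (B : {set edge}) : {set tile} :=
  [set X in T :\: U | #|tile_edges X :&: B| == 2].

(* (T_1 u ... u T_k, B_{k+1}). *)
Fixpoint sweep (T : {set tile}) (k : nat) : {set tile} * {set edge} :=
  if k is k'.+1 then
    let: (U, B) := sweep T k' in
    let L := next_layer T U B in
    let E := \bigcup_(X in L) tile_edges X in
    (U :|: L, (B :\: E) :|: (E :\: B))
  else (finset.set0, left_edges).

(* layer T k is T_{k+1}. *)
Definition layer (T : {set tile}) (k : nat) : {set tile} :=
  next_layer T (sweep T k).1 (sweep T k).2.

Definition tile_step (T : {set tile}) (X Y : tile) : Prop :=
  tile_edges X :&: tile_edges Y != finset.set0 /\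
  exists k l : nat, [/\ (k < l)%N, X \in layer T k & Y \in layer T l].

Definition tile_le (T : {set tile}) : tile -> tile -> Prop :=
  clos_refl_trans tile (tile_step T).

(* T is the tiling attached to the reduced word i. *)
Definition tiling_of_word (R : realType) (i : seq 'I_n.-1) (T : {set tile}) :
    Prop :=
  is_tiling R T /\
  forall X Y, X \in T -> Y \in T -> tile_le T X Y ->
    word_le i (tile_root X) (tile_root Y).

End Tilings.

Section CrystalOperators.
Variable n : nat.
Implicit Types (i j u v : seq 'I_n.-1) (x y : {ffun pos_root n -> nat}).

(* The tile [s,t] of a tiling is determined by its pair of labels, so that
   N^(T_i) is the set of families indexed by the pairs s < t. *)
Definition braid_coord (A B C : pos_root n) x : {ffun pos_root n -> nat} :=
  let m := minn (x A) (x C) in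
  [ffun r => if r == A then (x A + x B - m)%N
             else if r == B then m
             else if r == C then (x C + x B - m)%N
             else x r].

Inductive move : seq 'I_n.-1 * {ffun pos_root n -> nat} ->
                 seq 'I_n.-1 * {ffun pos_root n -> nat} -> Prop :=
| CommMove u v (p q : 'I_n.-1) x of (p.+1 < q)%N || (q.+1 < p)%N :
    move (u ++ [:: p; q] ++ v, x) (u ++ [:: q; p] ++ v, x)
  (* The tiles of the flipped hexagon are those of the three consecutive
     roots at the place of the braid move. *)
| BraidMove u v (p q : 'I_n.-1) (s t w : 'I_n) (A B C : pos_root n) x
    of (p.+1 == q :> nat) || (q.+1 == p :> nat)
     & val A = (s, t) & val B = (s, w) & val C = (t, w)
     & (let rs := take 3 (drop (size u)
                     (word_roots (u ++ [:: p; q; p] ++ v))) in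
        rs = [:: val A; val B; val C] \/ rs = [:: val C; val B; val A]) :
    move (u ++ [:: p; q; p] ++ v, x) (u ++ [:: q; p; q] ++ v, braid_coord A B C x).

(* The graph of phi^i_j. *)
Definition transition i j x y : Prop :=
  clos_refl_trans _ move (i, x) (j, y).

Definition incr (r : pos_root n) x : {ffun pos_root n -> nat} :=
  [ffun r' => (x r' + (r' == r))%N].

(* The graph of f_a^* on N^(T_i); the last letter n - a of j is rev_ord a in
   0-based indexing. *)
Definition fstar (a : 'I_n.-1) i x x' : Prop :=
  exists j y, [/\ reduced_word j, exists u, j = rcons u (rev_ord a),
    transition i j x y & transition j i (incr (simple_root a) y) x'].

Definition exponent := {ffun pos_root n -> int}.

Definition Rstar (a : 'I_n.-1) i : set exponent :=
  fun y : exponent => exists x x', fstar a i x x' /\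
    forall r, y r = (x' r)%:Z - (x r)%:Z.

End CrystalOperators.

Section Potential.
Variables (R : realType) (n : nat).
Local Notation C := R[i].
Implicit Types (T : {set tile n}) (g : 'M[C]_n).

(* prod_T x_T^(y_T) *)
Definition monomial T (x : tile n -> C) (y : exponent n) : C :=
  \prod_(X in T) x X ^ y (tile_root X).

(* A finite support sum: it is the sum over Rstar a i when this is finite. *)
Definition varrho (a : 'I_n.-1) (i : seq 'I_n.-1) T (x : tile n -> C) : C :=
  \sum_(y \in Rstar a i) monomial T x y.

(* Laurent polynomials with integer coefficients in the variables x_T. *)
Definition laurent := {fsfun exponent n -> int with 0}.

Definition laurent_eval (P : laurent) T (x : tile n -> C) : C :=
  \sum_(y <- finsupp P) (P y)%:~R * monomial T x y.

Lemma card_label_set (S : {set 'I_n}) : (#|S| <= n)%N.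
Proof. by rewrite -[leqRHS]card_ord max_card. Qed.

(* The minor with rows 1, ..., #S and columns S; enum_val is increasing. *)
Definition Delta (S : {set 'I_n}) g : C :=
  \det (\matrix_(k < #|S|, l < #|S|)
          g (widen_ord (card_label_set S) k) (enum_val l)).

Definition unitriangular g : Prop :=
  forall k l : 'I_n, (l <= k)%N -> g k l = (k == l)%:R.

Definition lower_SL g : Prop := is_trig_mx g /\ \det g = 1.

(* A representative of w_0 in SL_n: the signs (-1)^k multiply to the sign
   of w_0. *)
Definition w0_mx : 'M[C]_n :=
  \matrix_(k, l) ((-1) ^+ k *+ (l == w0 n k)).

Definition Lew0 g : Prop :=
  unitriangular g /\
  exists b b' : 'M[C]_n,
    [/\ lower_SL b, lower_SL b' & g = b *m w0_mx *m b'].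

Definition inner_verts T : {set {set 'I_n}} :=
  (\bigcup_(X in T) tile_verts X) :\: left_verts n.

(* The open subset of L^(e,w_0) with coordinates Delta_S in G_m. *)
Definition cluster_torus T g : Prop :=
  Lew0 g /\ forall S, S \in inner_verts T -> Delta S g != 0.

Definition cluster_coord g (S : {set 'I_n}) : C :=
  if S \in left_verts n then 1 else Delta S g.

Definition NA g (X : tile n) : C :=
  cluster_coord g (tile_left X) / cluster_coord g (tile_right X).

Definition fchi (a : 'I_n.-1) g : C :=
  Delta (lo a |: [set j : 'I_n | (a.+1 < j)%N]) g /
  Delta [set j : 'I_n | (a < j)%N] g.

Definition BK_potential g : C := \sum_(a < n.-1) fchi a g.

End Potential.

(* Main.v *)
Require Import Defs.
From HB Require Import structures.
From mathcomp Require Import all_boot all_order all_algebra all_fingroup.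
From mathcomp Require Import finmap complex.
From mathcomp Require Import boolp classical_sets functions cardinality fsbigop.
From mathcomp Require Import reals trigo.
From mathcomp Require Import zify ring lra.
From Stdlib Require Import Relation_Operators.

Set Implicit Arguments.
Unset Strict Implicit.
Unset Printing Implicit Defensive.

Import Order.TTheory GRing.Theory Num.Theory.

Local Open Scope ring_scope.

(* The tiling of a reduced word is made of the rhombi that its path sweeps, and
   both sides of the identity are sums over the same combinatorial objects: the
   configurations for a, which are sets c of vertices S with a+1 in S, a not in
   S, containing {a+1,...,n} and closed under some moves along the edges and
   tiles of the tiling.  To c belongs the exponent vector whose entry at a tile is
   #(left and right vertices in c) - #(bottom and top vertices in c).
   Crystal side: on x, f_a^* adds the exponent vector of the greatest
   configuration maximizing a height function linear in x.  This is stable under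
   hexagon flips and clear for words ending in n-a; every configuration is the
   greatest maximizer for some x.
   Potential side: the sum over all configurations of the monomials in
   Delta_left / Delta_right is invariant under hexagon flips by the three-term
   Pluecker relation, so it can be evaluated for a word ending in n-a, where
   there is a single configuration.  As minors inside the polygon may vanish along
   the way, this is done for a generic pencil through g and specialized.
   Geometry: in a tiling every inner edge has exactly one tile on each side, which
   is shown by perturbing midpoints of edges; sweeping from the left boundary then
   identifies a tiling with the tiling of any reduced word refining its order. *)

(** * Words and the rhombi swept by their paths *)

(** The relations [transition] and [fstar] allow arbitrary paths of moves, so closed paths must be
    shown to act trivially before [Rstar] can be computed in one fixed tiling. The rule for [f_a^*]
    by greatest configurations is itself the tool: it commutes with all transitions, and every
    nonzero vector is, for some [a], the image under [f_a^*] of a vector of smaller weight. Greatest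
    maximizers are tractable because configurations are closed under union and intersection and the
    height is modular. A flip alters a configuration only at the vertex inside the hexagon. Which
    choices are admissible there depends on finitely many truth values, so a single exhaustive
    evaluation serves both sides: the piecewise linear comparison of heights and the rational
    comparison of monomials. Coefficients 0 and 1 express that an exponent vector determines both
    [a] and its configuration. Exponents 2 and -2 are excluded because parallel edges of a tile obey
    closure rules in the same direction. *)

Section Words.
Variable n : nat.
Implicit Types (w : 'S_n) (i j : seq 'I_n.-1) (p q : 'I_n.-1).
Local Open Scope nat_scope.
Local Notation pos w x := ((w^-1)%g x).

(* A permutation [w] stands for the path from the bottom to the top whose edges
   have labels [w 0, w 1, ...] and whose vertices are the [chain w k]; [walk w i]
   lists the rhombi swept from it, as label pairs with bottom vertices. *)
Definition step w p : 'S_n := (sigma p * w)%g.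
Definition run w i : 'S_n := foldl step w i.
Definition chain w (k : nat) : {set 'I_n} := [set x | pos w x < k].
Definition ascent w p := w (lo p) < w (hi p).

Fixpoint legal w i : bool :=
  if i is p :: i' then ascent w p && legal (step w p) i' else true.

Fixpoint walk w i : seq ('I_n * 'I_n * {set 'I_n}) :=
  if i is p :: i' then (w (lo p), w (hi p), chain w p) :: walk (step w p) i'
  else [::].

Definition word_tiling i : {set tile n} :=
  [set X : tile n | (val X.1, X.2) \in walk 1%g i].

Lemma run_cat w i j : run w (i ++ j) = run (run w i) j.
Proof. by rewrite /run foldl_cat. Qed.

Lemma legal_cat w i j : legal w (i ++ j) = legal w i && legal (run w i) j.
Proof. by elim: i w => //= p i IH w; rewrite IH andbA. Qed.

Lemma walk_cat w i j : walk w (i ++ j) = walk w i ++ walk (run w i) j.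
Proof. by elim: i w => //= p i IH w; rewrite IH. Qed.

Lemma run_word_perm w i : run w i = (word_perm i * w)%g.
Proof.
elim: i w => [|p i IH] w /=; first by rewrite mul1g.
by rewrite IH /step mulgA.
Qed.

Lemma walk_roots w i :
  map fst (walk w i) = [seq (w b.1, w b.2) | b <- word_roots i].
Proof.
elim: i w => //= p i IH w; rewrite IH -map_comp; congr (_ :: _).
by apply: eq_map => b /=; rewrite /step !permM.
Qed.

(** Ties the path to the root order: the rhombi swept from the left boundary carry the roots of the
    word in the order of [word_le]. *)
Lemma walk1_roots i : map fst (walk 1%g i) = word_roots i.
Proof. by rewrite walk_roots -[RHS]map_id; apply: eq_map => -[s t]; rewrite !perm1. Qed.

Lemma pos_step w p x : pos (step w p) x = sigma p (pos w x).
Proof. by rewrite /step invMg permM /sigma tpermV. Qed.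

Lemma val_lo p : lo p = p :> nat. Proof. by []. Qed.
Lemma val_hi p : hi p = p.+1 :> nat. Proof. by []. Qed.

Lemma sigmaE p (x : 'I_n) :
  sigma p x = (if x == p :> nat then p.+1 else if x == p.+1 :> nat then nat_of_ord p else x) :> nat.
Proof.
rewrite /sigma; case: tpermP => [->|->|/eqP h1 /eqP h2] /=.
- by rewrite eqxx.
- by rewrite eqxx; case: eqP => // ->.
- by move: h1 h2; rewrite -!val_eqE /= => /negbTE -> /negbTE ->.
Qed.

Lemma sigma_lo p : sigma p (lo p) = hi p. Proof. exact: tpermL. Qed.
Lemma sigma_hi p : sigma p (hi p) = lo p. Proof. exact: tpermR. Qed.

Lemma sigma_lt p (x : 'I_n) k : k != p.+1 -> (sigma p x < k) = (x < k).
Proof. by move=> kp; rewrite sigmaE; do 2?case: ifP; lia. Qed.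

Lemma chain_step w p k : k != p.+1 -> chain (step w p) k = chain w k.
Proof. by move=> kp; apply/setP => x; rewrite !inE pos_step sigma_lt. Qed.

Lemma chainS w (x : 'I_n) : chain w x.+1 = w x |: chain w x.
Proof.
apply/setP => y; rewrite !inE ltnS leq_eqVlt; congr (_ || _).
by rewrite val_eqE -(inj_eq (@perm_inj _ w) (pos w y)) permKV.
Qed.

Lemma notin_chain w (x : 'I_n) k : (w x \notin chain w k) = (k <= x).
Proof. by rewrite inE permK -leqNgt. Qed.

Lemma chainS_lo w p : chain w p.+1 = w (lo p) |: chain w p.
Proof. exact: (chainS w (lo p)). Qed.

Lemma chainS_hi w p : chain w p.+2 = w (hi p) |: chain w p.+1.
Proof. exact: (chainS w (hi p)). Qed.

Lemma step_lo w p : step w p (lo p) = w (hi p).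
Proof. by rewrite permM /sigma tpermL. Qed.

Lemma step_hi w p : step w p (hi p) = w (lo p).
Proof. by rewrite permM /sigma tpermR. Qed.

Lemma step_out w p (x : 'I_n) : x != p :> nat -> x != p.+1 :> nat -> step w p x = w x.
Proof. by move=> h1 h2; rewrite permM /sigma tpermD // -val_eqE eq_sym. Qed.

Lemma chain_step_eq w p : chain (step w p) p.+1 = w (hi p) |: chain w p.
Proof. by rewrite chainS_lo step_lo chain_step // neq_ltn ltnSn. Qed.

Lemma card_chain w k : k <= n -> #|chain w k| = k.
Proof.
move=> kn; rewrite -[RHS]card_ord.
have -> : chain w k = w @: (widen_ord kn @: [set: 'I_k]).
  apply/setP => x; rewrite inE; apply/idP/imsetP => [h|[y /imsetP[z _ ->] ->]].
    exists (pos w x); last by rewrite permKV.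
    by apply/imsetP; exists (Ordinal h) => //; apply: val_inj.
  by rewrite permK /=.
rewrite card_imset; last exact: perm_inj.
rewrite card_imset ?cardsT ?card_ord //.
by move=> x y /(congr1 val) /= /val_inj.
Qed.

Lemma chain1 k : chain 1%g k = initial n k.
Proof. by apply/setP => x; rewrite !inE invg1 perm1. Qed.

Lemma chain_w0 k : k <= n -> chain (w0 n) k = ~: initial n (n - k).
Proof.
move=> kn; apply/setP => x; rewrite !inE.
have -> : pos (w0 n) x = rev_ord x.
  by apply: (@perm_inj _ (w0 n)); rewrite permKV /w0 permE rev_ordK.
by have := ltn_ord x; rewrite /=; lia.
Qed.

Lemma pos_step_lt w p (x y : 'I_n) :
  ~~ ((pos w x == p :> nat) && (pos w y == p.+1 :> nat)) ->
  pos w x < pos w y -> pos (step w p) x < pos (step w p) y.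
Proof.
rewrite !pos_step !sigmaE.
by do 4?case: ifP; lia.
Qed.

Lemma pos_eq_lo w p (x : 'I_n) : (pos w x == p :> nat) = (x == w (lo p)).
Proof. by rewrite -[nat_of_ord p]/(nat_of_ord (lo p)) val_eqE -(inj_eq (@perm_inj _ w) (pos w x)) permKV. Qed.

Lemma pos_eq_hi w p (x : 'I_n) : (pos w x == p.+1 :> nat) = (x == w (hi p)).
Proof. by rewrite -[p.+1]/(nat_of_ord (hi p)) val_eqE -(inj_eq (@perm_inj _ w) (pos w x)) permKV. Qed.

(** A legal step exchanges only two neighbouring labels standing in increasing order, so a pair once
    inverted stays inverted. *)
Lemma legal_inverted w i (s t : 'I_n) : s < t -> legal w i ->
  pos w t < pos w s -> pos (run w i) t < pos (run w i) s.
Proof.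
move=> st; elim: i w => //= p i IH w /andP[asc L] h.
apply: IH => //; apply: pos_step_lt => //.
rewrite pos_eq_lo pos_eq_hi; apply/negP => /andP[/eqP e1 /eqP e2].
by move: asc; rewrite /ascent -e1 -e2; lia.
Qed.

(** The rhombus with labels [s], [t] is swept at the step where the two become inverted. As
    inversions persist, comparing the first and the last permutation is enough. *)
Lemma mem_walk_roots w i (s t : 'I_n) : s < t -> legal w i ->
  ((s, t) \in map fst (walk w i)) =
  (pos w s < pos w t) && (pos (run w i) t < pos (run w i) s).
Proof.
move=> st; elim: i w => [|p i IH] w /=; first by rewrite in_nil; lia.
case/andP=> asc L; rewrite in_cons IH //.
have [e|ne] := altP ((s, t) =P (w (lo p), w (hi p))).
  case: e => es et /=; rewrite es et !permK ltnSn /=; symmetry.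
  rewrite -es -et; apply: (legal_inverted st) => //.
  by rewrite !pos_step es et !permK sigma_lo sigma_hi.
rewrite /=; congr (_ && _).
have h1 : ~~ ((pos w s == p :> nat) && (pos w t == p.+1 :> nat)).
  by rewrite pos_eq_lo pos_eq_hi -xpair_eqE.
have h2 : ~~ ((pos w t == p :> nat) && (pos w s == p.+1 :> nat)).
  rewrite pos_eq_lo pos_eq_hi; apply/negP => /andP[/eqP e1 /eqP e2].
  by move: asc; rewrite /ascent -e1 -e2; lia.
case: (ltngtP (pos w s) (pos w t)) => [/(pos_step_lt h1) -> //|/(pos_step_lt h2)|].
  by lia.
by move/val_inj/perm_inj => e; move: st; rewrite e ltnn.
Qed.

Lemma uniq_walk_roots w i : legal w i -> uniq (map fst (walk w i)).
Proof.
elim: i w => //= p i IH w /andP[asc L]; rewrite IH // andbT.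
by rewrite mem_walk_roots // !pos_step !permK sigma_lo sigma_hi /= ltnNge leqnSn.
Qed.

Definition inversions w : {set 'I_n * 'I_n} :=
  [set st : 'I_n * 'I_n | (st.1 < st.2) && (pos w st.2 < pos w st.1)].

(** An adjacent transposition alters the relative order of a single pair, so it creates at most one
    inversion, and none at a descent. *)
Lemma card_inversions_step w p :
  #|inversions (step w p)| <= #|inversions w| + ascent w p.
Proof.
have sub : inversions (step w p) \subset
   if ascent w p then (w (lo p), w (hi p)) |: inversions w else inversions w.
  apply/fintype.subsetP => -[s t]; rewrite inE /= => /andP[st inv].
  have key : ~~ ((pos w s == p :> nat) && (pos w t == p.+1 :> nat)) ->
     (s, t) \in inversions w.
    move=> h; rewrite inE /= st; case: (ltngtP (pos w t) (pos w s)) => [//|lt|].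
      by have := pos_step_lt h lt; lia.
    by move/val_inj/perm_inj => e; move: st; rewrite e ltnn.
  case asc: (ascent w p).
    rewrite in_setU1; have [//|ne] := altP ((s, t) =P (w (lo p), w (hi p))).
    by rewrite /= key // pos_eq_lo pos_eq_hi -xpair_eqE.
  apply: key; rewrite pos_eq_lo pos_eq_hi; apply/negP => /andP[/eqP e1 /eqP e2].
  by move: asc; rewrite /ascent -e1 -e2 st.
apply: leq_trans (subset_leq_card sub) _.
case: (ascent w p); last by rewrite addn0.
by apply: leq_trans (leq_card_setU _ _) _; rewrite cards1 addnC.
Qed.

Lemma card_inversions_run w i : #|inversions (run w i)| <= #|inversions w| + size i.
Proof.
elim: i w => [|p i IH] w; first by rewrite addn0.
have h : #|inversions (run w (p :: i))| <= _ := IH (step w p).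
have := card_inversions_step w p; move: h; case: (ascent _ _) => /=; lia.
Qed.

(** Each letter adds at most one inversion, so equality in the total forces an ascent at every
    letter. *)
Lemma legal_of_card w i : #|inversions (run w i)| = #|inversions w| + size i -> legal w i.
Proof.
elim: i w => // p i IH w h; rewrite [legal _ _]/=.
have h1 : #|inversions (run w (p :: i))| <= _ := card_inversions_run (step w p) i; have h2 := card_inversions_step w p.
have asc : ascent w p by move: h2; case: (ascent w p) => //=; move: h h1; rewrite /=; lia.
by rewrite asc /=; apply: IH; move: h h1 h2; rewrite asc /=; lia.
Qed.

Lemma inversions1 : inversions 1%g = finset.set0.
Proof. by apply/setP => -[s t]; rewrite !inE /= invg1 !perm1; lia. Qed.

Lemma pos_w0 (x : 'I_n) : pos (w0 n) x = rev_ord x.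
Proof. by apply: (@perm_inj _ (w0 n)); rewrite permKV /w0 permE rev_ordK. Qed.

Lemma card_lt_pairs : #|[set st : 'I_n * 'I_n | st.1 < st.2]| = (n * n.-1)./2.
Proof.
rewrite -bin2 -bin2_sum big_mkord -sum1dep_card.
rewrite (eq_bigl (fun st : 'I_n * 'I_n => true && (st.1 < st.2))) //.
rewrite -(pair_big_dep xpredT (fun s t : 'I_n => s < t) (fun _ _ => 1)) /=.
rewrite (exchange_big_dep xpredT) //=; apply: eq_bigr => t _.
rewrite sum1dep_card -[RHS](@card_chain 1%g t (ltnW (ltn_ord t))).
by apply: eq_card => s; rewrite !inE invg1 perm1.
Qed.

Lemma inversions_w0 : inversions (w0 n) = [set st : 'I_n * 'I_n | st.1 < st.2].
Proof.
apply/setP => -[s t]; rewrite !inE /= !pos_w0 /=.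
by have := ltn_ord s; have := ltn_ord t; lia.
Qed.

(** [w0] inverts all pairs, and these are exactly as many as a reduced word has letters. *)
Lemma reduced_legal i : reduced_word i -> legal 1%g i /\ run 1%g i = w0 n.
Proof.
case=> sz e; have r : run 1%g i = w0 n by rewrite run_word_perm mulg1.
split=> //; apply: legal_of_card.
by rewrite r inversions_w0 inversions1 cards0 card_lt_pairs sz.
Qed.

Lemma legal_reduced i : legal 1%g i -> run 1%g i = w0 n -> reduced_word i.
Proof.
move=> L r; split; last by rewrite -r run_word_perm mulg1.
have sz : size (map fst (walk 1%g i)) = size i.
  by rewrite size_map; elim: i 1%g {L r} => //= p i IH w; rewrite IH.
rewrite -sz -card_lt_pairs -(card_uniqP (uniq_walk_roots L)).
apply: eq_card => -[s t]; rewrite !inE /=.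
have [st|st] := boolP (s < t).
  rewrite mem_walk_roots // r !pos_w0 invg1 !perm1 st /=.
  by have := ltn_ord s; have := ltn_ord t; lia.
apply/negbTE; apply: contra st; move: L; elim: i 1%g {r sz} => //= p i IH w /andP[asc L].
by rewrite in_cons => /orP[/eqP[-> ->] //|]; apply: IH.
Qed.

Lemma mem_roots_full i (s t : 'I_n) : legal 1%g i -> run 1%g i = w0 n -> s < t ->
  (s, t) \in map fst (walk 1%g i).
Proof.
move=> L r st; rewrite mem_walk_roots // r !pos_w0 invg1 !perm1 st /=.
by have := ltn_ord s; have := ltn_ord t; lia.
Qed.

End Words.

(** * Connectedness of reduced words *)

Section Moves.
Variable n : nat.
Implicit Types (w : 'S_n) (i j : seq 'I_n.-1) (p q : 'I_n.-1).
Local Open Scope nat_scope.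
Local Notation pos w x := ((w^-1)%g x).

Lemma card_inversions_legal i : legal 1%g i -> #|inversions (run 1%g i)| = size i.
Proof.
move=> L; have sz w : size (map fst (walk w i)) = size i.
  by rewrite size_map; elim: i w {L} => //= p i IH w; rewrite IH.
rewrite -(sz 1%g) -(card_uniqP (uniq_walk_roots L)).
apply: eq_card => -[s t]; rewrite !inE /=.
have [st|st] := boolP (s < t).
  by rewrite mem_walk_roots // invg1 !perm1 st.
apply/esym/negbTE; apply: contra st; move: L; elim: i 1%g {sz} => //= p i IH w /andP[asc L].
by rewrite in_cons => /orP[/eqP[-> ->] //|]; apply: IH.
Qed.

Lemma legal_eq_run i j : legal 1%g i -> run 1%g j = run 1%g i -> size j = size i ->
  legal 1%g j.
Proof.
move=> L r sz; apply: legal_of_card.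
by rewrite r card_inversions_legal // inversions1 cards0 sz.
Qed.

Lemma step_comm w p q : (p.+1 < q) || (q.+1 < p) -> step (step w p) q = step (step w q) p.
Proof.
move=> far; apply/permP => x; rewrite !permM; congr (w _); apply: val_inj.
by rewrite /= !sigmaE; do !case: ifP; lia.
Qed.

Lemma step_braid w p q : (p.+1 == q :> nat) || (q.+1 == p :> nat) ->
  step (step (step w p) q) p = step (step (step w q) p) q.
Proof.
move=> adj; apply/permP => x; rewrite !permM; congr (w _); apply: val_inj.
by rewrite /= !sigmaE; do !case: ifP; lia.
Qed.

Lemma stepK w p : step (step w p) p = w.
Proof. by rewrite /step /sigma mulgA tperm2 mul1g. Qed.

Lemma move_run ix jy : move ix jy ->
  (forall w, run w jy.1 = run w ix.1) /\ size jy.1 = size ix.1.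
Proof.
case=> [u v p q x far|u v p q s t r A B C x adj _ _ _ _] /=.
  split=> [w|]; last by rewrite !size_cat.
  by rewrite !run_cat; congr (run _ v); rewrite /run /= step_comm // orbC.
split=> [w|]; last by rewrite !size_cat.
by rewrite !run_cat; congr (run _ v); rewrite /run /= [RHS]step_braid.
Qed.

Lemma move_legal i x j y : move (i, x) (j, y) -> legal 1%g i ->
  legal 1%g j /\ run 1%g j = run 1%g i.
Proof. by move=> /move_run[/= r sz] L; split=> //; apply: legal_eq_run L _ _. Qed.

Lemma transition_legal i x j y : transition i j x y -> legal 1%g i ->
  legal 1%g j /\ run 1%g j = run 1%g i.
Proof.
suff H a b : clos_refl_trans _ (@move n) a b ->
    legal 1%g a.1 -> legal 1%g b.1 /\ run 1%g b.1 = run 1%g a.1 by exact: H.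
elim=> [[? ?] [? ?]|//|a' b' c' _ IH1 _ IH2 L]; first exact: move_legal.
by have [L1 e1] := IH1 L; have [L2 e2] := IH2 L1; rewrite e2.
Qed.

Lemma size_word_roots i : size (word_roots i) = size i.
Proof. by elim: i => //= p i IH; rewrite size_map IH. Qed.

Lemma word_roots_cat i j :
  word_roots (i ++ j) =
  word_roots i ++ [seq (run 1%g i b.1, run 1%g i b.2) | b <- word_roots j].
Proof. by rewrite -(walk1_roots (i ++ j)) walk_cat map_cat walk1_roots walk_roots. Qed.

(** The roots at a window depend only on the prefix and the window, so the side condition of a braid
    move survives appending letters. *)
Lemma roots_window i j k : take (size j) (drop (size i) (word_roots (i ++ j ++ k))) =
  [seq (run 1%g i b.1, run 1%g i b.2) | b <- word_roots j].
Proof.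
rewrite word_roots_cat drop_size_cat ?size_word_roots //.
by rewrite word_roots_cat map_cat take_size_cat // size_map size_word_roots.
Qed.

Lemma move_catr i x j y k : move (i, x) (j, y) -> move (i ++ k, x) (j ++ k, y).
Proof.
suff H a b : move a b -> move (a.1 ++ k, a.2) (b.1 ++ k, b.2) by exact: (H (i, x) (j, y)).
case=> [u v p q z far|u v p q s t r A B C z adj eA eB eC rs] /=.
  by rewrite -!catA; apply: CommMove.
rewrite -!catA; apply: (BraidMove _ adj eA eB eC).
by move: rs; rewrite !(@roots_window u [:: p; q; p]).
Qed.

Lemma transition_catr i x j y k : transition i j x y -> transition (i ++ k) (j ++ k) x y.
Proof.
suff H a b : clos_refl_trans _ (@move n) a b ->
    clos_refl_trans _ (@move n) (a.1 ++ k, a.2) (b.1 ++ k, b.2) by exact: H.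
elim=> [[? ?] [? ?] m|[? ?]|a' b' c' _ h1 _ h2].
- by apply: rt_step; apply: move_catr.
- exact: rt_refl.
- exact: rt_trans h1 h2.
Qed.

(** Moves constrain the words and never the vectors, so a path of words lifts from every starting
    vector; the quantifier over [x] records this. *)
Definition joined i j := forall x, exists y, transition i j x y.

Lemma joined_refl i : joined i i.
Proof. by move=> x; exists x; apply: rt_refl. Qed.

Lemma joined_trans j i k : joined i j -> joined j k -> joined i k.
Proof.
move=> h1 h2 x; have [y hy] := h1 x; have [z hz] := h2 y.
by exists z; apply: rt_trans hy hz.
Qed.

Lemma joined_catr i j k : joined i j -> joined (i ++ k) (j ++ k).
Proof. by move=> h x; have [y hy] := h x; exists y; apply: transition_catr. Qed.

Lemma joined_comm u p q : (p.+1 < q) || (q.+1 < p) ->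
  joined (u ++ [:: p; q]) (u ++ [:: q; p]).
Proof.
move=> far x; exists x; apply: rt_step.
by have := CommMove u [::] x far; rewrite !cats0.
Qed.

Section Window.
Variables (w : 'S_n) (p q : 'I_n.-1).
Hypothesis pq : p.+1 = q :> nat.
Let a := w (lo p).
Let b := w (hi p).
Let c := w (hi q).
Let S := chain w p.

Lemma lo_hi : lo q = hi p. Proof. by apply: val_inj; rewrite /= pq. Qed.

(** The words [p q p] and [q p q] sweep the same hexagon with bottom vertex [S]. Its inner vertex is
    [b |: S] here, and [S] with [a] and [c] added in [walk_down]. *)
Lemma walk_up : walk w [:: p; q; p] = [:: (a, b, S); (a, c, b |: S); (b, c, S)].
Proof.
have b1 : step w p (hi q) = c by rewrite step_out //= -pq; lia.
have b2 : step w p (lo q) = a by rewrite lo_hi step_hi.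
have b3 : step (step w p) q (lo p) = b by rewrite step_out ?step_lo //= -?pq; lia.
have b4 : step (step w p) q (hi p) = c by rewrite -lo_hi step_lo.
have c1 : chain (step w p) q = b |: S by rewrite -pq chain_step_eq.
have c2 : chain (step (step w p) q) p = S by rewrite !chain_step //; lia.
by rewrite /= b1 b2 b3 b4 c1 c2.
Qed.

Lemma walk_down : walk w [:: q; p; q] = [:: (b, c, a |: S); (a, c, S); (a, b, c |: S)].
Proof.
have b0 : w (lo q) = b by rewrite lo_hi.
have b1 : step w q (hi p) = c by rewrite -lo_hi step_lo.
have b2 : step w q (lo p) = a by rewrite step_out //= -pq; lia.
have b3 : step (step w q) p (hi q) = b by rewrite step_out ?step_hi ?b0 //= -?pq; lia.
have b4 : step (step w q) p (lo q) = a by rewrite lo_hi step_hi.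
have c1 : chain w q = a |: S by rewrite -pq chainS_lo.
have c2 : chain (step w q) p = S by rewrite chain_step //; lia.
have c3 : chain (step (step w q) p) q = c |: S by rewrite -pq chain_step_eq b1 c2.
by rewrite /= b0 b1 b2 b3 b4 c1 c2 c3.
Qed.

Lemma ascents_up : legal w [:: p; q; p] -> (a < b) && (b < c).
Proof.
have b3 : step (step w p) q (lo p) = b by rewrite step_out ?step_lo //= -?pq; lia.
have b4 : step (step w p) q (hi p) = c by rewrite -lo_hi step_lo step_out //= -pq; lia.
by rewrite /= /ascent b3 b4 -/a -/b => /and3P[-> _ /andP[-> _]].
Qed.

Lemma ascents_down : legal w [:: q; p; q] -> (a < b) && (b < c).
Proof.
have b0 : w (lo q) = b by rewrite lo_hi.
have b1 : step w q (hi p) = c by rewrite -lo_hi step_lo.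
have b3 : step (step w q) p (hi q) = b by rewrite step_out ?step_hi ?b0 //= -?pq; lia.
have b4 : step (step w q) p (lo q) = a by rewrite lo_hi step_hi step_out //= -pq; lia.
by rewrite /= /ascent b0 b3 b4 -/c => /and3P[-> _ /andP[-> _]].
Qed.

Lemma window_notin : [/\ a \notin S, b \notin S & c \notin S].
Proof. by rewrite !notin_chain /= -pq; split; lia. Qed.

End Window.

Lemma walk_comm w p q : (p.+1 < q) || (q.+1 < p) ->
  walk w [:: p; q] = rev (walk w [:: q; p]).
Proof.
move=> far; rewrite /= /rev /= !step_out; rewrite ?val_lo ?val_hi; try lia.
by rewrite !chain_step //; lia.
Qed.

(** Legality gives [a < b < c] for the three labels involved, hence the three positive roots that a
    braid move demands. *)
Lemma joined_braid u p q : (p.+1 == q :> nat) || (q.+1 == p :> nat) ->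
  legal 1%g (u ++ [:: p; q; p]) -> joined (u ++ [:: p; q; p]) (u ++ [:: q; p; q]).
Proof.
move=> adj; rewrite legal_cat => /andP[_ L] x.
suff [s [t [r [A [B [C [eA eB eC rs]]]]]]] : exists s t r (A B C : pos_root n),
  [/\ val A = (s, t), val B = (s, r), val C = (t, r) &
      (let rs := take 3 (drop (size u) (word_roots (u ++ [:: p; q; p] ++ [::]))) in
        rs = [:: val A; val B; val C] \/ rs = [:: val C; val B; val A])].
  exists (braid_coord A B C x); apply: rt_step.
  by have := BraidMove x adj eA eB eC rs; rewrite !cats0.
rewrite /= (@roots_window u [:: p; q; p]) -walk_roots.
have mk (s t : 'I_n) : s < t -> exists A : pos_root n, val A = (s, t).
  by move=> st; exists (exist _ (s, t) st).
case/orP: adj => /eqP pq.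
  have /andP[h1 h2] := ascents_up pq L.
  have [A eA] := mk _ _ h1; have [B eB] := mk _ _ (ltn_trans h1 h2); have [C eC] := mk _ _ h2.
  by do 3!eexists; exists A, B, C; split; [exact: eA|exact: eB|exact: eC|left; rewrite walk_up //= eA eB eC].
have /andP[h1 h2] := ascents_down pq L.
have [A eA] := mk _ _ h1; have [B eB] := mk _ _ (ltn_trans h1 h2); have [C eC] := mk _ _ h2.
by do 3!eexists; exists A, B, C; split; [exact: eA|exact: eB|exact: eC|right; rewrite walk_down //= eA eB eC].
Qed.

(** The exchange argument behind the connectedness of reduced words, by induction on the length. A
    last letter [c] far from [p] is commuted past it; if [c] is adjacent to [p], the word is brought
    to end in [c p c], which a braid move turns into [p c p]. *)
Lemma descent_word i p : legal 1%g i -> run 1%g i (hi p) < run 1%g i (lo p) ->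
  exists j, [/\ legal 1%g (rcons j p), run 1%g (rcons j p) = run 1%g i
    & joined i (rcons j p)].
Proof.
have [m] := ubnP (size i); elim: m i p => // m IH i p.
case/lastP: i => [|i c] sz L; first by rewrite /run /= !perm1 /=; lia.
rewrite size_rcons in sz; move=> desc.
have [->|ne] := eqVneq p c; first by exists i; split=> //; apply: joined_refl.
have Li : legal 1%g i by move: L; rewrite -cats1 legal_cat => /andP[].
have asc : ascent (run 1%g i) c.
  by move: L; rewrite -cats1 legal_cat /= andbT => /andP[].
have rE : run 1%g (rcons i c) = step (run 1%g i) c by rewrite -cats1 run_cat.
rewrite rE in desc.
set w1 := run 1%g i in rE desc asc.
have fin j : run 1%g j = run 1%g (rcons i c) -> size j = size (rcons i c) ->
    legal 1%g j by move=> r s; apply: legal_eq_run L _ _.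
have nepc : p != c :> nat by [].
have [far|] := boolP ((p.+1 < c) || (c.+1 < p)).
  have desc1 : w1 (hi p) < w1 (lo p).
    by move: desc; rewrite !(@step_out _ w1) // ?val_lo ?val_hi; lia.
  have [j [Lj rj jj]] := IH i p sz Li desc1.
  have eqr : run 1%g (rcons (rcons j c) p) = run 1%g (rcons i c).
    rewrite rE /w1 -rj -!cats1 -!catA !run_cat /run /= step_comm //.
    by rewrite orbC.
  have jn : joined (rcons i c) (rcons (rcons j c) p).
    rewrite -!cats1 -catA; apply: (joined_trans (j := rcons j p ++ [:: c])).
      exact: joined_catr.
    by rewrite -cats1 -catA; apply: joined_comm.
  have szj : size (rcons j p) = size i.
    by rewrite -(card_inversions_legal Lj) rj card_inversions_legal.
  exists (rcons j c); split=> //; apply: fin => //.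
  by move: szj; rewrite !size_rcons => ->.
move=> near; have adj : (p.+1 == c :> nat) || (c.+1 == p :> nat) by move: near; lia.
(* The three entries at the places of [p] and [c] are decreasing after the last letter. Removing
   that letter leaves a descent at [p], and undoing this one leaves a descent at [c], so the
   induction hypothesis applies twice. *)
have desc1 : w1 (hi p) < w1 (lo p).
  case/orP: adj => /eqP e; have ec := lo_hi e; move: desc asc; rewrite /ascent.
    by rewrite -ec step_lo (@step_out _ w1 c (lo p)) ?val_lo; lia.
  by rewrite ec step_hi (@step_out _ w1 c (hi p)) ?val_hi; lia.
have [j [Lj rj jj]] := IH i p sz Li desc1.
have szj : size (rcons j p) = size i.
  by rewrite -(card_inversions_legal Lj) rj card_inversions_legal.
rewrite size_rcons in szj.
have Lj' : legal 1%g j by move: Lj; rewrite -cats1 legal_cat => /andP[].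
have rj' : run 1%g j = step w1 p.
  by rewrite /w1 -rj -cats1 run_cat /run /= stepK.
have desc2 : run 1%g j (hi c) < run 1%g j (lo c).
  rewrite rj'; case/orP: adj => /eqP e; have ec := lo_hi e.
    have e1 : step w1 c (hi p) = w1 (hi c) by rewrite -ec step_lo.
    have e2 : step w1 c (lo p) = w1 (lo p) by rewrite step_out // ?val_lo; lia.
    have e3 : step w1 p (hi c) = w1 (hi c) by rewrite step_out // ?val_hi; lia.
    have e4 : step w1 p (lo c) = w1 (lo p) by rewrite ec step_hi.
    by rewrite e3 e4 -e1 -e2.
  have e1 : step w1 c (hi p) = w1 (hi p) by rewrite step_out // ?val_hi; lia.
  have e2 : step w1 c (lo p) = w1 (lo c) by rewrite ec step_hi.
  have e3 : step w1 p (hi c) = w1 (hi p) by rewrite -ec step_lo.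
  have e4 : step w1 p (lo c) = w1 (lo c) by rewrite step_out // ?val_lo; lia.
  by rewrite e3 e4 -e1 -e2.
have szj' : size j < m by lia.
have [k [Lk rk jk]] := IH j c szj' Lj' desc2.
have jn1 : joined (rcons i c) (k ++ [:: c; p; c]).
  rewrite -cats1; apply: (joined_trans (j := (j ++ [:: p]) ++ [:: c])).
    by apply: joined_catr; rewrite cats1.
  by rewrite -catA; have := joined_catr [:: p; c] jk; rewrite -cats1 -catA.
have [x hx] := jn1 [ffun=> 0].
have [Lr rr] := transition_legal hx L.
exists (k ++ [:: p; c]); rewrite -cats1 -catA.
have adj' : (c.+1 == p :> nat) || (p.+1 == c :> nat) by rewrite orbC.
have jn2 := joined_braid adj' Lr.
have jn := joined_trans jn1 jn2; split=> //.
  by have [y hy] := jn [ffun=> 0]; have [] := transition_legal hy L.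
by have [y hy] := jn [ffun=> 0]; have [] := transition_legal hy L.
Qed.

End Moves.

(* The hexagon with bottom vertex S and labels s < t < u is subdivided by the
   vertex S + t in T and by the vertex S + s + u in T'. *)
Definition hexagon (n : nat) (T T' : {set tile n}) (A B C : pos_root n)
    (S : {set 'I_n}) (s t u : 'I_n) : Prop :=
  [/\ val A = (s, t), val B = (s, u), val C = (t, u),
      [/\ s \notin S, t \notin S & u \notin S]
    & exists T0 : {set tile n},
      [/\ T = [set (A, S); (B, t |: S); (C, S)] :|: T0,
          T' = [set (C, s |: S); (B, S); (A, u |: S)] :|: T0
        & forall X, X \in T0 ->
          [/\ tile_root X \notin [:: A; B; C], t |: S \notin tile_verts X
            & s |: (u |: S) \notin tile_verts X]]].

(** * Braid moves as hexagon flips *)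

Section Hexagons.
Variable n : nat.
Implicit Types (w : 'S_n) (i j : seq 'I_n.-1) (p q : 'I_n.-1).
Local Open Scope nat_scope.
Local Notation pos w x := ((w^-1)%g x).

Definition upper_count (l : nat) (V : {set 'I_n}) := #|[set x in V | l <= x]|.

Lemma upper_countU1 l (x : 'I_n) (V : {set 'I_n}) : x \notin V ->
  upper_count l (x |: V) = (l <= x) + upper_count l V.
Proof.
move=> xV; rewrite /upper_count; have [lx|lx] := boolP (l <= x).
  rewrite (_ : [set y in x |: V | l <= y] = x |: [set y in V | l <= y]).
    by rewrite cardsU1 inE (negbTE xV).
  by apply/setP => y; rewrite !inE; case: eqP => [->|//]; rewrite lx.
apply: eq_card => y; rewrite !inE; case: eqP => [->|//].
by rewrite (negbTE lx) !andbF.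
Qed.

(** A legal step replaces one label of the vertex at level [p.+1] by a larger one, so at each level
    the number of labels above a threshold never decreases. This separates what is swept before a
    hexagon from what is swept after it. *)
Lemma upper_count_step l w p k : ascent w p ->
  upper_count l (chain w k) <= upper_count l (chain (step w p) k).
Proof.
move=> asc; have [->|ne] := eqVneq k p.+1; last by rewrite chain_step.
rewrite chain_step_eq chainS_lo !upper_countU1 ?notin_chain //= ?leqnSn //.
by move: asc; rewrite /ascent; lia.
Qed.

Lemma upper_count_run l w i k : legal w i ->
  upper_count l (chain w k) <= upper_count l (chain (run w i) k).
Proof.
elim: i w => //= p i IH w /andP[asc L].
exact: leq_trans (upper_count_step l k asc) (IH _ L).
Qed.

Lemma walk_split w i X : X \in walk w i ->
  exists i1 p i2, [/\ i = i1 ++ p :: i2, X.1 = (run w i1 (lo p), run w i1 (hi p))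
    & X.2 = chain (run w i1) p].
Proof.
elim: i w => //= p i IH w; rewrite in_cons => /orP[/eqP ->|].
  by exists [::], p, i.
by move/IH => [i1 [q [i2 [-> h1 h2]]]]; exists (p :: i1), q, i2.
Qed.

(** Bottom, left and top vertex lie on the path before the step and the right vertex on the path
    after it, so statements about vertices reduce to [chain]s of prefixes. *)
Lemma vert_walk w i (X : tile n) (V : {set 'I_n}) : (val X.1, X.2) \in walk w i -> V \in tile_verts X ->
  exists i1 i2 k, [/\ i = i1 ++ i2, k <= n & V = chain (run w i1) k].
Proof.
move=> /walk_split [i1 [p [i2 [-> e1 e2]]]].
have {}e1 : val X.1 = _ := e1; have {}e2 : X.2 = _ := e2.
have pn : p.+2 <= n by case: (n) p {X V w i1 i2 e1 e2} => [[]|m] //= p; apply: leq_trans (ltn_ord p) _.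
rewrite /tile_verts /tile_left /tile_right /tile_s /tile_t e1 e2 [(_, _).1]/= [(_, _).2]/= !inE -!orbA.
rewrite -chainS_lo -chain_step_eq => /or4P[] /eqP ->.
- by exists i1, (p :: i2), (nat_of_ord p); split=> //; lia.
- by exists i1, (p :: i2), p.+1; split=> //; lia.
- exists (rcons i1 p), i2, p.+1; rewrite -cats1 -catA run_cat; split=> //; lia.
- exists i1, (p :: i2), p.+2; split=> //.
  by rewrite chain_step_eq chainS_hi chainS_lo finset.setUCA.
Qed.

Lemma mem_word_tiling i (X : tile n) : (X \in word_tiling i) = ((val X.1, X.2) \in walk 1%g i).
Proof. by rewrite inE. Qed.

Lemma upper_countU l (x : 'I_n) (V : {set 'I_n}) : x \notin V ->
  upper_count l (x |: V) = if l <= x then (upper_count l V).+1 else upper_count l V.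
Proof. by move=> xV; rewrite upper_countU1 //; case: (l <= x). Qed.

(** The point is that no other rhombus meets an inner vertex. At level [p.+1] the path visits [S]
    plus the smallest label before the hexagon and [S] plus the largest one after it; by
    monotonicity of [upper_count] it visits [S] plus the middle label neither earlier nor later.
    Level [p.+2] is treated likewise. *)
Lemma hexagon_word u v p q (A B C : pos_root n) : p.+1 = q :> nat ->
  let w := run 1%g u in
  legal 1%g (u ++ [:: p; q; p] ++ v) ->
  val A = (w (lo p), w (hi p)) -> val B = (w (lo p), w (hi q)) ->
  val C = (w (hi p), w (hi q)) ->
  hexagon (word_tiling (u ++ [:: p; q; p] ++ v))
          (word_tiling (u ++ [:: q; p; q] ++ v)) A B C (chain w p)
          (w (lo p)) (w (hi p)) (w (hi q)).
Proof.
move=> pq w; rewrite legal_cat => /andP[Lu]; rewrite -/w legal_cat => /andP[L3 Lv].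
move=> eA eB eC.
have [sS tS uS] := window_notin w pq; have /andP[st tu] := ascents_up pq L3.
have W1 := walk_up w pq; have W2 := walk_down w pq.
set S := chain w p in sS tS uS W1 W2 *.
set s := w (lo p) in sS eA eB st W1 W2 *; set t := w (hi p) in tS eA eC st tu W1 W2 *.
set r := w (hi q) in uS eB eC tu W1 W2 *.
have pn : p.+3 <= n by rewrite pq; case: (n) q {p pq S s t r w W1 W2 sS tS uS st tu A B C eA eB eC Lu Lv L3 u v} => [[]|m] //= q; have := ltn_ord q; rewrite /=; lia.
have cS : #|S| = p by rewrite card_chain //; lia.
have c1 : chain w p.+1 = s |: S by rewrite chainS_lo.
have c2 : chain w p.+2 = t |: (s |: S) by rewrite chainS_hi c1.
have re : run w [:: p; q; p] = run w [:: q; p; q].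
  by rewrite /run /= step_braid //; rewrite pq eqxx.
set w3 := run w [:: p; q; p] in re Lv *.
have d1 : chain w3 p.+1 = r |: S.
  rewrite re /w3 /run /= chain_step; last by lia.
  by rewrite chain_step_eq chain_step; [rewrite -(lo_hi pq) step_lo|lia].
have d2 : chain w3 p.+2 = t |: (r |: S).
  have pq2 : p.+2 = q.+1 by lia.
  rewrite pq2 re /run /= chain_step_eq (_ : step (step w q) p (hi q) = t); last first.
    by rewrite step_out ?step_hi ?(lo_hi pq) //=; lia.
  congr (_ |: _).
  by rewrite -pq chain_step_eq chain_step; [rewrite -(lo_hi pq) step_lo|lia].
have L' : legal 1%g (u ++ [:: p; q; p] ++ v) by rewrite !legal_cat Lu L3.
have U' := uniq_walk_roots L'.
split=> //.
exists [set X : tile n | (val X.1, X.2) \in walk 1%g u ++ walk w3 v]; split.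
- apply/setP => X; rewrite mem_word_tiling !inE !walk_cat -/w -/w3 W1 !mem_cat !in_cons in_nil orbF.
  case: X => R V; rewrite -eA -eB -eC !xpair_eqE /= !val_eqE.
  by rewrite -!orbA; case: (_ \in walk 1%g u); rewrite ?orbT.
- apply/setP => X; rewrite mem_word_tiling !inE !walk_cat -/w -re -/w3 W2 !mem_cat !in_cons in_nil orbF.
  case: X => R V; rewrite -eA -eB -eC !xpair_eqE /= !val_eqE.
  by rewrite -!orbA; case: (_ \in walk 1%g u); rewrite ?orbT.
move=> X; rewrite inE => XT; split.
- move: U'; rewrite !walk_cat -/w W1 !map_cat uniq_catCA cat_uniq => /and3P[_ /hasPn h _].
  have /h : val X.1 \in map fst (walk 1%g u) ++ map fst (walk w3 v).
    by rewrite -map_cat; apply/mapP; exists (val X.1, X.2).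
  by rewrite /= -eA -eB -eC !inE !(inj_eq val_inj).
- apply/negP => VX; move: XT; rewrite mem_cat => /orP[XT|XT].
    have [i1 [i2 [k [ei kn eV]]]] := vert_walk XT VX.
    have ek : k = p.+1 by rewrite -(card_chain (run 1%g i1) kn) -eV cardsU1 tS cS.
    have Li : legal (run 1%g i1) i2 by move: Lu; rewrite ei legal_cat => /andP[].
    have := upper_count_run t k Li; rewrite -run_cat -ei -/w -eV ek c1 !upper_countU //.
    by rewrite leqnn (leqNgt t s) st ltnn.
  have [i1 [i2 [k [ei kn eV]]]] := vert_walk XT VX.
  have ek : k = p.+1 by rewrite -(card_chain (run w3 i1) kn) -eV cardsU1 tS cS.
  have Li : legal w3 i1 by move: Lv; rewrite ei legal_cat => /andP[].
  have := upper_count_run r k Li; rewrite -eV ek d1 !upper_countU //.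
  by rewrite leqnn (leqNgt r t) tu ltnn.
apply/negP => VX; have stu : s \notin r |: S.
  by rewrite in_setU1 (negbTE sS) orbF -val_eqE neq_ltn (ltn_trans st tu).
have ttu : t \notin r |: S by rewrite in_setU1 (negbTE tS) orbF -val_eqE neq_ltn tu.
have tts : t \notin s |: S by rewrite in_setU1 (negbTE tS) orbF -val_eqE neq_ltn st orbT.
have csr : #|s |: (r |: S)| = p.+2 by rewrite !cardsU1 stu uS cS.
move: XT; rewrite mem_cat => /orP[XT|XT].
  have [i1 [i2 [k [ei kn eV]]]] := vert_walk XT VX.
  have ek : k = p.+2 by rewrite -(card_chain (run 1%g i1) kn) -eV.
  have Li : legal (run 1%g i1) i2 by move: Lu; rewrite ei legal_cat => /andP[].
  have := upper_count_run r k Li; rewrite -run_cat -ei -/w -eV ek c2 !upper_countU //.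
  by rewrite leqnn (leqNgt r s) (leqNgt r t) tu (ltn_trans st tu) /= ltnn.
have [i1 [i2 [k [ei kn eV]]]] := vert_walk XT VX.
have ek : k = p.+2 by rewrite -(card_chain (run w3 i1) kn) -eV.
have Li : legal w3 i1 by move: Lv; rewrite ei legal_cat => /andP[].
have := upper_count_run t k Li; rewrite -eV ek d2 !upper_countU //.
by rewrite leqnn (ltnW tu) (leqNgt t s) st /= ltnn.
Qed.

End Hexagons.

Section MoveFun.
Variable n : nat.
Implicit Types (w : 'S_n) (i j : seq 'I_n.-1) (p q : 'I_n.-1).
Implicit Types (x y z : {ffun pos_root n -> nat}).
Local Open Scope nat_scope.

Lemma braid_coordK (A B C : pos_root n) (s t u : 'I_n) :
  val A = (s, t) -> val B = (s, u) -> val C = (t, u) ->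
  involutive (braid_coord A B C).
Proof.
move=> eA eB eC x.
have st : s < t by have := valP A; rewrite eA.
have tu : t < u by have := valP C; rewrite eC.
have AB : (A == B) = false.
  by rewrite -val_eqE eA eB xpair_eqE eqxx /= -val_eqE ltn_eqF.
have AC : (A == C) = false.
  by rewrite -val_eqE eA eC xpair_eqE -val_eqE /= ltn_eqF.
have BC : (B == C) = false.
  by rewrite -val_eqE eB eC xpair_eqE -val_eqE /= ltn_eqF.
apply/ffunP => r; rewrite /braid_coord !ffunE !eqxx.
rewrite ![B == A]eq_sym ![C == A]eq_sym ![C == B]eq_sym !AB !AC !BC /=.
(* The minimum of the two new outer coordinates is the old middle one, which makes the formula
   self-inverse. *)
have key a b c : (a + b - minn a c + minn a c -
    minn (a + b - minn a c) (c + b - minn a c) = a /\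
    minn (a + b - minn a c) (c + b - minn a c) = b).
  by case: (leqP a c); lia.
have [kA kB] := key (x A) (x B) (x C); have [kC _] := key (x C) (x B) (x A).
case: eqP => [->|_]; first exact: kA.
case: eqP => [->|_]; first exact: kB.
by case: eqP => [->|//]; rewrite -[RHS]kC minnC [minn (x C + _ - _) _]minnC (minnC (x C)).
Qed.

Lemma word_tiling_comm u v p q : (p.+1 < q) || (q.+1 < p) ->
  word_tiling (u ++ [:: p; q] ++ v) = word_tiling (u ++ [:: q; p] ++ v).
Proof.
move=> far; apply/setP => X; rewrite !mem_word_tiling !walk_cat (walk_comm _ far) !mem_cat mem_rev.
by rewrite {2 4}/run /= step_comm.
Qed.

(** Extends one move to a map of all vectors, with the reverse move undoing it. For a braid move the
    hexagon may be flipped in either direction; the map is [braid_coord] both times. *)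
Lemma move_fun i x j y : legal 1%g i -> move (i, x) (j, y) ->
  exists f, [/\ y = f x, forall z, move (i, z) (j, f z), forall z, move (j, f z) (i, z)
    & word_tiling i = word_tiling j /\ f = id \/
      exists A B C S s t u, f = braid_coord A B C /\
        (hexagon (word_tiling i) (word_tiling j) A B C S s t u \/
         hexagon (word_tiling j) (word_tiling i) A B C S s t u)].
Proof.
suff H a b : move a b -> legal 1%g a.1 ->
  exists f, [/\ b.2 = f a.2, forall z, move (a.1, z) (b.1, f z), forall z, move (b.1, f z) (a.1, z)
    & word_tiling a.1 = word_tiling b.1 /\ f = id \/
      exists A B C S s t u, f = braid_coord A B C /\
        (hexagon (word_tiling a.1) (word_tiling b.1) A B C S s t u \/
         hexagon (word_tiling b.1) (word_tiling a.1) A B C S s t u)].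
  by move=> L m; have := H _ _ m L.
case=> [u v p q z far|u v p q s t r A B C z adj eA eB eC rs] L /=.
  exists id; split=> // [z'|z'|]; [exact: CommMove| |left].
    by apply: CommMove; rewrite orbC.
  by split=> //; apply: word_tiling_comm.
have hK := braid_coordK eA eB eC.
have st : s < t by have := valP A; rewrite eA.
have tr : t < r by have := valP C; rewrite eC.
exists (braid_coord A B C); split=> // [z'|z'|].
- exact: BraidMove adj eA eB eC rs.
- suff rs' : let rs := take 3 (drop (size u) (word_roots (u ++ [:: q; p; q] ++ v))) in
     rs = [:: val A; val B; val C] \/ rs = [:: val C; val B; val A].
    rewrite -{2}(hK z'); apply: BraidMove eA eB eC rs'.
    by rewrite orbC.
  move: rs; rewrite !(@roots_window _ u [:: p; q; p]) !(@roots_window _ u [:: q; p; q]).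
  rewrite -!walk_roots; case/orP: adj => /eqP pq; rewrite !(walk_up _ pq) !(walk_down _ pq) /=.
    by case=> -[-> -> ->]; [right|left].
  by case=> -[-> -> ->]; [right|left].
right; move: rs; rewrite (@roots_window _ u [:: p; q; p]) -walk_roots.
move: (L); rewrite legal_cat => /andP[_]; rewrite legal_cat => /andP[L3 _].
case/orP: adj => /eqP pq.
  rewrite (walk_up _ pq) /=; have /andP[ab bc] := ascents_up pq L3.
  rewrite eA eB eC; case=> [[es et _ er _ _]|[es et _ _ _ er]]; last first.
    by move: ab bc; rewrite es er; lia.
  exists A, B, C, (chain (run 1%g u) p), s, t, r; split=> //; left.
  have := @hexagon_word _ u v p q A B C pq L.
  by rewrite /= es et er -eA -eB -eC; apply.
have /andP[ab bc] := ascents_down pq L3.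
rewrite (walk_down _ pq) /=.
rewrite eA eB eC; case=> [[e1 e2 _ _ e3 _]|[et er es _ _ _]].
  by move: ab bc; rewrite e3 -?e2 ?e1; lia.
exists A, B, C, (chain (run 1%g u) q), s, t, r; split=> //; right.
have L' : legal 1%g (u ++ [:: q; p; q] ++ v).
  apply: legal_eq_run L _ _; last by rewrite !size_cat.
  rewrite !run_cat; congr (run _ v); rewrite /run /= step_braid //.
  by rewrite pq eqxx.
have := @hexagon_word _ u v q p A B C pq L'.
by rewrite /= es et er -eA -eB -eC; apply.
Qed.

End MoveFun.

(** * Configurations and hexagon flips *)

Section Configurations.
Variable n : nat.
Implicit Types (a : 'I_n.-1) (T : {set tile n}) (X : tile n) (V : {set 'I_n}).
Implicit Types (c : {set {set 'I_n}}) (x y : {ffun pos_root n -> nat}).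

Definition tile_top X : {set 'I_n} := tile_s X |: (tile_t X |: X.2).
Definition region a : {set {set 'I_n}} := [set V : {set 'I_n} | (hi a \in V) && (lo a \notin V)].
Definition right_vertex a : {set 'I_n} := [set j : 'I_n | (a < j)%N].

(* The closure rules for a configuration, where [g] says that the label of the
   edge is above [a]: adding a label above [a], or removing one below [a], stays
   in the configuration, and so does going from the right to the left vertex of a
   tile whose labels are on the same side of [a]. *)
Definition edge_cond (g r1 r2 c1 c2 : bool) :=
  r1 ==> r2 ==> if g then c1 ==> c2 else c2 ==> c1.

Definition rhombus_cond (g1 g2 rb rl rr rt cb cl cr ct : bool) :=
  [&& edge_cond g1 rb rl cb cl, edge_cond g2 rb rr cb cr,
      edge_cond g2 rl rt cl ct, edge_cond g1 rr rt cr ct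
    & rl ==> rr ==> (g1 == g2) ==> cr ==> cl].

Definition tile_cond a c X :=
  rhombus_cond (a < tile_s X)%N (a < tile_t X)%N
    (X.2 \in region a) (tile_left X \in region a)
    (tile_right X \in region a) (tile_top X \in region a)
    (X.2 \in c) (tile_left X \in c) (tile_right X \in c) (tile_top X \in c).

Definition config a T : {set {set {set 'I_n}}} :=
  [set c : {set {set 'I_n}} | [&& c \subset region a, c \subset \bigcup_(X in T) tile_verts X,
    right_vertex a \in c & [forall X in T, tile_cond a c X]]].

Definition rexp c X : int :=
  (tile_left X \in c)%:Z + (tile_right X \in c)%:Z
  - (X.2 \in c)%:Z - (tile_top X \in c)%:Z.

Definition slope c X : int := (tile_right X \in c)%:Z - (tile_left X \in c)%:Z.

Definition height T c x : int := \sum_(X in T) (x (tile_root X))%:Z * slope c X.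

Definition greatest a T x c : Prop :=
  [/\ c \in config a T,
      forall c', c' \in config a T -> height T c' x <= height T c x
    & forall c', c' \in config a T -> height T c' x = height T c x -> c' \subset c].

(** The combinatorial rule for [x' = f_a^* x]. It is kept as a relation, so that no maximizer has to
    be constructed at this stage. *)
Definition shifted a T x x' : Prop := exists c,
  greatest a T x c /\
  forall X, X \in T -> (x' (tile_root X))%:Z = (x (tile_root X))%:Z + rexp c X.

Lemma in_region a V : (V \in region a) = (hi a \in V) && (lo a \notin V).
Proof. by rewrite inE. Qed.

Lemma tile_vertsE X : tile_verts X = [set X.2; tile_left X; tile_right X; tile_top X].
Proof. by []. Qed.

Lemma tile_vertsP X V : reflect [\/ V = X.2, V = tile_left X, V = tile_right X | V = tile_top X]
  (V \in tile_verts X).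
Proof.
rewrite tile_vertsE !inE -!orbA.
by apply: (iffP or4P) => -[/eqP|/eqP|/eqP|/eqP] h; [constructor 1|constructor 2|constructor 3|constructor 4|constructor 1|constructor 2|constructor 3|constructor 4].
Qed.

Lemma edge_condUI (g r1 r2 c1 c2 d1 d2 : bool) :
  edge_cond g r1 r2 c1 c2 -> edge_cond g r1 r2 d1 d2 ->
  edge_cond g r1 r2 (c1 || d1) (c2 || d2) && edge_cond g r1 r2 (c1 && d1) (c2 && d2).
Proof. by move: g r1 r2 c1 c2 d1 d2 => [] [] [] [] [] [] []. Qed.

Lemma rhombus_condUI (g1 g2 rb rl rr rt cb cl cr ct db dl dr dt : bool) :
  rhombus_cond g1 g2 rb rl rr rt cb cl cr ct ->
  rhombus_cond g1 g2 rb rl rr rt db dl dr dt ->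
  rhombus_cond g1 g2 rb rl rr rt (cb || db) (cl || dl) (cr || dr) (ct || dt) &&
  rhombus_cond g1 g2 rb rl rr rt (cb && db) (cl && dl) (cr && dr) (ct && dt).
Proof.
rewrite /rhombus_cond => /and5P[a1 a2 a3 a4 a5] /and5P[b1 b2 b3 b4 b5].
have /andP[-> ->] := edge_condUI a1 b1; have /andP[-> ->] := edge_condUI a2 b2.
have /andP[-> ->] := edge_condUI a3 b3; have /andP[-> ->] := edge_condUI a4 b4.
move: a5 b5; clear; case: rl => //=; case: rr => //=; case: (g1 == g2) => //=.
by case: cr; case: cl => //; case: dr; case: dl.
Qed.

(** For a given tile every closure rule is an implication from the membership of one vertex to that
    of another, and such implications pass to unions and intersections. *)
Lemma config_setUI a T c c' : c \in config a T -> c' \in config a T ->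
  (c :|: c' \in config a T) && (c :&: c' \in config a T).
Proof.
rewrite !inE => /and4P[r1 v1 b1 /forall_inP h1] /and4P[r2 v2 b2 /forall_inP h2].
rewrite !finset.subUset r1 r2 v1 v2 b1 b2 /=.
rewrite (fintype.subset_trans (finset.subsetIl _ _) r1) (fintype.subset_trans (finset.subsetIl _ _) v1) /=.
apply/andP; split; apply/forall_inP => X XT; rewrite /tile_cond.
  by rewrite !finset.in_setU; have /andP[] := rhombus_condUI (h1 X XT) (h2 X XT).
by rewrite !finset.in_setI; have /andP[] := rhombus_condUI (h1 X XT) (h2 X XT).
Qed.

(** The height is a sum over the members of the configuration, hence modular. With [config_setUI] it
    follows that the maximizers are closed under union. *)
Lemma height_setUI T c c' x :
  height T (c :|: c') x + height T (c :&: c') x = height T c x + height T c' x.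
Proof.
rewrite /height -!big_split /=; apply: eq_bigr => X _; rewrite -!mulrDr; congr (_ * _).
rewrite /slope !finset.in_setU !finset.in_setI.
by case: (tile_right X \in c); case: (tile_left X \in c);
  case: (tile_right X \in c'); case: (tile_left X \in c').
Qed.

End Configurations.

(* [t0], [t1] (resp. [u0], [u1]) tell whether the vertex inside the hexagon of
   [T] (resp. [T']) may be left out of, or put into, a configuration. *)
Definition balanced (cs cu cst ctu t0 t1 u0 u1 : bool) : bool :=
  let k := (cs + ctu)%N in let l := (cu + cst)%N in
  [|| [&& ~~ t0, ~~ t1, ~~ u0 & ~~ u1],
      [&& k == l.+1, t0, t1, u0 == (l == 0)%N & u1 == (l == 1)%N],
      [&& l == k.+1, u0, u1, t0 == (k == 0)%N & t1 == (k == 1)%N],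
      [&& k == l, l == 0%N, t0, ~~ t1, u0 & ~~ u1],
      [&& k == l, l == 2%N, ~~ t0, t1, ~~ u0 & u1],
      [&& k == l, l == 1%N, t0, ~~ t1, ~~ u0 & u1]
    | [&& k == l, l == 1%N, ~~ t0, t1, u0 & ~~ u1]].

Definition lower_cond (gs gt gu rS rs rt ru rst rtu rstu cS cs ct cu cst ctu cstu : bool) :=
  [&& ct ==> rt, rhombus_cond gs gt rS rs rt rst cS cs ct cst,
    rhombus_cond gs gu rt rst rtu rstu ct cst ctu cstu
  & rhombus_cond gt gu rS rt ru rtu cS ct cu ctu].

Definition upper_cond (gs gt gu rS rs ru rst rsu rtu rstu cS cs cu cst csu ctu cstu : bool) :=
  [&& csu ==> rsu, rhombus_cond gt gu rs rst rsu rstu cs cst csu cstu,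
    rhombus_cond gs gu rS rs ru rsu cS cs cu csu
  & rhombus_cond gs gt ru rsu rtu rstu cu csu ctu cstu].

Definition allb (f : bool -> bool) := if f true then f false else false.

Lemma allbP f : allb f = true -> forall b, f b.
Proof. by rewrite /allb; case e: (f true) => // h [] //; rewrite e. Qed.

(** The bits [gs], [gt], [gu] tell which labels exceed [a]; those starting with [h] (with [l]) tell
    whether [a+1] (whether [a]) is [s], [t], [u] or an element of [S]. The first guard lists the
    relations between them, and the last six bits are the memberships of the six boundary vertices
    of the hexagon. Guards are [if]s, so that the evaluation does not enter excluded branches. *)
Definition hexagon_check : bool :=
  allb (fun gs => allb (fun gt => allb (fun gu =>
  allb (fun hs => allb (fun ht => allb (fun hu => allb (fun h0 =>
  allb (fun ls => allb (fun lt => allb (fun lu => allb (fun l0 =>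
  if [&& gs ==> gt, gt ==> gu, hs ==> gs, ht ==> gt && ~~ gs, hu ==> gu && ~~ gt,
         ls ==> ~~ gs && gt, lt ==> ~~ gt && gu, lu ==> ~~ gu,
         [|| hs, ht | hu] ==> ~~ h0 & [|| ls, lt | lu] ==> ~~ l0] then
  let r h l := (h0 || h) && ~~ (l0 || l) in
  let rS := r false false in
  let rs := r hs ls in let rt := r ht lt in let ru := r hu lu in
  let rst := r (hs || ht) (ls || lt) in let rsu := r (hs || hu) (ls || lu) in
  let rtu := r (ht || hu) (lt || lu) in
  let rstu := r [|| hs, ht | hu] [|| ls, lt | lu] in
  allb (fun cS => allb (fun cs => allb (fun cu =>
  allb (fun cst => allb (fun ctu => allb (fun cstu =>
  if [&& cS ==> rS, cs ==> rs, cu ==> ru, cst ==> rst, ctu ==> rtu & cstu ==> rstu] then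
    let tc b := lower_cond gs gt gu rS rs rt ru rst rtu rstu cS cs b cu cst ctu cstu in
    let uc b := upper_cond gs gt gu rS rs ru rst rsu rtu rstu cS cs cu cst b ctu cstu in
    balanced cs cu cst ctu (tc false) (tc true) (uc false) (uc true)
  else true))))))
  else true))))))))))).

Lemma hexagon_checkP : hexagon_check = true.
Proof. by vm_compute. Qed.

Section LocalHexagon.
Variables (n : nat) (a : 'I_n.-1) (S : {set 'I_n}) (s t u : 'I_n).
Hypotheses (st : (s < t)%N) (tu : (t < u)%N).
Hypotheses (sS : s \notin S) (tS : t \notin S) (uS : u \notin S).

Definition vs := s |: S.
Definition vt := t |: S.
Definition vu := u |: S.
Definition vst := s |: (t |: S).
Definition vsu := s |: (u |: S).
Definition vtu := t |: (u |: S).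
Definition vstu := s |: (t |: (u |: S)).

Definition lower_ok (o : {set {set 'I_n}}) (b : bool) : bool :=
  let r V := V \in region a in let c V := V \in o in
  lower_cond (a < s)%N (a < t)%N (a < u)%N (r S) (r vs) (r vt) (r vu) (r vst) (r vtu) (r vstu)
     (c S) (c vs) b (c vu) (c vst) (c vtu) (c vstu).

Definition upper_ok (o : {set {set 'I_n}}) (b : bool) : bool :=
  let r V := V \in region a in let c V := V \in o in
  upper_cond (a < s)%N (a < t)%N (a < u)%N (r S) (r vs) (r vu) (r vst) (r vsu) (r vtu) (r vstu)
     (c S) (c vs) (c vu) (c vst) b (c vtu) (c vstu).

Lemma hexagon_balanced (o : {set {set 'I_n}}) : o \subset region a ->
  balanced (vs \in o) (vu \in o) (vst \in o) (vtu \in o)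
    (lower_ok o false) (lower_ok o true) (upper_ok o false) (upper_ok o true).
Proof.
move=> /fintype.subsetP sub; rewrite /lower_ok /upper_ok.
have i V : (V \in o) ==> (V \in region a) by apply/implyP => /sub.
have h := hexagon_checkP.
have {}h := allbP h (a < s)%N; have {}h := allbP h (a < t)%N; have {}h := allbP h (a < u)%N.
have {}h := allbP h (hi a == s); have {}h := allbP h (hi a == t).
have {}h := allbP h (hi a == u); have {}h := allbP h (hi a \in S).
have {}h := allbP h (lo a == s); have {}h := allbP h (lo a == t).
have {}h := allbP h (lo a == u); have {}h := allbP h (lo a \in S).
move: h; rewrite ifT; last first.
  have ne (v x : 'I_n) : x \notin S -> v == x -> v \notin S by move=> xS /eqP ->.
  repeat (apply/andP; split).
  1-8: by rewrite -?val_eqE /=; lia.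
    by apply/implyP => /or3P[] e; apply: ne e.
  by apply/implyP => /or3P[] e; apply: ne e.
set r := fun h l => _.
have {}rS : (S \in region a) = r false false by rewrite in_region /r !orbF.
have rs : (vs \in region a) = r (hi a == s) (lo a == s).
  by rewrite in_region /r !in_setU1 ![_ || (_ \in S)]orbC.
have rt : (vt \in region a) = r (hi a == t) (lo a == t).
  by rewrite in_region /r !in_setU1 ![_ || (_ \in S)]orbC.
have ru : (vu \in region a) = r (hi a == u) (lo a == u).
  by rewrite in_region /r !in_setU1 ![_ || (_ \in S)]orbC.
have rst : (vst \in region a) = r ((hi a == s) || (hi a == t)) ((lo a == s) || (lo a == t)).
  by rewrite in_region /r !in_setU1 !orbA ![_ || (_ \in S)]orbC ?orbA.
have rsu : (vsu \in region a) = r ((hi a == s) || (hi a == u)) ((lo a == s) || (lo a == u)).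
  by rewrite in_region /r !in_setU1 !orbA ![_ || (_ \in S)]orbC ?orbA.
have rtu : (vtu \in region a) = r ((hi a == t) || (hi a == u)) ((lo a == t) || (lo a == u)).
  by rewrite in_region /r !in_setU1 !orbA ![_ || (_ \in S)]orbC ?orbA.
have rstu : (vstu \in region a) = r [|| hi a == s, hi a == t | hi a == u] [|| lo a == s, lo a == t | lo a == u].
  by rewrite in_region /r !in_setU1 !orbA ![_ || (_ \in S)]orbC ?orbA.
move: (i S) (i vs) (i vu) (i vst) (i vtu) (i vstu).
rewrite /= -rS -rs -rt -ru -rst -rsu -rtu -rstu => i1 i2 i3 i4 i5 i6 h.
have {}h := allbP h (S \in o); have {}h := allbP h (vs \in o); have {}h := allbP h (vu \in o).
have {}h := allbP h (vst \in o); have {}h := allbP h (vtu \in o); have {}h := allbP h (vstu \in o).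
by move: h; rewrite ifT // i1 i2 i3 i4 i5 i6.
Qed.

End LocalHexagon.

(** * Heights and monomials at one hexagon *)

Section LocalArithmetic.
Implicit Types (cS cs cu cst ctu cstu ct csu : bool) (x y z : nat).

Definition lower_height x y z cs cu cst ctu ct : int :=
  x%:Z * (ct%:Z - cs%:Z) + y%:Z * (ctu%:Z - cst%:Z) + z%:Z * (cu%:Z - ct%:Z).

Definition upper_height x y z cs cu cst ctu csu : int :=
  x%:Z * (ctu%:Z - csu%:Z) + y%:Z * (cu%:Z - cs%:Z) + z%:Z * (csu%:Z - cst%:Z).

(** Condenses the cases to three. If [k = l + 1] the inner vertex is free in the lower tiling and
    forced in the upper one; if [l = k + 1] the roles are exchanged; if [k = l] both are forced and
    together they number [l]. *)
Lemma balancedP cs cu cst ctu (t0 t1 u0 u1 : bool) : balanced cs cu cst ctu t0 t1 u0 u1 ->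
  forall ct csu : bool, (if ct then t1 else t0) -> (if csu then u1 else u0) ->
  let k := (cs + ctu)%N in let l := (cu + cst)%N in
  [\/ [/\ k = l.+1, l = csu :> nat, t0, t1 & (if csu then u0 else u1) = false],
      [/\ l = k.+1, k = ct :> nat, u0, u1 & (if ct then t0 else t1) = false]
    | [/\ k = l, l = (ct + csu)%N, (if ct then t0 else t1) = false
         & (if csu then u0 else u1) = false]].
Proof.
rewrite /balanced; move: (cs + ctu)%N (cu + cst)%N => k l + ct csu.
case/or4P => [/and4P[/negbTE -> /negbTE -> _ _]| | |]; first by case: ct.
- case/and5P => /eqP -> -> -> /eqP -> /eqP -> _.
  by case: csu => /eqP ->; constructor 1.
- case/and5P => /eqP -> -> -> /eqP -> /eqP ->.
  by case: ct => /eqP -> _; constructor 2.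
case/or4P => /and5P[/eqP -> /eqP -> + + /andP[+ +]].
- by move=> -> /negbTE -> -> /negbTE ->; case: ct => //; case: csu => // _ _; constructor 3.
- by move=> /negbTE -> -> /negbTE -> ->; case: ct => //; case: csu => // _ _; constructor 3.
- by move=> -> /negbTE -> /negbTE -> ->; case: ct => //; case: csu => // _ _; constructor 3.
- by move=> /negbTE -> -> -> /negbTE ->; case: ct => //; case: csu => // _ _; constructor 3.
Qed.

Lemma balanced_exists cs cu cst ctu (t0 t1 u0 u1 : bool) :
  balanced cs cu cst ctu t0 t1 u0 u1 -> (t0 || t1) = (u0 || u1).
Proof.
rewrite /balanced; case: cs; case: cu; case: cst; case: ctu => /=;
by case: t0; case: t1; case: u0; case: u1.
Qed.

(** The middle coordinate [y] cancels: only [x], [z] and the two diagonal counts matter, which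
    [balancedP] controls. *)
Lemma height_difference x y z cs cu cst ctu ct csu : let m := minn x z in
  upper_height (x + y - m) m (z + y - m) cs cu cst ctu csu
  - lower_height x y z cs cu cst ctu ct =
  (x%:Z - z%:Z) * ((cs + ctu)%N%:Z - (ct + csu)%N%:Z)
   + (m%:Z - z%:Z) * ((cu + cst)%N%:Z - (cs + ctu)%N%:Z).
Proof.
move=> m; have mx : (m <= x)%N by apply: geq_minl.
have mz : (m <= z)%N by apply: geq_minr.
rewrite /lower_height /upper_height -!subzn ?PoszD; [ring | |]; lia.
Qed.

Lemma upper_height_put x y z cs cu cst ctu csu : let m := minn x z in
  upper_height (x + y - m) m (z + y - m) cs cu cst ctu csu =
  upper_height (x + y - m) m (z + y - m) cs cu cst ctu false
  + (z%:Z - x%:Z) * csu%:Z.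
Proof.
move=> m; have mx : (m <= x)%N by apply: geq_minl.
have mz : (m <= z)%N by apply: geq_minr.
have e1 : (x + y - m)%N%:Z = x%:Z + y%:Z - m%:Z by lia.
have e2 : (z + y - m)%N%:Z = z%:Z + y%:Z - m%:Z by lia.
by rewrite /upper_height e1 e2 /=; ring.
Qed.

Lemma lower_upper_height x y z cs cu cst ctu (t0 t1 u0 u1 : bool) ct :
  balanced cs cu cst ctu t0 t1 u0 u1 -> (if ct then t1 else t0) ->
  let m := minn x z in
  exists2 csu : bool, if csu then u1 else u0 &
    lower_height x y z cs cu cst ctu ct <=
    upper_height (x + y - m) m (z + y - m) cs cu cst ctu csu.
Proof.
move=> bal ht m.
(* In the upper height the inner vertex has weight [z - x]; where both choices are admissible, it is
   included unless this is negative. *)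
pose csu := u1 && ~~ (u0 && (x > z)%N).
have hu : if csu then u1 else u0.
  have := balanced_exists bal; rewrite /csu.
  by case: (u1) => //=; [case: (u0) => //=; case: ltnP|case: ct ht => ->; rewrite ?orbT /= orbF].
exists csu => //; rewrite -subr_ge0 height_difference -/m.
have := balancedP bal ht hu; rewrite /csu in hu *; rewrite /m.
case=> [[-> -> _ _ _]|[-> -> -> -> _]|[-> -> _ _]] /=; last by rewrite !subrr !mulr0.
  by move: (_ && _) => b; case: ct {ht}; case: b; lia.
by case: (ltnP z x) => /=; case: ct {ht}; lia.
Qed.

Lemma upper_lower_height x y z cs cu cst ctu (t0 t1 u0 u1 : bool) csu :
  balanced cs cu cst ctu t0 t1 u0 u1 -> (if csu then u1 else u0) ->
  let m := minn x z in
  exists2 ct : bool, if ct then t1 else t0 &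
    upper_height (x + y - m) m (z + y - m) cs cu cst ctu csu <=
    lower_height x y z cs cu cst ctu ct.
Proof.
move=> bal hu m.
(* In the lower height the inner vertex has weight [x - z]. *)
pose ct := t1 && ~~ (t0 && (x < z)%N).
have ht : if ct then t1 else t0.
  have := balanced_exists bal; rewrite /ct.
  by case: (t1) => //=; [case: (t0) => //=; case: ltnP|case: csu hu => ->; rewrite ?orbT /= orbF].
exists ct => //; rewrite -subr_le0 height_difference -/m.
have := balancedP bal ht hu; rewrite /ct in ht *; rewrite /m.
case=> [[-> -> -> -> _]|[-> -> _ _ _]|[-> -> _ _]] /=; last by rewrite !subrr !mulr0.
  by case: (ltnP x z) => /=; case: csu {hu}; lia.
by move: (_ && _) => b; case: csu {hu}; case: b; lia.
Qed.

(* The two choices [ct] and [csu] are those of the greatest maximizers. *)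
Lemma shift_min x z x' z' cS cs cu cst ctu (t0 t1 u0 u1 : bool) ct csu :
  balanced cs cu cst ctu t0 t1 u0 u1 ->
  (if ct then t1 else t0) -> (if csu then u1 else u0) ->
  (if ct then t0 ==> (z <= x)%N else t1 ==> (x < z)%N) ->
  (if csu then u0 ==> (x <= z)%N else u1 ==> (z < x)%N) ->
  x'%:Z = x%:Z + (cs%:Z + ct%:Z - cS%:Z - cst%:Z) ->
  z'%:Z = z%:Z + (ct%:Z + cu%:Z - cS%:Z - ctu%:Z) ->
  (minn x' z')%:Z = (minn x z)%:Z + (cs%:Z + cu%:Z - cS%:Z - csu%:Z).
Proof.
move=> bal ht hu gt gu; have := balancedP bal ht hu.
move: (nat_of_bool cs) (nat_of_bool cu) (nat_of_bool cst) (nat_of_bool ctu) (nat_of_bool cS).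
move=> {bal} {}cs {}cu {}cst {}ctu {}cS.
case=> [[e1 e2 h1 h2 h3]|[e1 e2 h1 h2 h3]|[e1 e2 h1 h2]] ex ez; move: gt gu.
- by rewrite h1 h2; case: (ct) ex ez e2; case: (csu) h3 => /= -> /=; lia.
- by rewrite h1 h2; case: (csu) ex ez e2; case: (ct) h3 => /= -> /=; lia.
- by case: (csu) h2 e2 ex ez; case: (ct) h1 => /= -> -> /=; lia.
Qed.

(** The counterpart of [shift_min] for the reverse flip: here [x] and [z] are coordinates on the
    flipped side, and their minimum [m] is the middle coordinate on the other side. *)
Lemma shift_min_upper x z x' z' m cs cu cst ctu cstu (t0 t1 u0 u1 : bool) ct csu :
  balanced cs cu cst ctu t0 t1 u0 u1 ->
  (if ct then t1 else t0) -> (if csu then u1 else u0) ->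
  (if ct then t0 ==> (z <= x)%N else t1 ==> (x < z)%N) ->
  (if csu then u0 ==> (x <= z)%N else u1 ==> (z < x)%N) ->
  m = minn x z ->
  x'%:Z = x%:Z + (csu%:Z + ctu%:Z - cu%:Z - cstu%:Z) ->
  z'%:Z = z%:Z + (cst%:Z + csu%:Z - cs%:Z - cstu%:Z) ->
  (minn x' z')%:Z = m%:Z + (cst%:Z + ctu%:Z - ct%:Z - cstu%:Z).
Proof.
move=> bal ht hu gt gu ->; have := balancedP bal ht hu.
move: (nat_of_bool cs) (nat_of_bool cu) (nat_of_bool cst) (nat_of_bool ctu) (nat_of_bool cstu).
move=> {bal} {}cs {}cu {}cst {}ctu {}cstu.
case=> [[e1 e2 h1 h2 h3]|[e1 e2 h1 h2 h3]|[e1 e2 h1 h2]] ex ez; move: gt gu.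
- by rewrite h1 h2; case: (ct) ex ez e2; case: (csu) h3 => /= -> /=; lia.
- by rewrite h1 h2; case: (csu) ex ez e2; case: (ct) h3 => /= -> /=; lia.
- by case: (csu) h2 e2 ex ez; case: (ct) h1 => /= -> -> /=; lia.
Qed.

Lemma exprz_bits (K : fieldType) (v : K) (b1 b2 b3 b4 : bool) : v != 0 ->
  v ^ (b1%:Z + b2%:Z - b3%:Z - b4%:Z) = v ^+ b1 * v ^+ b2 / v ^+ b3 / v ^+ b4.
Proof. by move=> v0; rewrite !expfzDr // -!exprnN -!exprnP. Qed.

(** All monomials are compared through [q = x z / y]: over the same boundary memberships, a lower
    and an upper monomial differ by powers of [q] and [1 + q] determined by the two diagonal counts
    and the choices inside. *)
Lemma lower_upper_factor (K : fieldType) (x y z : K) cS cs cu cst ctu cstu ct csu :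
  x != 0 -> y != 0 -> z != 0 -> x * z + y != 0 ->
  let q := x * z / y in
  (x ^ (cs%:Z + ct%:Z - cS%:Z - cst%:Z) *
     y ^ (cst%:Z + ctu%:Z - ct%:Z - cstu%:Z) * z ^ (ct%:Z + cu%:Z - cS%:Z - ctu%:Z)) *
   (1 + q) ^+ (cs + ctu) * q ^+ (cu + cst) * q ^- csu =
  (((x * z + y) / z) ^ (csu%:Z + ctu%:Z - cu%:Z - cstu%:Z) *
     (x * z) ^ (cs%:Z + cu%:Z - cS%:Z - csu%:Z) *
     (y * z / (x * z + y)) ^ (cst%:Z + csu%:Z - cs%:Z - cstu%:Z)) *
   (1 + q) ^+ (cu + cst) * q ^+ ct.
Proof.
move=> x0 y0 z0 w0 q.
have -> : 1 + q = (x * z + y) / y by rewrite /q; field.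
rewrite /q; move: (x * z + y) w0 => w w0.
rewrite !exprz_bits ?mulf_neq0 ?invr_neq0 // !exprD !expr_div_n !exprMn.
by field; rewrite ?expf_neq0.
Qed.

Lemma shift_sub (x y m x' y' m' : nat) (d1 d2 d3 : int) :
  (m <= x)%N -> (m' <= x')%N ->
  x'%:Z = x%:Z + d1 -> y'%:Z = y%:Z + d2 -> m'%:Z = m%:Z + d3 ->
  (x' + y' - m')%N%:Z = (x + y - m)%N%:Z + (d1 + d2 - d3).
Proof. by move=> h h' e1 e2 e3; lia. Qed.

Lemma shift_sub_inv (x y m x' y' m' : nat) (d1 d2 d3 : int) :
  (m <= x)%N -> (m' <= x')%N ->
  x'%:Z = (x + y - m)%N%:Z + d1 -> y'%:Z = m%:Z + d2 -> m'%:Z = y%:Z + d3 ->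
  (x' + y' - m')%N%:Z = x%:Z + (d1 + d2 - d3).
Proof. by move=> h h' e1 e2 e3; lia. Qed.

(** If [k = l + 1], the two lower monomials are [1/(1+q)] and [q/(1+q)] times the one upper
    monomial. If [l = k + 1], the two upper ones are such fractions of the lower one. If [k = l],
    there is one on each side and they agree. *)
Lemma lower_upper_sum (K : fieldType) (x y z : K) cS cs cu cst ctu cstu (t0 t1 u0 u1 : bool) :
  x != 0 -> y != 0 -> z != 0 -> x * z + y != 0 ->
  balanced cs cu cst ctu t0 t1 u0 u1 ->
  let f (ct : bool) := x ^ (cs%:Z + ct%:Z - cS%:Z - cst%:Z) *
     y ^ (cst%:Z + ctu%:Z - ct%:Z - cstu%:Z) * z ^ (ct%:Z + cu%:Z - cS%:Z - ctu%:Z) in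
  let g (csu : bool) := ((x * z + y) / z) ^ (csu%:Z + ctu%:Z - cu%:Z - cstu%:Z) *
     (x * z) ^ (cs%:Z + cu%:Z - cS%:Z - csu%:Z) *
     (y * z / (x * z + y)) ^ (cst%:Z + csu%:Z - cs%:Z - cstu%:Z) in
  f false *+ t0 + f true *+ t1 = g false *+ u0 + g true *+ u1.
Proof.
move=> x0 y0 z0 w0 bal f g; pose q := x * z / y.
have qn0 : q != 0 by rewrite !mulf_neq0 ?invr_neq0.
have Pn0 : 1 + q != 0.
  by rewrite (_ : 1 + q = (x * z + y) / y) ?mulf_neq0 ?invr_neq0 // /q; field.
have fg ct csu : f ct * (1 + q) ^+ (cs + ctu) * q ^+ (cu + cst) * q ^- csu =
    g csu * (1 + q) ^+ (cu + cst) * q ^+ ct by apply: lower_upper_factor.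
have kl : (cs + ctu <= 2)%N by case: cs {f g fg bal}; case: ctu.
have ll : (cu + cst <= 2)%N by case: cu {f g fg bal}; case: cst.
move: (f) (g) fg kl ll bal; rewrite /balanced.
move: (cs + ctu)%N (cu + cst)%N => k l; clear f g => f g fg kl ll.
have P0 m : (1 + q) ^+ m != 0 by rewrite expf_neq0.
have F2 (b : bool) ct : k = b.+1 -> l = b -> f ct * (1 + q) = g b * q ^+ ct.
  move=> ek el; have := fg ct b; rewrite ek el => h.
  by apply: (mulIf (P0 b)); rewrite [RHS]mulrAC -h exprS; field; rewrite expf_neq0.
have F3 (b : bool) csu : k = b -> l = b.+1 -> f b * q = g csu * (1 + q) * q ^+ csu.
  move=> ek el; have := fg b csu; rewrite ek el exprS.
  move=> h; apply: (mulIf (P0 b)); apply: (mulIf (expf_neq0 b qn0)).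
  have -> : g csu * (1 + q) * q ^+ csu * (1 + q) ^+ b * q ^+ b =
            g csu * ((1 + q) ^+ b.+1) * q ^+ b * q ^+ csu by rewrite exprS; ring.
  by rewrite -[in RHS]h; field; rewrite expf_neq0.
have F4 (b1 b2 : bool) : k = l -> l = (b1 + b2)%N -> f b1 = g b2.
  move=> ek el; have := fg b1 b2; rewrite ek => h.
  apply: (mulIf (P0 l)); apply: (mulIf (expf_neq0 b1 qn0)); rewrite -h.
  by rewrite [in q ^+ l]el exprD; field; rewrite expf_neq0.
case/or4P => [/and4P[/negbTE -> /negbTE -> /negbTE -> /negbTE ->]| | |].
- by rewrite !mulr0n !addr0.
- case/and5P => /eqP ek -> -> /eqP -> /eqP ->; apply: (mulIf Pn0).
  have l2 : (l < 2)%N by rewrite -ltnS -ek.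
  rewrite !mulr1n mulrDl; case: l l2 ek F2 {fg F3 F4 ll} => [|[|//]] _ ek F2.
    by rewrite !(F2 false) //= !mulr1n mulr0n; ring.
  by rewrite !(F2 true) //= mulr1n mulr0n; ring.
- case/and5P => /eqP el -> -> /eqP -> /eqP ->; apply: (mulIf (mulf_neq0 Pn0 qn0)).
  have k2 : (k < 2)%N by rewrite -ltnS -el.
  rewrite !mulr1n; case: k k2 el F3 {fg F2 F4 kl} => [|[|//]] _ el F3.
    rewrite [RHS](_ : _ = g false * (1 + q) * q ^+ false * q + g true * (1 + q) * q ^+ true).
      by rewrite -(F3 false false erefl el) -(F3 false true erefl el) /= mulr1n mulr0n; ring.
    by rewrite expr0 expr1; ring.
  rewrite [RHS](_ : _ = g false * (1 + q) * q ^+ false * q + g true * (1 + q) * q ^+ true).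
    by rewrite -(F3 true false erefl el) -(F3 true true erefl el) /= mulr1n mulr0n; ring.
  by rewrite expr0 expr1; ring.
case/or4P => /and5P[/eqP ek /eqP el] + + /andP[].
- by move=> -> /negbTE -> -> /negbTE ->; rewrite !mulr0n !addr0 (F4 false false).
- by move=> /negbTE -> -> /negbTE -> ->; rewrite !mulr0n !add0r (F4 true true).
- by move=> -> /negbTE -> /negbTE -> ->; rewrite !mulr0n addr0 add0r (F4 false true).
- by move=> /negbTE -> -> -> /negbTE ->; rewrite !mulr0n addr0 add0r (F4 true false).
Qed.

End LocalArithmetic.

(** Regroups the configurations of either tiling over the same index set, the sets [o] that avoid
    both inner vertices. *)
Lemma sum_sets_put (X : finType) (V : nmodType) (z z' : X) (P : pred {set X}) (F : {set X} -> V) :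
  z != z' -> (forall c, P c -> z' \notin c) ->
  \sum_(c | P c) F c =
  \sum_(o : {set X} | (z \notin o) && (z' \notin o)) (F o *+ P o + F (z |: o) *+ P (z |: o)).
Proof.
move=> zz Pz'; rewrite big_split /= (bigID (fun c : {set X} => z \notin c)) /=; congr (_ + _).
  rewrite big_mkcond [RHS]big_mkcond; apply: eq_bigr => c _.
  case Pc: (P c); first by rewrite (Pz' c) // andbT.
  by rewrite mulr0n; case: ifP.
rewrite (reindex_onto (fun o => z |: o) (fun c => c :\ z)) /=; last first.
  by move=> c /andP[_]; rewrite negbK => zc; rewrite finset.setD1K.
rewrite big_mkcond [RHS]big_mkcond; apply: eq_bigr => o _.
rewrite negbK finset.setU11 andbT.
have -> : ((z |: o) :\ z == o) = (z \notin o).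
  apply/eqP/idP => [<-|zo]; first by rewrite finset.setD11.
  by rewrite finset.setU1K.
case zo: (z \in o); rewrite ?andbF //=.
case Po: (P _); rewrite /= ?mulr0n ?if_same // mulr1n.
by have := Pz' _ Po; rewrite in_setU1 negb_or => /andP[_ ->].
Qed.

(** If configurations correspond outside [Z] in both directions without loss of height, the maxima
    agree and so do the traces of maximizers outside [Z]. Inside [Z] only [z'] can occur, so
    greatest maximizers correspond. *)
Lemma greatest_transfer (n : nat) (a : 'I_n.-1) (T T' : {set tile n})
    (x y : {ffun pos_root n -> nat}) (Z : {set {set 'I_n}}) (z' : {set 'I_n})
    (c : {set {set 'I_n}}) :
  (forall c', c' \in config a T' -> c' :&: Z \subset [set z']) ->
  (forall c, c \in config a T -> exists2 c', c' \in config a T' &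
     c' :\: Z = c :\: Z /\ height T c x <= height T' c' y) ->
  (forall c', c' \in config a T' -> exists2 c, c \in config a T &
     c :\: Z = c' :\: Z /\ height T' c' y <= height T c x) ->
  greatest a T x c -> exists c', greatest a T' y c' /\ c' :\: Z = c :\: Z.
Proof.
move=> hZ up down [cT cmax cgr].
have [d0 d0T [d0Z le0]] := up c cT.
have eq0 : height T' d0 y = height T c x.
  apply/eqP; rewrite eq_le le0 andbT.
  by have [c1 c1T [_ le1]] := down d0 d0T; apply: le_trans le1 (cmax _ c1T).
have maxT' d : d \in config a T' -> height T' d y <= height T c x.
  by move=> dT; have [c1 c1T [_ le1]] := down d dT; apply: le_trans le1 (cmax _ c1T).
have outT' d : d \in config a T' -> height T' d y = height T c x -> d :\: Z \subset c :\: Z.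
  move=> dT dh; have [c1 c1T [<- le1]] := down d dT; apply: finset.setSD; apply: cgr => //.
  by apply/eqP; rewrite eq_le cmax // -dh.
have join d e : d \in config a T' -> height T' d y = height T c x ->
    e \in config a T' -> height T' e y = height T c x ->
    d :|: e \in config a T' /\ height T' (d :|: e) y = height T c x.
  move=> dT dh eT eh; have /andP[uT iT] := config_setUI dT eT; split=> //.
  apply/eqP; rewrite eq_le maxT' //= -(lerD2r (height T' (d :&: e) y)).
  by rewrite height_setUI dh eh lerD2l maxT'.
pose P (d : {set {set 'I_n}}) := (d \in config a T') && (height T' d y == height T c x).
(* The only possible enlargement of [d0] with the same trace is by [z']; it is made whenever the
   result is still a maximizer. *)
pose c' := if P (z' |: d0) then z' |: d0 else d0.
have [c'T c'h] : c' \in config a T' /\ height T' c' y = height T c x.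
  by rewrite /c'; case: ifP => [/andP[h1 /eqP h2]|_].
have c'0 : d0 \subset c' by rewrite /c'; case: ifP => // _; apply: finset.subsetUr.
have c'Z : c' :\: Z = c :\: Z.
  by apply/eqP; rewrite finset.eqEsubset outT' //= -d0Z finset.setSD.
exists c'; split=> //; split=> // [d dT|d dT]; first by rewrite c'h maxT'.
rewrite c'h => dh; apply/fintype.subsetP => V Vd.
have [VZ|VZ] := boolP (V \in Z); last first.
  have : V \in c :\: Z by apply: (fintype.subsetP (outT' _ dT dh)); rewrite inE VZ.
  by rewrite -c'Z inE => /andP[].
have eV : V = z'.
  by apply/eqP; have := fintype.subsetP (hZ _ dT) V; rewrite !inE Vd VZ => /(_ isT).
have [uT uh] := join _ _ dT dh d0T eq0.
suff e : d :|: d0 = z' |: d0 by rewrite /c' /P -e uT uh eqxx /= e -eV !inE eqxx.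
apply/setP => W; rewrite !inE; case d0W: (W \in d0); rewrite ?orbT // !orbF.
apply/idP/eqP => [Wd|->]; last by rewrite -eV.
have [WZ|WZ] := boolP (W \in Z).
  by apply/eqP; have := fintype.subsetP (hZ _ dT) W; rewrite !inE Wd WZ => /(_ isT).
have : W \in d0 :\: Z by rewrite d0Z; apply: (fintype.subsetP (outT' _ dT dh)); rewrite inE WZ.
by rewrite inE d0W andbF.
Qed.

(** * A hexagon flip inside a tiling *)

Section Flip.
Variables (n : nat) (a : 'I_n.-1) (T T' T0 : {set tile n}) (A B C : pos_root n).
Variables (S : {set 'I_n}) (s t u : 'I_n).
Hypotheses (eA : val A = (s, t)) (eB : val B = (s, u)) (eC : val C = (t, u)).
Hypotheses (sS : s \notin S) (tS : t \notin S) (uS : u \notin S).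
Hypothesis eT : T = [set (A, S); (B, t |: S); (C, S)] :|: T0.
Hypothesis eT' : T' = [set (C, s |: S); (B, S); (A, u |: S)] :|: T0.
Hypothesis T0P : forall X, X \in T0 ->
  [/\ tile_root X \notin [:: A; B; C], t |: S \notin tile_verts X
    & s |: (u |: S) \notin tile_verts X].
Implicit Types (o c : {set {set 'I_n}}) (V W : {set 'I_n}) (X : tile n).

Local Notation VS := (vs S s).
Local Notation VT := (vt S t).
Local Notation VU := (vu S u).
Local Notation VST := (vst S s t).
Local Notation VSU := (vsu S s u).
Local Notation VTU := (vtu S t u).
Local Notation VSTU := (vstu S s t u).

Lemma flip_st : (s < t)%N. Proof. by have := valP A; rewrite eA. Qed.
Lemma flip_tu : (t < u)%N. Proof. by have := valP C; rewrite eC. Qed.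
Let st := flip_st.
Let tu := flip_tu.
Let su : (s < u)%N := ltn_trans st tu.

Lemma tile_st V : tile_s (A, V) = s /\ tile_t (A, V) = t.
Proof. by rewrite /tile_s /tile_t -[(A, V).1]/A eA. Qed.
Lemma tile_su V : tile_s (B, V) = s /\ tile_t (B, V) = u.
Proof. by rewrite /tile_s /tile_t -[(B, V).1]/B eB. Qed.
Lemma tile_tu V : tile_s (C, V) = t /\ tile_t (C, V) = u.
Proof. by rewrite /tile_s /tile_t -[(C, V).1]/C eC. Qed.

Lemma flipA1 : [/\ tile_left (A, S) = VS, tile_right (A, S) = VT & tile_top (A, S) = VST].
Proof. by rewrite /tile_left /tile_right /tile_top; have [-> ->] := tile_st S. Qed.
Lemma flipB1 : [/\ tile_left (B, VT) = VST, tile_right (B, VT) = VTU & tile_top (B, VT) = VSTU].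
Proof.
rewrite /tile_left /tile_right /tile_top; have [-> ->] := tile_su VT.
by split=> //; rewrite /vtu /vstu ?[t |: (u |: S)]finset.setUCA.
Qed.
Lemma flipC1 : [/\ tile_left (C, S) = VT, tile_right (C, S) = VU & tile_top (C, S) = VTU].
Proof. by rewrite /tile_left /tile_right /tile_top; have [-> ->] := tile_tu S. Qed.
Lemma flipC2 : [/\ tile_left (C, VS) = VST, tile_right (C, VS) = VSU & tile_top (C, VS) = VSTU].
Proof.
rewrite /tile_left /tile_right /tile_top; have [-> ->] := tile_tu VS.
split; rewrite /vst /vsu /vstu /vs; [exact: finset.setUCA|exact: finset.setUCA|].
by rewrite [u |: (s |: S)]finset.setUCA finset.setUCA.
Qed.
Lemma flipB2 : [/\ tile_left (B, S) = VS, tile_right (B, S) = VU & tile_top (B, S) = VSU].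
Proof. by rewrite /tile_left /tile_right /tile_top; have [-> ->] := tile_su S. Qed.
Lemma flipA2 : [/\ tile_left (A, VU) = VSU, tile_right (A, VU) = VTU & tile_top (A, VU) = VSTU].
Proof. by rewrite /tile_left /tile_right /tile_top; have [-> ->] := tile_st VU. Qed.

Lemma neq_mem (x : 'I_n) V W : (x \in V) != (x \in W) -> V != W.
Proof. by apply: contraNneq => ->. Qed.

Let neqs : [/\ s == t = false, s == u = false, t == u = false, t == s = false & u == s = false].
Proof. by clear -st tu su; split; rewrite -val_eqE; apply/eqP => /= h; move: st tu su; rewrite ?h; lia. Qed.
Let neq_ut : u == t = false.
Proof. by rewrite eq_sym; case: neqs. Qed.

Let mems := (in_setU1, eqxx, negbTE sS, negbTE tS, negbTE uS).

Lemma flip_neqT : [/\ VT != S, VT != VS, VT != VU & [/\ VT != VST, VT != VTU, VT != VSTU & VT != VSU]].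
Proof.
have [e1 e2 e3 e4 e5] := neqs; rewrite /vs /vt /vu /vst /vsu /vtu /vstu.
split; first 3 last.
  split; [apply: (@neq_mem s)|apply: (@neq_mem u)|apply: (@neq_mem s)|apply: (@neq_mem s)];
    by rewrite !mems ?e1 ?e2 ?e3 ?e4 ?e5 ?neq_ut.
all: by apply: (@neq_mem t); rewrite !mems ?e1 ?e2 ?e3 ?e4 ?e5 ?neq_ut.
Qed.

Lemma flip_neqSU : [/\ VSU != S, VSU != VS, VSU != VU & [/\ VSU != VST, VSU != VTU & VSU != VSTU]].
Proof.
have [e1 e2 e3 e4 e5] := neqs; rewrite /vs /vt /vu /vst /vsu /vtu /vstu.
split; first 3 last.
  by split; apply: (@neq_mem t); rewrite !mems ?e1 ?e2 ?e3 ?e4 ?e5 ?neq_ut.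
- by apply: (@neq_mem s); rewrite !mems ?e1 ?e2 ?e3 ?e4 ?e5 ?neq_ut.
- by apply: (@neq_mem u); rewrite !mems ?e1 ?e2 ?e3 ?e4 ?e5 ?neq_ut.
- by apply: (@neq_mem s); rewrite !mems ?e1 ?e2 ?e3 ?e4 ?e5 ?neq_ut.
Qed.

Definition put (b : bool) (z : {set 'I_n}) o : {set {set 'I_n}} := if b then z |: o else o.

Lemma in_put b z o V : V != z -> (V \in put b z o) = (V \in o).
Proof. by rewrite /put; case: b => // /negbTE h; rewrite in_setU1 h. Qed.

Lemma put_in b z o : z \notin o -> (z \in put b z o) = b.
Proof. by rewrite /put; case: b => [_|/negbTE //]; rewrite in_setU1 eqxx. Qed.

Lemma right_vertex_neqT : right_vertex a != VT.
Proof.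
apply/eqP => /setP h; have := h t; have := h u; have [_ _ _ _ _] := neqs.
by rewrite !inE !mems neq_ut => /= h1 h2; move: tu h1 h2; clear; lia.
Qed.

Lemma right_vertex_neqSU : right_vertex a != VSU.
Proof.
apply/eqP => /setP h; have := h s; have := h t; have [e1 e2 e3 e4 e5] := neqs.
by rewrite !inE !mems e4 e3 => /= h1 h2; move: st h1 h2; clear; lia.
Qed.

Definition hexagon_frame : {set {set 'I_n}} :=
  \bigcup_(X in T0) tile_verts X :|: [set S; VS; VU; VST; VTU; VSTU].

Definition outer_config o : bool :=
  [&& o \subset region a, o \subset hexagon_frame, right_vertex a \in o
    & [forall X in T0, tile_cond a o X]].

Lemma tile_cond_put b z o X : z \notin tile_verts X ->
  tile_cond a (put b z o) X = tile_cond a o X.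
Proof.
rewrite tile_vertsE !inE !negb_or -!andbA => /and4P[h1 h2 h3 h4].
by rewrite /tile_cond !in_put // eq_sym.
Qed.

Lemma subset_put b z o (W : {set {set 'I_n}}) : (put b z o \subset W) = (b ==> (z \in W)) && (o \subset W).
Proof. by rewrite /put; case: b => //=; rewrite finset.subUset finset.sub1set. Qed.

Lemma forall_hexagon (P : pred (tile n)) X1 X2 X3 :
  [forall X in [set X1; X2; X3] :|: T0, P X] =
  [&& P X1, P X2 & P X3] && [forall X in T0, P X].
Proof.
apply/forall_inP/andP => [h|[/and3P[h1 h2 h3] /forall_inP h] X].
  split; first by rewrite !h // !inE eqxx ?orbT.
  by apply/forall_inP => X XT; apply: h; rewrite finset.in_setU XT orbT.
by rewrite finset.in_setU => /orP[|/h //]; rewrite !inE -orbA => /or3P[] /eqP ->.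
Qed.

Lemma mem_set3 (X X1 X2 X3 : tile n) :
  (X \in [set X1; X2; X3]) = [|| X == X1, X == X2 | X == X3].
Proof. by rewrite !inE -orbA. Qed.

Lemma bigcup_hexagon X1 X2 X3 :
  \bigcup_(X in [set X1; X2; X3] :|: T0) tile_verts X =
  tile_verts X1 :|: tile_verts X2 :|: tile_verts X3 :|: \bigcup_(X in T0) tile_verts X.
Proof.
apply/setP => V; rewrite 3!finset.in_setU; apply/finset.bigcupP/idP => [[X]|].
  rewrite finset.in_setU mem_set3 -!orbA => /or4P[/eqP -> ->|/eqP -> ->|/eqP -> ->|XT VX]; rewrite ?orbT //.
  by apply/or4P/Or44; apply/finset.bigcupP; exists X.
case/orP => [/orP[/orP[]|]|/finset.bigcupP[X XT]] h.
- by exists X1 => //; rewrite !inE eqxx.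
- by exists X2 => //; rewrite !inE eqxx ?orbT.
- by exists X3 => //; rewrite !inE eqxx ?orbT.
- by exists X => //; rewrite finset.in_setU XT orbT.
Qed.

Lemma vertices_lower : \bigcup_(X in T) tile_verts X = VT |: hexagon_frame.
Proof.
rewrite eT bigcup_hexagon !tile_vertsE /hexagon_frame.
have [-> -> ->] := flipA1; have [-> -> ->] := flipB1; have [-> -> ->] := flipC1.
rewrite [(A, S).2]/= [(B, _).2]/= [(C, S).2]/=.
apply/setP => V; rewrite !finset.in_setU !inE -/VT; move: (V \in _) => b.
apply/idP/idP => H; repeat (case/orP: H => H).
all: by first [rewrite H ?orbT | rewrite (eqP H) !eqxx ?orbT].
Qed.

Lemma vertices_upper : \bigcup_(X in T') tile_verts X = VSU |: hexagon_frame.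
Proof.
rewrite eT' bigcup_hexagon !tile_vertsE /hexagon_frame.
have [-> -> ->] := flipC2; have [-> -> ->] := flipB2; have [-> -> ->] := flipA2.
rewrite [(C, _).2]/= [(B, _).2]/= [(A, _).2]/=.
apply/setP => V; rewrite !finset.in_setU !inE -/VS -/VU; move: (V \in _) => b.
apply/idP/idP => H; repeat (case/orP: H => H).
all: by first [rewrite H ?orbT | rewrite (eqP H) !eqxx ?orbT].
Qed.

Lemma subset_frame z o : z \notin o -> (o \subset z |: hexagon_frame) = (o \subset hexagon_frame).
Proof.
move=> zo; apply/fintype.subsetP/fintype.subsetP => h V Vo; last by rewrite in_setU1 h ?orbT.
by move: (h V Vo); rewrite in_setU1 => /orP[/eqP e|//]; move: zo; rewrite -e Vo.
Qed.

Lemma andb_reorder (b1 b2 b3 b4 b5 b6 b7 b8 : bool) :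
  [&& b1 && b2, b3, b4, [&& b5, b6 & b7] & b8] =
  [&& b2, b3, b4 & b8] && [&& b1, b5, b6 & b7].
Proof. by case: b1 b2 b3 b4 b5 b6 b7 b8 => [] [] [] [] [] [] [] []. Qed.

(** Separates the conditions shared by both tilings from those at the three tiles of the hexagon;
    [hexagon_balanced] compares only the latter. *)
Lemma lower_config b o : VT \notin o -> VSU \notin o ->
  (put b VT o \in config a T) = outer_config o && lower_ok a S s t u o b.
Proof.
move=> zo zo'; rewrite inE !subset_put vertices_lower subset_frame // in_setU1 eqxx /= implybT.
rewrite in_put ?right_vertex_neqT // eT forall_hexagon.
rewrite (_ : [forall X in T0, tile_cond a (put b VT o) X] = [forall X in T0, tile_cond a o X]); last first.
  by apply: eq_forallb_in => X /T0P[_ h _]; rewrite tile_cond_put.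
rewrite /outer_config /lower_ok /lower_cond /tile_cond.
have [-> -> ->] := flipA1; have [-> -> ->] := flipB1; have [-> -> ->] := flipC1.
have [-> ->] := tile_st S; have [-> ->] := tile_su VT; have [-> ->] := tile_tu S.
rewrite [(A, S).2]/= [(B, _).2]/= [(C, S).2]/=.
have [h1 h2 h3 [h4 h5 h6 h7]] := flip_neqT.
rewrite put_in // !in_put ?[_ == VT]eq_sym //.
exact: andb_reorder.
Qed.

Lemma upper_config b o : VT \notin o -> VSU \notin o ->
  (put b VSU o \in config a T') = outer_config o && upper_ok a S s t u o b.
Proof.
move=> zo zo'; rewrite inE !subset_put vertices_upper subset_frame // in_setU1 eqxx /= implybT.
rewrite in_put ?right_vertex_neqSU // eT' forall_hexagon.
rewrite (_ : [forall X in T0, tile_cond a (put b VSU o) X] = [forall X in T0, tile_cond a o X]); last first.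
  by apply: eq_forallb_in => X /T0P[_ _ h]; rewrite tile_cond_put.
rewrite /outer_config /upper_ok /upper_cond /tile_cond.
have [-> -> ->] := flipC2; have [-> -> ->] := flipB2; have [-> -> ->] := flipA2.
have [-> ->] := tile_tu VS; have [-> ->] := tile_su S; have [-> ->] := tile_st VU.
rewrite [(C, _).2]/= [(B, _).2]/= [(A, _).2]/=.
have [h1 h2 h3 [h4 h5 h6]] := flip_neqSU.
rewrite put_in // !in_put ?[_ == VSU]eq_sym //.
exact: andb_reorder.
Qed.

Lemma flip_roots : [/\ (A == B) = false, (A == C) = false & (B == C) = false].
Proof.
have [e1 e2 e3 e4 e5] := neqs.
by rewrite -!(inj_eq val_inj) eA eB eC !xpair_eqE e1 e3 !andbF.
Qed.

Lemma lower_notin : [/\ (A, S) \notin (B, VT) |: ((C, S) |: T0), (B, VT) \notin (C, S) |: T0 & (C, S) \notin T0].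
Proof.
have [e1 e2 e3] := flip_roots.
have h R V : R \in [:: A; B; C] -> (R, V) \notin T0.
  by move=> RI; apply/negP => /T0P[]; rewrite /tile_root RI.
by split; rewrite ?in_setU1 ?negb_or ?xpair_eqE ?e1 ?e2 ?e3 ?h // !inE eqxx ?orbT.
Qed.

Lemma upper_notin : [/\ (C, VS) \notin (B, S) |: ((A, VU) |: T0), (B, S) \notin (A, VU) |: T0 & (A, VU) \notin T0].
Proof.
have [e1 e2 e3] := flip_roots.
have h R V : R \in [:: A; B; C] -> (R, V) \notin T0.
  by move=> RI; apply/negP => /T0P[]; rewrite /tile_root RI.
by split; rewrite ?in_setU1 ?negb_or ?xpair_eqE ?[C == _]eq_sym ?[B == A]eq_sym ?e1 ?e2 ?e3 ?h // !inE eqxx ?orbT.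
Qed.

Lemma big_lower (R : Type) (idx : R) (op : Monoid.com_law idx) (F : tile n -> R) :
  \big[op/idx]_(X in T) F X =
  op (F (A, S)) (op (F (B, VT)) (op (F (C, S)) (\big[op/idx]_(X in T0) F X))).
Proof.
have [h1 h2 h3] := lower_notin.
by rewrite -!big_setU1 // eT -!finset.setUA.
Qed.

Lemma big_upper (R : Type) (idx : R) (op : Monoid.com_law idx) (F : tile n -> R) :
  \big[op/idx]_(X in T') F X =
  op (F (C, VS)) (op (F (B, S)) (op (F (A, VU)) (\big[op/idx]_(X in T0) F X))).
Proof.
have [h1 h2 h3] := upper_notin.
by rewrite -!big_setU1 // eT' -!finset.setUA.
Qed.

Implicit Types (x y : {ffun pos_root n -> nat}).

Lemma slope_put b z o X : z \notin tile_verts X -> slope (put b z o) X = slope o X.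
Proof.
rewrite tile_vertsE !inE !negb_or -!andbA => /and4P[h1 h2 h3 h4].
by rewrite /slope !in_put // eq_sym.
Qed.

Lemma rexp_put b z o X : z \notin tile_verts X -> rexp (put b z o) X = rexp o X.
Proof.
rewrite tile_vertsE !inE !negb_or -!andbA => /and4P[h1 h2 h3 h4].
by rewrite /rexp !in_put // eq_sym.
Qed.

Lemma height_lower b o x : VT \notin o -> height T (put b VT o) x =
  lower_height (x A) (x B) (x C) (VS \in o) (VU \in o) (VST \in o) (VTU \in o) b
  + height T0 o x.
Proof.
move=> zo; rewrite /height big_lower /lower_height /slope /tile_root.
have [-> -> _] := flipA1; have [-> -> _] := flipB1; have [-> -> _] := flipC1.
have [h1 h2 h3 [h4 h5 h6 h7]] := flip_neqT.
rewrite put_in // !in_put ?[_ == VT]eq_sym //= !addrA; congr (_ + _).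
by apply: eq_bigr => X /T0P[_ h _]; rewrite -/(slope _ X) slope_put.
Qed.

Lemma height_upper b o x : VSU \notin o -> height T' (put b VSU o) x =
  upper_height (x A) (x B) (x C) (VS \in o) (VU \in o) (VST \in o) (VTU \in o) b
  + height T0 o x.
Proof.
move=> zo; rewrite /height big_upper /upper_height /slope /tile_root.
have [-> -> _] := flipC2; have [-> -> _] := flipB2; have [-> -> _] := flipA2.
have [h1 h2 h3 [h4 h5 h6]] := flip_neqSU.
rewrite put_in // !in_put ?[_ == VSU]eq_sym //= !addrA.
rewrite (_ : \sum_(X in T0) _ = height T0 o x); last first.
  by apply: eq_bigr => X /T0P[_ _ h]; rewrite -/(slope _ X) slope_put.
by rewrite /height; ring.
Qed.

Definition outer c : {set {set 'I_n}} := c :\: [set VT; VSU].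

Lemma outer_notin c : (VT \notin outer c) && (VSU \notin outer c).
Proof. by rewrite !inE !eqxx ?orbT. Qed.

Lemma VSU_notin_frame : VSU \notin hexagon_frame.
Proof.
rewrite finset.in_setU negb_or; apply/andP; split.
  by apply/finset.bigcupP => -[X /T0P[_ _ h]]; apply/negP.
have [h1 h2 h3 [h4 h5 h6]] := flip_neqSU.
by rewrite !inE !negb_or h1 h2 h3 h4 h5 h6.
Qed.

Lemma VT_notin_frame : VT \notin hexagon_frame.
Proof.
rewrite finset.in_setU negb_or; apply/andP; split.
  by apply/finset.bigcupP => -[X /T0P[_ h _]]; apply/negP.
have [h1 h2 h3 [h4 h5 h6 h7]] := flip_neqT.
by rewrite !inE !negb_or h1 h2 h3 h4 h5 h6.
Qed.

Lemma lower_notin_VSU c : c \in config a T -> VSU \notin c.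
Proof.
rewrite inE => /and4P[_ /fintype.subsetP sub _ _]; apply/negP => /sub.
have [_ _ _ [_ _ _ h7]] := flip_neqT.
by rewrite vertices_lower in_setU1 eq_sym (negbTE h7) (negbTE VSU_notin_frame).
Qed.

Lemma upper_notin_VT c : c \in config a T' -> VT \notin c.
Proof.
rewrite inE => /and4P[_ /fintype.subsetP sub _ _]; apply/negP => /sub.
have [_ _ _ [_ _ _ h7]] := flip_neqT.
by rewrite vertices_upper in_setU1 (negbTE h7) (negbTE VT_notin_frame).
Qed.

Lemma put_outer_lower c : VSU \notin c -> put (VT \in c) VT (outer c) = c.
Proof.
move=> h; apply/setP => V; have [->|ne] := eqVneq V VT.
  by rewrite put_in //; case/andP: (outer_notin c).
rewrite in_put // !inE (negbTE ne) /=; case: eqP => [->|//].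
by rewrite (negbTE h).
Qed.

Lemma put_outer_upper c : VT \notin c -> put (VSU \in c) VSU (outer c) = c.
Proof.
move=> h; apply/setP => V; have [->|ne] := eqVneq V VSU.
  by rewrite put_in //; case/andP: (outer_notin c).
rewrite in_put // !inE (negbTE ne) orbF /=; case: eqP => [->|//].
by rewrite (negbTE h).
Qed.

Lemma outer_put b z o : (z == VT) || (z == VSU) -> VT \notin o -> VSU \notin o ->
  outer (put b z o) = o.
Proof.
move=> hz h1 h2; apply/setP => V; rewrite !inE.
have [->|n1] := eqVneq V VT; first by rewrite (negbTE h1).
have [->|n2] := eqVneq V VSU; first by rewrite (negbTE h2).
rewrite in_put //; apply/negP => /eqP e; move: hz; rewrite -e.
by rewrite (negbTE n1) (negbTE n2).
Qed.

Lemma braidA x : braid_coord A B C x A = (x A + x B - minn (x A) (x C))%N.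
Proof. by rewrite ffunE eqxx. Qed.
Lemma braidB x : braid_coord A B C x B = minn (x A) (x C).
Proof. by have [e1 e2 e3] := flip_roots; rewrite ffunE eq_sym e1 eqxx. Qed.
Lemma braidC x : braid_coord A B C x C = (x C + x B - minn (x A) (x C))%N.
Proof.
by have [e1 e2 e3] := flip_roots; rewrite ffunE ![C == _]eq_sym e2 e3 eqxx.
Qed.
Lemma braid_out x r : r \notin [:: A; B; C] -> braid_coord A B C x r = x r.
Proof. by rewrite ffunE !inE !negb_or => /and3P[/negbTE -> /negbTE -> /negbTE ->]. Qed.

Lemma height_braid o x : height T0 o (braid_coord A B C x) = height T0 o x.
Proof. by apply: eq_bigr => X /T0P[h _ _]; rewrite braid_out. Qed.

Lemma outer_sub c T1 : c \in config a T1 -> outer c \subset region a.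
Proof.
rewrite inE => /and4P[r _ _ _]; apply: fintype.subset_trans r.
exact: finset.subsetDl.
Qed.

(** Only the inner vertex is chosen anew. Balance provides an admissible choice whose height, in the
    flipped coordinates, is not smaller. *)
Lemma flip_up c x : c \in config a T ->
  exists2 c', c' \in config a T' & outer c' = outer c /\
    height T c x <= height T' c' (braid_coord A B C x).
Proof.
move=> cT; have hc := lower_notin_VSU cT; have sub := outer_sub cT.
have /andP[o1 o2] := outer_notin c.
have eh : height T c x = height T (put (VT \in c) VT (outer c)) x by rewrite put_outer_lower.
have : put (VT \in c) VT (outer c) \in config a T by rewrite put_outer_lower.
rewrite {}eh lower_config // => /andP[K hb].
have bal := hexagon_balanced st tu sS tS uS sub.
have hb' : if VT \in c then lower_ok a S s t u (outer c) true else lower_ok a S s t u (outer c) false.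
  by case: (VT \in c) hb.
have [b' hu le] := lower_upper_height (x A) (x B) (x C) bal hb'.
exists (put b' VSU (outer c)).
  by rewrite upper_config // K /=; case: b' hu {le}.
rewrite outer_put ?eqxx ?orbT //; split=> //.
by rewrite height_lower // height_upper // height_braid braidA braidB braidC lerD2r.
Qed.

Lemma flip_down c x : c \in config a T' ->
  exists2 c', c' \in config a T & outer c' = outer c /\
    height T' c (braid_coord A B C x) <= height T c' x.
Proof.
move=> cT; have hc := upper_notin_VT cT; have sub := outer_sub cT.
have /andP[o1 o2] := outer_notin c.
have eh y : height T' c y = height T' (put (VSU \in c) VSU (outer c)) y by rewrite put_outer_upper.
have : put (VSU \in c) VSU (outer c) \in config a T' by rewrite put_outer_upper.
rewrite {}eh upper_config // => /andP[K hb].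
have bal := hexagon_balanced st tu sS tS uS sub.
have hb' : if VSU \in c then upper_ok a S s t u (outer c) true else upper_ok a S s t u (outer c) false.
  by case: (VSU \in c) hb.
have [b' hu le] := upper_lower_height (x A) (x B) (x C) bal hb'.
exists (put b' VT (outer c)).
  by rewrite lower_config // K /=; case: b' hu {le}.
rewrite outer_put ?eqxx ?orbT //; split=> //.
by rewrite height_lower // height_upper // height_braid braidA braidB braidC lerD2r.
Qed.

(** Adding the inner vertex changes the height by [x A - x C]. A greatest maximizer contains it if
    this is allowed and the change is nonnegative; ties are decided in favour of inclusion, whence
    the strict inequality in the other case. *)
Lemma lower_choice c x : greatest a T x c -> let o := outer c in
  [/\ outer_config o, (if VT \in c then lower_ok a S s t u o true else lower_ok a S s t u o false)
    & (if VT \in c then lower_ok a S s t u o false ==> (x C <= x A)%N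
       else lower_ok a S s t u o true ==> (x A < x C)%N)].
Proof.
move=> [cT cmax cgr] o; have hc := lower_notin_VSU cT.
have /andP[o1 o2] := outer_notin c.
have ec : c = put (VT \in c) VT o by rewrite put_outer_lower.
have := cT; rewrite {1}ec lower_config // => /andP[K hb].
split=> //; first by case: (VT \in c) hb.
have hh b : height T (put b VT o) x = height T o x + ((x A)%:Z - (x C)%:Z) * b%:Z.
  rewrite -[in RHS]/(put false VT o) !height_lower // /lower_height /=; ring.
have hc1 : height T c x = height T (put (VT \in c) VT o) x by rewrite -ec.
rewrite hh in hc1; move: hc1 cmax cgr; case hV: (VT \in c) => /= hc1 cmax cgr; apply/implyP => ok.
  have /cmax : put false VT o \in config a T by rewrite lower_config // K.
  by rewrite hc1 hh mulr0 mulr1 addr0 lerDl subr_ge0 lez_nat.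
have oT : put true VT o \in config a T by rewrite lower_config // K.
have := cmax _ oT; rewrite hc1 hh mulr0 mulr1 addr0 gerDl subr_le0 lez_nat => le.
rewrite ltnNge; apply/negP => le2.
have : height T (put true VT o) x = height T c x.
  by rewrite hc1 hh mulr0 mulr1 addr0 (_ : _ - _ = 0) ?addr0 //; apply/eqP; rewrite subr_eq0 eqz_nat eqn_leq le.
move/(cgr _ oT)/fintype.subsetP/(_ VT); rewrite put_in // hV => /(_ isT).
by [].
Qed.

(** In the flipped tiling the inner vertex has weight [x C - x A] in terms of the coordinates before
    the flip, so the inequalities are reversed. *)
Lemma upper_choice c x : greatest a T' (braid_coord A B C x) c -> let o := outer c in
  [/\ outer_config o, (if VSU \in c then upper_ok a S s t u o true else upper_ok a S s t u o false)
    & (if VSU \in c then upper_ok a S s t u o false ==> (x A <= x C)%N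
       else upper_ok a S s t u o true ==> (x C < x A)%N)].
Proof.
set y := braid_coord A B C x.
move=> [cT cmax cgr] o; have hc := upper_notin_VT cT.
have /andP[o1 o2] := outer_notin c.
have ec : c = put (VSU \in c) VSU o by rewrite put_outer_upper.
have := cT; rewrite {1}ec upper_config // => /andP[K hb].
split=> //; first by case: (VSU \in c) hb.
have hh b : height T' (put b VSU o) y = height T' o y + ((x C)%:Z - (x A)%:Z) * b%:Z.
  rewrite -[in RHS]/(put false VSU o) !height_upper // /y braidA braidB braidC.
  by rewrite upper_height_put addrAC.
have hc1 : height T' c y = height T' (put (VSU \in c) VSU o) y by rewrite -ec.
rewrite hh in hc1; move: hc1 cmax cgr; case hV: (VSU \in c) => /= hc1 cmax cgr; apply/implyP => ok.
  have /cmax : put false VSU o \in config a T' by rewrite upper_config // K.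
  by rewrite hc1 hh mulr0 mulr1 addr0 lerDl subr_ge0 lez_nat.
have oT : put true VSU o \in config a T' by rewrite upper_config // K.
have := cmax _ oT; rewrite hc1 hh mulr0 mulr1 addr0 gerDl subr_le0 lez_nat => le.
rewrite ltnNge; apply/negP => le2.
have : height T' (put true VSU o) y = height T' c y.
  by rewrite hc1 hh mulr0 mulr1 addr0 (_ : _ - _ = 0) ?addr0 //; apply/eqP; rewrite subr_eq0 eqz_nat eqn_leq le.
move/(cgr _ oT)/fintype.subsetP/(_ VSU); rewrite put_in // hV => /(_ isT).
by [].
Qed.

Lemma rexp_lower b o : VT \notin o ->
  [/\ rexp (put b VT o) (A, S) = (VS \in o)%:Z + b%:Z - (S \in o)%:Z - (VST \in o)%:Z,
      rexp (put b VT o) (B, VT) = (VST \in o)%:Z + (VTU \in o)%:Z - b%:Z - (VSTU \in o)%:Z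
    & rexp (put b VT o) (C, S) = b%:Z + (VU \in o)%:Z - (S \in o)%:Z - (VTU \in o)%:Z].
Proof.
move=> zo; rewrite /rexp.
have [-> -> ->] := flipA1; have [-> -> ->] := flipB1; have [-> -> ->] := flipC1.
have [h1 h2 h3 [h4 h5 h6 h7]] := flip_neqT.
by rewrite put_in // !in_put ?[_ == VT]eq_sym.
Qed.

Lemma rexp_upper b o : VSU \notin o ->
  [/\ rexp (put b VSU o) (A, VU) = b%:Z + (VTU \in o)%:Z - (VU \in o)%:Z - (VSTU \in o)%:Z,
      rexp (put b VSU o) (B, S) = (VS \in o)%:Z + (VU \in o)%:Z - (S \in o)%:Z - b%:Z
    & rexp (put b VSU o) (C, VS) = (VST \in o)%:Z + b%:Z - (VS \in o)%:Z - (VSTU \in o)%:Z].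
Proof.
move=> zo; rewrite /rexp.
have [-> -> ->] := flipC2; have [-> -> ->] := flipB2; have [-> -> ->] := flipA2.
have [h1 h2 h3 [h4 h5 h6]] := flip_neqSU.
by rewrite put_in // !in_put ?[_ == VSU]eq_sym.
Qed.

Lemma flip_Z_lower c : c \in config a T -> c :&: [set VT; VSU] \subset [set VT].
Proof.
move=> /lower_notin_VSU h; apply/fintype.subsetP => V; rewrite !inE => /andP[Vc /orP[//|/eqP e]].
by move: h; rewrite -e Vc.
Qed.

Lemma flip_Z_upper c : c \in config a T' -> c :&: [set VT; VSU] \subset [set VSU].
Proof.
move=> /upper_notin_VT h; apply/fintype.subsetP => V; rewrite !inE => /andP[Vc /orP[/eqP e|//]].
by move: h; rewrite -e Vc.
Qed.

Lemma mem_flip_lower X : (X \in T) = [|| X == (A, S), X == (B, VT), X == (C, S) | X \in T0].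
Proof. by rewrite eT finset.in_setU mem_set3 -!orbA. Qed.

Lemma mem_flip_upper X : (X \in T') = [|| X == (C, VS), X == (B, S), X == (A, VU) | X \in T0].
Proof. by rewrite eT' finset.in_setU mem_set3 -!orbA. Qed.

(** The rule for [f_a^*] commutes with the flip. The new middle coordinate is a minimum, whose
    change is given by [shift_min]; the outer coordinates follow since the sum of each with the
    middle one is preserved. *)
Lemma shifted_up x x' : shifted a T x x' ->
  shifted a T' (braid_coord A B C x) (braid_coord A B C x').
Proof.
move=> [c [gc ex]].
have [c' [gc' co]] := greatest_transfer flip_Z_upper (fun c => @flip_up c x)
   (fun c => @flip_down c x) gc.
exists c'; split=> //.
have [_ ht gt] := lower_choice gc; have [_ hu gu] := upper_choice gc'.
rewrite -[c' :\: _]/(outer c') -[c :\: _]/(outer c) in co; rewrite co in hu gu.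
have /andP[o1 o2] := outer_notin c.
have [cT _ _] := gc; have [cT' _ _] := gc'.
have hc := lower_notin_VSU cT; have hc' := upper_notin_VT cT'.
have bal := hexagon_balanced st tu sS tS uS (outer_sub cT).
have ec := put_outer_lower hc; have ec' := put_outer_upper hc'; rewrite co in ec'.
have [r1 r2 r3] := rexp_lower (VT \in c) o1; rewrite ec in r1 r2 r3.
have [q1 q2 q3] := rexp_upper (VSU \in c') o2; rewrite ec' in q1 q2 q3.
have e1 : (x' A)%:Z = (x A)%:Z + rexp c (A, S) by apply: (ex (A, S)); rewrite mem_flip_lower eqxx.
have e2 : (x' B)%:Z = (x B)%:Z + rexp c (B, VT) by apply: (ex (B, VT)); rewrite mem_flip_lower eqxx orbT.
have e3 : (x' C)%:Z = (x C)%:Z + rexp c (C, S) by apply: (ex (C, S)); rewrite mem_flip_lower; apply/or4P/Or43/eqxx.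
rewrite r1 in e1; rewrite r2 in e2; rewrite r3 in e3.
have key := shift_min bal ht hu gt gu e1 e3.
have m1 := geq_minl (x A) (x C); have m2 := geq_minr (x A) (x C).
have m3 := geq_minl (x' A) (x' C); have m4 := geq_minr (x' A) (x' C).
move=> X; rewrite mem_flip_upper => /or4P[/eqP ->|/eqP ->|/eqP ->|XT].
- by rewrite /tile_root !braidC q3 (shift_sub m2 m4 e3 e2 key); ring.
- by rewrite /tile_root !braidB q2.
- by rewrite /tile_root !braidA q1 (shift_sub m1 m3 e1 e2 key); ring.
have [h1 h2 h3] := T0P XT; rewrite !braid_out // -ec' (rexp_put _ _ h3) ex; last first.
  by rewrite mem_flip_lower; apply/or4P/Or44.
by rewrite -{1}ec (rexp_put _ _ h2).
Qed.

Lemma shifted_down x x' : shifted a T' (braid_coord A B C x) x' ->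
  shifted a T x (braid_coord A B C x').
Proof.
set y := braid_coord A B C x.
move=> [c' [gc' ex]].
have [c [gc co]] := greatest_transfer flip_Z_lower (fun c => @flip_down c x)
   (fun c => @flip_up c x) gc'.
exists c; split=> //.
have [_ ht gt] := lower_choice gc; have [_ hu gu] := upper_choice gc'.
rewrite -[c' :\: _]/(outer c') -[c :\: _]/(outer c) in co; rewrite -co in hu gu.
have /andP[o1 o2] := outer_notin c.
have [cT _ _] := gc; have [cT' _ _] := gc'.
have hc := lower_notin_VSU cT; have hc' := upper_notin_VT cT'.
have bal := hexagon_balanced st tu sS tS uS (outer_sub cT).
have ec := put_outer_lower hc; have ec' := put_outer_upper hc'; rewrite -co in ec'.
have [r1 r2 r3] := rexp_lower (VT \in c) o1; rewrite ec in r1 r2 r3.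
have [q1 q2 q3] := rexp_upper (VSU \in c') o2; rewrite ec' in q1 q2 q3.
have e1 : (x' A)%:Z = (y A)%:Z + rexp c' (A, VU) by apply: (ex (A, VU)); rewrite mem_flip_upper; apply/or4P/Or43/eqxx.
have e2 : (x' B)%:Z = (y B)%:Z + rexp c' (B, S) by apply: (ex (B, S)); rewrite mem_flip_upper eqxx orbT.
have e3 : (x' C)%:Z = (y C)%:Z + rexp c' (C, VS) by apply: (ex (C, VS)); rewrite mem_flip_upper eqxx.
have m1 := geq_minl (x A) (x C); have m2 := geq_minr (x A) (x C).
have m3 := geq_minl (x' A) (x' C); have m4 := geq_minr (x' A) (x' C).
rewrite q1 in e1; rewrite q2 in e2; rewrite q3 in e3.
rewrite /y braidA in e1; rewrite /y braidB in e2; rewrite /y braidC in e3.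
have lexz : (x A + x B - minn (x A) (x C) <= x C + x B - minn (x A) (x C))%N = (x A <= x C)%N.
  by move: m1 m2; clear; lia.
have lezx : (x C + x B - minn (x A) (x C) <= x A + x B - minn (x A) (x C))%N = (x C <= x A)%N.
  by move: m1 m2; clear; lia.
have key := @shift_min_upper _ _ _ _ (x B) _ _ _ _ _ _ _ _ _ _ _ bal ht hu _ _ _ e1 e3.
have {}key : (minn (x' A) (x' C))%:Z = (x B)%:Z + ((VST \in outer c)%:Z + (VTU \in outer c)%:Z - (VT \in c)%:Z - (VSTU \in outer c)%:Z).
  apply: key.
  - by move: gt; case: (VT \in c) => //; rewrite ?lezx // !ltnNge lezx.
  - by move: gu; case: (VSU \in c') => //; rewrite ?lexz // !ltnNge lexz.
  - by clear; lia.
move=> X; rewrite mem_flip_lower => /or4P[/eqP ->|/eqP ->|/eqP ->|XT].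
- by rewrite /tile_root !braidA r1 (shift_sub_inv m1 m3 e1 e2 key); ring.
- by rewrite /tile_root !braidB r2.
- by rewrite /tile_root !braidC r3 (shift_sub_inv m2 m4 e3 e2 key); ring.
have [h1 h2 h3] := T0P XT; rewrite !braid_out // -ec (rexp_put _ _ h2) ex; last first.
  by rewrite mem_flip_upper; apply/or4P/Or44.
by rewrite /y braid_out // -{1}ec' (rexp_put _ _ h3).
Qed.

Section FlipSum.
Variables (K : fieldType) (val_ : tile n -> K).
Let al := val_ (A, S).
Let be := val_ (B, VT).
Let ga := val_ (C, S).
Hypotheses (al0 : al != 0) (be0 : be != 0) (ga0 : ga != 0) (qu0 : al * ga + be != 0).
Hypothesis valC : val_ (C, VS) = be * ga / (al * ga + be).
Hypothesis valB : val_ (B, S) = al * ga.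
Hypothesis valA : val_ (A, VU) = (al * ga + be) / ga.

(** For each part outside the inner vertices the two sides reduce to [lower_upper_sum]. The
    prescribed values at the flipped tiles are those that the Pluecker relation gives for ratios of
    minors. *)
Lemma flip_sum :
  \sum_(c in config a T) \prod_(X in T) val_ X ^ rexp c X =
  \sum_(c in config a T') \prod_(X in T') val_ X ^ rexp c X.
Proof.
have neq : VT != VSU by case: flip_neqT => _ _ _ [].
have neq' : VSU != VT by rewrite eq_sym.
rewrite (sum_sets_put _ neq lower_notin_VSU) (sum_sets_put _ neq' upper_notin_VT).
rewrite (eq_bigl (fun o : {set {set 'I_n}} => (VSU \notin o) && (VT \notin o))); last first.
  by move=> o; rewrite andbC.
apply: eq_bigr => o /andP[o2 o1].
have E1 b : put b VT o \in config a T = outer_config o && lower_ok a S s t u o b.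
  exact: lower_config.
have E2 b : put b VSU o \in config a T' = outer_config o && upper_ok a S s t u o b.
  exact: upper_config.
have := E1 false; have := E1 true; have := E2 false; have := E2 true; rewrite /put => -> -> -> ->.
case K0 : (outer_config o); last by rewrite !mulr0n.
have sub : o \subset region a by case/and4P: K0.
have bal := hexagon_balanced st tu sS tS uS sub.
rewrite /=.
pose rest := \prod_(X in T0) val_ X ^ rexp o X.
have W1 b : \prod_(X in T) val_ X ^ rexp (put b VT o) X =
    (al ^ ((VS \in o)%:Z + b%:Z - (S \in o)%:Z - (VST \in o)%:Z) *
     be ^ ((VST \in o)%:Z + (VTU \in o)%:Z - b%:Z - (VSTU \in o)%:Z) *
     ga ^ (b%:Z + (VU \in o)%:Z - (S \in o)%:Z - (VTU \in o)%:Z)) * rest.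
  rewrite big_lower; have [-> -> ->] := rexp_lower b o1; rewrite -/al -/be -/ga /= -!mulrA.
  do 3!congr (_ * _); apply: eq_bigr => X /T0P[_ h _]; rewrite rexp_put //.
have W2 b : \prod_(X in T') val_ X ^ rexp (put b VSU o) X =
    (((al * ga + be) / ga) ^ (b%:Z + (VTU \in o)%:Z - (VU \in o)%:Z - (VSTU \in o)%:Z) *
     (al * ga) ^ ((VS \in o)%:Z + (VU \in o)%:Z - (S \in o)%:Z - b%:Z) *
     (be * ga / (al * ga + be)) ^ ((VST \in o)%:Z + b%:Z - (VS \in o)%:Z - (VSTU \in o)%:Z)) * rest.
  rewrite big_upper; have [-> -> ->] := rexp_upper b o2; rewrite valA valB valC /=.
  rewrite (_ : \prod_(X in T0) _ = rest); last first.
    by apply: eq_bigr => X /T0P[_ _ h]; rewrite rexp_put.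
  by rewrite mulrCA [X in _ * X]mulrCA -!mulrA [RHS]mulrCA.
have := W1 false; have := W1 true; have := W2 false; have := W2 true.
rewrite /put => -> -> -> ->.
have := lower_upper_sum (S \in o) (VSTU \in o) al0 be0 ga0 qu0 bal.
by move/(congr1 (fun v => v * rest)); rewrite /= !(mulrDl _ _ rest) !mulrnAl.
Qed.

End FlipSum.

End Flip.

(** * The three-term Pluecker relation for minors *)

(** [Delta] over any commutative ring: the pencil argument needs minors over polynomials and over
    their fraction field. *)
Definition minor (K : comNzRingType) (n : nat) (g : 'M[K]_n) (S : {set 'I_n}) : K :=
  \det (\matrix_(k < #|S|, l < #|S|) g (widen_ord (card_label_set S) k) (enum_val l)).

Lemma minor_map (K K' : comNzRingType) (f : {rmorphism K -> K'}) (n : nat) (g : 'M[K]_n)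
    (S : {set 'I_n}) :
  minor (map_mx f g) S = f (minor g S).
Proof. by rewrite /minor -det_map_mx; congr (\det _); apply/matrixP => k l; rewrite !mxE. Qed.

Section ColumnDeterminants.
Variables (K : fieldType) (n : nat) (g : 'M[K]_n).
Implicit Types (l : seq 'I_n) (S : {set 'I_n}) (x y : 'I_n).

Local Notation minor := (minor g).

(** Rows beyond the matrix read as 0, so that submatrices can be indexed by natural numbers without
    bounds. *)
Definition entry (k : nat) x : K := if insub k is Some k' then g k' x else 0.

Definition coldet (x0 : 'I_n) (m : nat) l : K :=
  \det (\matrix_(i < m, j < m) entry i (nth x0 l j)).

Lemma minor_coldet x0 S : minor S = coldet x0 #|S| (enum S).
Proof.
congr (\det _); apply/matrixP => i j; rewrite !mxE (enum_val_nth x0) /entry.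
case: insubP => [k _ /= ek|]; last by rewrite (leq_trans (ltn_ord i)) ?card_label_set.
by congr (g _ _); apply: val_inj.
Qed.

Variable x0 : 'I_n.

Lemma coldet_swap l1 x y l2 m : ((size l1).+1 < m)%N ->
  coldet x0 m (l1 ++ x :: y :: l2) = - coldet x0 m (l1 ++ y :: x :: l2).
Proof.
move=> hm; pose i1 := Ordinal (ltnW hm); pose i2 := Ordinal hm.
have ne : i1 != i2 by rewrite -val_eqE /= neq_ltn ltnSn.
rewrite /coldet; set M := (X in _ = - \det X).
rewrite (_ : \matrix_(i, j) _ = xcol i1 i2 M).
  by rewrite xcolE det_mulmx det_perm odd_tperm ne expr1 mulrN1.
apply/matrixP => i j; rewrite !mxE; congr (entry _ _).
case: tpermP => [->|->|/eqP h1 /eqP h2] /=.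
- by rewrite !nth_cat ltnn ltnNge leqnSn /= subnn subSn // subnn.
- by rewrite !nth_cat ltnn ltnNge leqnSn /= subnn subSn // subnn.
move: h1 h2; rewrite -!val_eqE /= !nth_cat => h1 h2.
case: ltnP => // h; case e: (j - size l1)%N => [|[|k]] //; move: h1 h2 h e; lia.
Qed.

Lemma coldet_move l1 x l2 l3 m : (size l1 + size l2 < m)%N ->
  coldet x0 m (l1 ++ x :: l2 ++ l3) = (-1) ^+ (size l2) * coldet x0 m (l1 ++ l2 ++ x :: l3).
Proof.
elim: l2 l1 => [|y l2 IH] l1 /= hm; first by rewrite expr0 mul1r.
rewrite coldet_swap; last by move: hm; lia.
rewrite -cat_rcons IH ?size_rcons; last by move: hm; lia.
by rewrite cat_rcons exprS mulN1r mulNr.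
Qed.

(** The number of elements of [S] larger than [x], which is the number of columns that column [x]
    passes when moved to the end. *)
Definition above x S := count (mem S) (drop x.+1 (enum 'I_n)).

Lemma enum_ord_split x : enum 'I_n = take x (enum 'I_n) ++ x :: drop x.+1 (enum 'I_n).
Proof.
rewrite -{1}(cat_take_drop x (enum 'I_n)); congr (_ ++ _).
by rewrite (drop_nth x) ?size_enum_ord // nth_ord_enum.
Qed.

Lemma mem_take_enum x y : (y \in take x (enum 'I_n)) = (y < x)%N.
Proof.
rewrite -(mem_map val_inj) map_take val_enum_ord take_iota mem_iota /= add0n.
by have := ltn_ord x; rewrite leq_min; have := ltn_ord y; lia.
Qed.

Lemma mem_drop_enum x y : (y \in drop x.+1 (enum 'I_n)) = (x < y)%N.
Proof.
rewrite -(mem_map val_inj) map_drop val_enum_ord drop_iota mem_iota.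
by have := ltn_ord x; have := ltn_ord y; rewrite /=; lia.
Qed.

Lemma enum_filter S : enum S = [seq y <- enum 'I_n | y \in S].
Proof. by rewrite [in RHS]enumT. Qed.

Lemma enum_setU1 x S : x \notin S -> exists l1 l2,
  [/\ enum S = l1 ++ l2, enum (x |: S) = l1 ++ x :: l2 & size l2 = above x S].
Proof.
move=> xS; exists [seq y <- take x (enum 'I_n) | y \in S], [seq y <- drop x.+1 (enum 'I_n) | y \in S].
split; last by rewrite size_filter.
  by rewrite enum_filter {1}(enum_ord_split x) filter_cat /= (negbTE xS).
rewrite enum_filter {1}(enum_ord_split x) filter_cat /= finset.setU11; congr (_ ++ _ :: _); apply: eq_in_filter => y.
  by rewrite mem_take_enum in_setU1 -val_eqE => h; rewrite ltn_eqF.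
by rewrite mem_drop_enum in_setU1 -val_eqE => h; rewrite gtn_eqF.
Qed.

Lemma minorU1 x S : x \notin S ->
  minor (x |: S) = (-1) ^+ above x S * coldet x0 #|S|.+1 (enum S ++ [:: x]).
Proof.
move=> xS; have [l1 [l2 [e1 e2 sz]]] := enum_setU1 xS.
rewrite (minor_coldet x0) cardsU1 xS e2 e1 -{1}[l2]cats0 coldet_move ?cats0 ?sz ?catA //.
by move: (cardE S); rewrite e1 size_cat sz /=; lia.
Qed.

Lemma aboveU1 x y S : (x < y)%N -> y \notin S -> above x (y |: S) = (above x S).+1.
Proof.
move=> xy yS; rewrite /above; set d := drop _ _.
have hU := count_predUI (pred1 y) (mem S) d.
have c1 : count_mem y d = 1%N by rewrite count_uniq_mem ?drop_uniq ?enum_uniq // mem_drop_enum xy.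
have cI : count (predI (pred1 y) (mem S)) d = 0%N.
  rewrite (@eq_count _ _ pred0) ?count_pred0 // => z /=.
  by apply/negbTE; rewrite negb_and; case: eqP => [->|//]; rewrite yS.
rewrite (@eq_count _ _ (predU (pred1 y) (mem S))); last by move=> z; rewrite /= in_setU1.
by rewrite -[LHS]addn0 -cI hU c1 add1n.
Qed.

Lemma minorU2 x y S : (x < y)%N -> x \notin S -> y \notin S ->
  minor (x |: (y |: S)) =
    - ((-1) ^+ above x S * (-1) ^+ above y S * coldet x0 #|S|.+2 (enum S ++ [:: y; x])).
Proof.
move=> xy xS yS; have xyS : x \notin y |: S by rewrite in_setU1 negb_or xS andbT -val_eqE ltn_eqF.
rewrite minorU1 // aboveU1 // cardsU1 yS exprS mulN1r !mulNr -mulrA; congr (- (_ * _)).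
have [l1 [l2 [e1 e2 sz]]] := enum_setU1 yS.
rewrite e2 e1 -catA /= coldet_move ?sz //.
  by rewrite -!catA.
by move: (cardE S); rewrite e1 size_cat sz /=; lia.
Qed.

Lemma det2 (M : 'M[K]_2) : \det M = M 0 0 * M 1 1 - M 0 1 * M 1 0.
Proof.
rewrite (expand_det_row _ 0) !big_ord_recl big_ord0 addr0 /cofactor !det_mx11 !mxE /=.
rewrite -[(0 + 0)%N]/0%N -[(0 + bump 0 0)%N]/1%N expr0 expr1 mul1r mulN1r mulrN.
congr (M _ _ * M _ _ - M _ _ * M _ _); exact: val_inj.
Qed.

Section Schur.
Variables (S : {set 'I_n}).
Let k := #|S|.
Let M : 'M[K]_k := \matrix_(i < k, j < k) entry i (nth x0 (enum S) j).
Hypothesis M0 : \det M != 0.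
Let c x : 'cV[K]_k := \col_(i < k) entry i x.
Let h (d : nat) x : K :=
  entry (k + d) x - ((\row_(j < k) entry (k + d) (nth x0 (enum S) j)) *m invmx M *m c x) 0 0.

Lemma coldet_schur m l : size l = m ->
  coldet x0 (k + m) (enum S ++ l) = \det M * \det (\matrix_(i < m, j < m) h i (nth x0 l j)).
Proof.
move=> sl; have Mu : M \in unitmx by rewrite unitmxE unitfE.
pose X : 'M[K]_(k, m) := \matrix_(i, j) entry i (nth x0 l j).
pose Y : 'M[K]_(m, k) := \matrix_(i, j) entry (k + i) (nth x0 (enum S) j).
pose W : 'M[K]_(m, m) := \matrix_(i, j) entry (k + i) (nth x0 l j).
have -> : coldet x0 (k + m) (enum S ++ l) = \det (block_mx M X Y W).
  congr (\det _); apply/matrixP => i j; rewrite !mxE.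
  by case: splitP => i' ->; rewrite !mxE; case: splitP => j' ->;
    rewrite !mxE nth_cat -cardE -/k ?ltn_ord ?ltnNge ?leq_addr /= ?addKn.
(* Block elimination: a unitriangular block factor on the right clears the upper right block and
   leaves the Schur complement, whose entries are the [h]. *)
rewrite -[LHS]mulr1 -[X in _ * X](_ : \det (block_mx 1%:M (- (invmx M *m X)) 0 1%:M) = 1); last first.
  by rewrite det_ublock !det1 mulr1.
rewrite -det_mulmx mulmx_block !mulmx1 !mulmx0 !addr0 mulmxN mulmxA mulmxV // mul1mx addNr.
rewrite det_lblock; congr (_ * \det _); rewrite mulmxN mulmxA addrC.
apply/matrixP => i j; rewrite [LHS]mxE [RHS]mxE [X in X + _]mxE [X in _ + X]mxE /h; congr (_ - _).
rewrite !mxE; apply: eq_bigr => j' _; congr (_ * _); rewrite !mxE //.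
by apply: eq_bigr => j'' _; rewrite !mxE.
Qed.

End Schur.

(** After factoring out the nonzero minor on [S], the other minors become determinants of size 1 and
    2 in the entries of the Schur complement, where the relation is a polynomial identity. The signs
    agree since [s < t < u]. *)
Lemma plucker S (s t u : 'I_n) : (s < t)%N -> (t < u)%N -> s \notin S -> t \notin S -> u \notin S ->
  minor S != 0 ->
  minor (t |: S) * minor (s |: (u |: S)) =
  minor (s |: S) * minor (t |: (u |: S)) + minor (u |: S) * minor (s |: (t |: S)).
Proof.
move=> st tu sS tS uS; rewrite (minor_coldet x0) => M0.
have su := ltn_trans st tu.
have C1 x := coldet_schur M0 (erefl (size [:: x])).
have C2 x y := coldet_schur M0 (erefl (size [:: y; x])).
rewrite /= addn1 in C1; rewrite /= addn2 in C2.
by rewrite (minorU2 su) ?(minorU2 tu) ?(minorU2 st) ?minorU1 // !C1 !C2 !det_mx11 !det2 !mxE /=; ring.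
Qed.

End ColumnDeterminants.

Lemma tile_root_inj (n : nat) (i : seq 'I_n.-1) (X Y : tile n) : legal 1%g i ->
  X \in word_tiling i -> Y \in word_tiling i -> tile_root X = tile_root Y -> X = Y.
Proof.
rewrite !mem_word_tiling => L h1 h2 e; have U := uniq_walk_roots L.
move: X Y h1 h2 e => [r V] [r' V'] h1 h2; rewrite /tile_root /= => e; subst r'.
congr (_, _); have : (val r, V).1 = (val r, V').1 by [].
elim: (walk _ _) U h1 h2 => //= -[r1 V1] s IH /andP[ns U].
rewrite !in_cons => /orP[/eqP [e1 e2]|h1] /orP[/eqP [e3 e4]|h2] _.
- by rewrite e2 e4.
- by move: ns; rewrite -e1 => /negP[]; apply/mapP; exists (val r, V').
- by move: ns; rewrite -e3 => /negP[]; apply/mapP; exists (val r, V).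
- exact: IH U h1 h2 erefl.
Qed.

(** * Exponent vectors of the crystal operators *)

Section Base.
Variables (n : nat) (a : 'I_n.-1) (i : seq 'I_n.-1).
Hypothesis L : legal 1%g (rcons i (rev_ord a)).
Hypothesis full : run 1%g (rcons i (rev_ord a)) = w0 n.
Let b := rev_ord a.
Let w := run 1%g i.
Let T := word_tiling (rcons i b).

Let wE : w = step (w0 n) b.
Proof. by rewrite -full -cats1 run_cat /run /= stepK. Qed.

Let w_lo : w (lo b) = lo a.
Proof.
rewrite wE step_lo /w0 permE; apply: val_inj => /=.
by have := ltn_ord a; lia.
Qed.

Let w_hi : w (hi b) = hi a.
Proof.
rewrite wE step_hi /w0 permE; apply: val_inj => /=.
by have := ltn_ord a; lia.
Qed.

Let Li : legal 1%g i.
Proof. by move: L; rewrite -cats1 legal_cat => /andP[]. Qed.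

(** Just before the last letter [a] still precedes [a+1] on the path, and inversions persist. So on
    all earlier paths, too, a vertex containing [a+1] contains [a]. *)
Lemma prefix_notin_region i1 i2 k : i = i1 ++ i2 -> chain (run 1%g i1) k \notin region a.
Proof.
move=> ei; rewrite in_region !inE -leqNgt; apply/negP => /andP[h1 h2].
have : ((run 1%g i1)^-1%g (hi a) < (run 1%g i1)^-1%g (lo a))%N by apply: leq_trans h1 h2.
have Li2 : legal (run 1%g i1) i2 by move: Li; rewrite ei legal_cat => /andP[].
have lohi : (lo a < hi a)%N by [].
move/(legal_inverted lohi Li2); rewrite -run_cat -ei -/w.
by rewrite -w_lo -w_hi !permK /= ltnNge leqnSn.
Qed.

Lemma right_vertex_chain : chain (w0 n) b.+1 = right_vertex a.
Proof.
have := ltn_ord a => an; rewrite chain_w0 /=; last by lia.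
by apply/setP => x; rewrite !inE; lia.
Qed.

Lemma right_vertex_region : right_vertex a \in region a.
Proof. by rewrite in_region !inE /= ltnSn ltnn. Qed.

Lemma vert_base X V : X \in T -> V \in tile_verts X -> V \in region a -> V = right_vertex a.
Proof.
rewrite mem_word_tiling => XT VX VR.
have [i1 [i2 [k [ei kn eV]]]] := vert_walk XT VX.
case/lastP: i2 ei => [|i2 q] ei.
  move: VR; rewrite eV -[i1]cats0 -ei full in_region chain_w0 // !inE /= => h.
  by apply/setP => x; rewrite !inE; lia.
move: ei; rewrite -rcons_cat => /rcons_inj [ei _].
by move: VR; rewrite eV (negbTE (prefix_notin_region k ei)).
Qed.

(** The last rhombus is [[a,a+1]]; its left and right vertices index the numerator and the
    denominator of [f_{chi,a}]. *)
Lemma base_last : exists X, [/\ X \in T, tile_root X = simple_root a,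
  tile_right X = right_vertex a & tile_left X = lo a |: [set j : 'I_n | (a.+1 < j)%N]].
Proof.
exists (simple_root a, chain w b); split=> //.
- rewrite mem_word_tiling -cats1 walk_cat mem_cat; apply/orP; right.
  by rewrite /= -/w -/b w_lo w_hi mem_head.
- rewrite /tile_right (_ : tile_t _ = w (hi b)); last by rewrite w_hi.
  rewrite [_.2]/= -chain_step_eq.
  by rewrite wE stepK right_vertex_chain.
rewrite /tile_left (_ : tile_s _ = lo a) //; congr (_ |: _).
rewrite [_.2]/=.
rewrite wE chain_step; last by rewrite neq_ltn ltnSn.
have := ltn_ord a => an; rewrite chain_w0 /=; last by lia.
by apply/setP => x; rewrite !inE; lia.
Qed.

Lemma rexp_base X : X \in T ->
  [/\ (X.2 \in [set right_vertex a]) = false, (tile_left X \in [set right_vertex a]) = false,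
      (tile_top X \in [set right_vertex a]) = false
    & (tile_right X \in [set right_vertex a]) = (tile_root X == simple_root a)].
Proof.
move=> XT; have := XT; rewrite mem_word_tiling => /walk_split [i1 [p [i2 [ei e1 e2]]]].
have {}e1 : val X.1 = _ := e1; have {}e2 : X.2 = _ := e2.
have el : tile_left X = chain (run 1%g i1) p.+1.
  by rewrite /tile_left /tile_s e1 e2 chainS_lo.
have et : tile_top X = chain (run 1%g i1) p.+2.
  by rewrite /tile_top /tile_s /tile_t e1 e2 chainS_hi chainS_lo finset.setUCA.
have er : tile_right X = chain (run 1%g (rcons i1 p)) p.+1.
  by rewrite /tile_right /tile_t e1 e2 -cats1 run_cat chain_step_eq.
have ei1 : exists i3, i = i1 ++ i3.
  case/lastP: i2 ei => [|i2 q]; first by rewrite cats1 => /rcons_inj [-> _]; exists [::]; rewrite cats0.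
  by rewrite -rcons_cons -rcons_cat => /rcons_inj [-> _]; exists (p :: i2).
have [i3 ei3] := ei1.
have no k : (chain (run 1%g i1) k \in [set right_vertex a]) = false.
  apply/negbTE/negP; rewrite inE => /eqP e; have := prefix_notin_region k ei3.
  by rewrite e right_vertex_region.
rewrite e2 el et !no; split=> //.
case/lastP: i2 ei => [|i2 q] ei.
  have [e3 e4] : i = i1 /\ b = p by move: ei; rewrite cats1 => /rcons_inj [].
  rewrite er -e3 -e4 full right_vertex_chain inE eqxx; symmetry.
  by rewrite -(inj_eq val_inj) e1 -e3 -e4 -/w w_lo w_hi; apply/eqP.
have ei4 : i = rcons i1 p ++ i2.
  by move: ei; rewrite -rcons_cons -rcons_cat => /rcons_inj [-> _]; rewrite cat_rcons.
have Lp : ascent (run 1%g i1) p.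
  by move: Li; rewrite ei4 -cats1 legal_cat => /andP[]; rewrite legal_cat => /andP[_ /=]; rewrite andbT.
rewrite er.
have -> : (chain (run 1%g (rcons i1 p)) p.+1 \in [set right_vertex a]) = false.
  apply/negbTE/negP; rewrite inE => /eqP e; have := prefix_notin_region p.+1 ei4.
  by rewrite e right_vertex_region.
symmetry; apply/negbTE/eqP => eX.
have lohi : (lo a < hi a)%N by [].
have := mem_walk_roots lohi Li.
rewrite -/w -w_lo -w_hi !permK /= [X in _ && X]ltnNge leqnSn /= andbF => /negP; apply.
rewrite ei4 walk_cat map_cat mem_cat -cats1 walk_cat map_cat mem_cat /=.
rewrite in_cons -e1 -[X.1]/(tile_root X) eX /= w_lo w_hi.
by rewrite eqxx ?orbT.
Qed.

Lemma config_base : config a T = [set [set right_vertex a]].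
Proof.
apply/setP => c; rewrite [RHS]inE; apply/idP/eqP => [|->].
  rewrite inE => /and4P[/fintype.subsetP r /fintype.subsetP v vc _].
  apply/setP => V; rewrite inE; apply/idP/eqP => [Vc|->] //.
  by have /finset.bigcupP[X XT VX] := v V Vc; apply: vert_base XT VX (r V Vc).
have [X [XT eX eR _]] := base_last.
rewrite inE; apply/and4P; split.
- by rewrite finset.sub1set right_vertex_region.
- rewrite finset.sub1set; apply/finset.bigcupP; exists X => //.
  by apply/tile_vertsP; constructor 3.
- by rewrite inE.
apply/forall_inP => Y YT; have [cb cl ct _] := rexp_base YT.
have no V : V \in tile_verts Y -> (V \in [set right_vertex a]) = false -> (V \in region a) = false.
  by move=> VY; apply: contraFF => VR; rewrite inE (vert_base YT VY VR).
rewrite /tile_cond (no Y.2) ?(no (tile_left Y)) ?(no (tile_top Y)) //.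
- by rewrite /rhombus_cond /edge_cond /= implybT.
- by apply/tile_vertsP; constructor 4.
- by apply/tile_vertsP; constructor 2.
- by apply/tile_vertsP; constructor 1.
Qed.

Lemma rexp_baseE X : X \in T ->
  rexp [set right_vertex a] X = (tile_root X == simple_root a)%:Z.
Proof. by move=> /rexp_base[h1 h2 h3 h4]; rewrite /rexp h1 h2 h3 h4 subr0 subr0 add0r. Qed.

Lemma height_base (x : {ffun pos_root n -> nat}) :
  height T [set right_vertex a] x = (x (simple_root a))%:Z.
Proof.
have [X [XT eX eR _]] := base_last.
rewrite /height (big_setD1 X) //= big1 => [|Y]; last first.
  rewrite finset.in_setD1 => /andP[YX YT]; have [_ cl _ cr] := rexp_base YT.
  rewrite /slope cl cr (_ : (_ == _) = false) ?mulr0 //.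
  by apply/eqP => e; case/eqP: YX; apply: (tile_root_inj L) => //; rewrite eX.
have [_ cl _ cr] := rexp_base XT; rewrite /slope cl cr eX eqxx /=; lia.
Qed.

Lemma greatest_base x : greatest a T x [set right_vertex a].
Proof.
split; first by rewrite config_base inE.
  by move=> c; rewrite config_base inE => /eqP ->.
by move=> c; rewrite config_base inE => /eqP ->.
Qed.

Lemma shifted_base x : shifted a T x (incr (simple_root a) x).
Proof.
exists [set right_vertex a]; split; first exact: greatest_base.
by move=> X XT; rewrite rexp_baseE // ffunE PoszD.
Qed.

End Base.

(** * Transport along paths of moves *)

Section PathMaps.
Variable n : nat.
Implicit Types (i j : seq 'I_n.-1) (x y z : {ffun pos_root n -> nat}).
Implicit Types (T : {set tile n}).

(** The height of the weight of [x], the root [epsilon_s - epsilon_t] having height [t - s].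
    Transitions preserve it and [f_a^*] raises it by one, so it serves as the measure of an
    induction. *)
Definition weight x : nat :=
  (\sum_(r : pos_root n) x r * ((val r).2 - (val r).1))%N.

Definition crystal_map i j (F : {ffun pos_root n -> nat} -> {ffun pos_root n -> nat}) : Prop :=
  [/\ forall z, transition i j z (F z),
      forall a z z', shifted a (word_tiling i) z z' -> shifted a (word_tiling j) (F z) (F z'),
      forall a z c, c \in config a (word_tiling i) ->
        exists2 c', c' \in config a (word_tiling j) &
          height (word_tiling i) c z <= height (word_tiling j) c' (F z)
    & F [ffun=> 0%N] = [ffun=> 0%N] /\ forall z, weight (F z) = weight z].

Lemma crystal_map_id i : crystal_map i i id.
Proof.
split=> //; first by move=> z; apply: rt_refl.
by move=> a z c cT; exists c.
Qed.

Lemma crystal_map_comp i j k F G : crystal_map i j F -> crystal_map j k G -> crystal_map i k (G \o F).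
Proof.
move=> [t1 s1 h1 [z1 w1]] [t2 s2 h2 [z2 w2]]; split=> [z|a z z' h|a z c cT|].
- exact: rt_trans (t1 z) (t2 _).
- exact: s2 (s1 _ _ _ h).
- have [c1 c1T le1] := h1 a z c cT; have [c2 c2T le2] := h2 a (F z) c1 c1T.
  by exists c2 => //; apply: le_trans le1 le2.
- by rewrite /= z1 z2; split=> // z; rewrite /= w2 w1.
Qed.

Lemma weight_braid (A B C : pos_root n) (s t u : 'I_n) x :
  val A = (s, t) -> val B = (s, u) -> val C = (t, u) ->
  weight (braid_coord A B C x) = weight x.
Proof.
move=> eA eB eC; have [AB AC BC] := flip_roots eA eB eC.
have st := flip_st eA; have tu := flip_tu eC.
have split3 y : weight y = (y A * (t - s) + (y B * (u - s) + (y C * (u - t) +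
   \sum_(r : pos_root n | [&& r != A, r != B & r != C]) y r * ((val r).2 - (val r).1))))%N.
  rewrite /weight (bigD1 A) //= (bigD1 B) /=; last by rewrite eq_sym AB.
  rewrite (bigD1 C) /=; last by rewrite ![C == _]eq_sym AC BC.
  rewrite eA eB eC /=; do 3!congr (_ + _)%N; apply: eq_bigl => r.
  by rewrite -andbA.
rewrite !split3 (braidA _ _ _ x) (braidB eA eB eC) (braidC eA eB eC).
rewrite !addnA; congr (_ + _)%N; last first.
  apply: eq_bigr => r /and3P[rA rB rC]; rewrite braid_out //.
  by rewrite !inE !negb_or rA rB.
have m1 := geq_minl (x A) (x C); have m2 := geq_minr (x A) (x C).
move: m1 m2 st tu; clear; move: (minn _ _) (nat_of_ord s) (nat_of_ord t) (nat_of_ord u).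
move: (x A) (x B) (x C) => {x A B C s t u} A B C m s t u mA mC st tu.
have -> : (u - s = (u - t) + (t - s))%N by lia.
have [d1 ->] : exists d, A = (m + d)%N by exists (A - m)%N; lia.
have [d2 ->] : exists d, C = (m + d)%N by exists (C - m)%N; lia.
have -> : (m + d1 + B - m = d1 + B)%N by lia.
have -> : (m + d2 + B - m = d2 + B)%N by lia.
by rewrite !mulnDl !mulnDr; lia.
Qed.

Lemma braid0 (A B C : pos_root n) : braid_coord A B C [ffun=> 0%N] = [ffun=> 0%N].
Proof. by apply/ffunP => r; rewrite /braid_coord !ffunE /=; do ?case: ifP. Qed.

Lemma move_crystal_map i x j y : legal 1%g i -> move (i, x) (j, y) ->
  exists F G, [/\ crystal_map i j F, crystal_map j i G, cancel F G & y = F x].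
Proof.
move=> L /(move_fun L) [f [ey t1 t2 []]].
  move=> [eT ef]; exists id, id; rewrite ey ef; split=> //; split=> //.
  - by move=> z; apply: rt_step; have := t1 z; rewrite ef.
  - by rewrite eT.
  - by move=> a z c cT; exists c; rewrite ?eT // -eT.
  - by move=> z; apply: rt_step; have := t2 z; rewrite ef.
  - by rewrite eT.
  - by move=> a z c cT; exists c; rewrite ?eT // -eT.
move=> [A [B [C [S [s [t [u [ef hex]]]]]]]].
exists f, f.
have [eA eB eC] : [/\ val A = (s, t), val B = (s, u) & val C = (t, u)] by case: hex => -[].
have fK : cancel f f by rewrite ef; apply: braid_coordK eA eB eC.
have tr1 z : transition i j z (f z) by apply: rt_step.
have tr2 z : transition j i z (f z) by apply: rt_step; have := t2 (f z); rewrite fK.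
have f0 : f [ffun=> 0%N] = [ffun=> 0%N] by rewrite ef braid0.
have fw z : weight (f z) = weight z by rewrite ef (weight_braid _ eA eB eC).
have main T T' : hexagon T T' A B C S s t u -> forall a,
   [/\ forall z z', shifted a T z z' -> shifted a T' (f z) (f z'),
       forall z z', shifted a T' z z' -> shifted a T (f z) (f z'),
       forall z c, c \in config a T -> exists2 c', c' \in config a T' & height T c z <= height T' c' (f z)
     & forall z c, c \in config a T' -> exists2 c', c' \in config a T & height T' c z <= height T c' (f z)].
  move=> [_ _ _ [sS tS uS] [T0 [eT eT' T0P]]] a; rewrite ef; split=> [z z'|z z'|z c cT|z c cT].
  - exact: (shifted_up eA eB eC sS tS uS eT eT' T0P).
  - rewrite -{1}[z](braid_coordK eA eB eC).
    exact: (shifted_down eA eB eC sS tS uS eT eT' T0P).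
  - have [c' c'T [_ le]] := flip_up eA eB eC sS tS uS eT eT' T0P z cT.
    by exists c'.
  - have [c' c'T [_ le]] := flip_down eA eB eC sS tS uS eT eT' T0P (braid_coord A B C z) cT.
    by exists c'; rewrite ?(braid_coordK eA eB eC) in le *.
by case: hex => /main h; split=> //; split=> // a; have [] := h a.
Qed.

Lemma transition_crystal_map i x j y : legal 1%g i -> transition i j x y ->
  exists F G, [/\ crystal_map i j F, crystal_map j i G, cancel F G & y = F x].
Proof.
suff H a b : clos_refl_trans _ (@move n) a b -> legal 1%g a.1 ->
    exists F G, [/\ crystal_map a.1 b.1 F, crystal_map b.1 a.1 G, cancel F G & b.2 = F a.2].
  by move=> L h; have := H _ _ h L.
elim=> [[i1 x1] [j1 y1] m L|a' _|a' b' c' h1 IH1 _ IH2 L]; first exact: move_crystal_map L m.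
  by exists id, id; split=> //; apply: crystal_map_id.
have [F1 [G1 [f1 g1 k1 e1]]] := IH1 L.
have L' : legal 1%g b'.1.
  by case: a' b' h1 L {IH1 IH2 f1 g1 e1} => [i1 x1] [j1 y1] h1 L; have [] := transition_legal h1 L.
have [F2 [G2 [f2 g2 k2 e2]]] := IH2 L'.
exists (F2 \o F1), (G1 \o G2); split; rewrite /= ?e2 ?e1 //.
- exact: crystal_map_comp f1 f2.
- exact: crystal_map_comp g2 g1.
- exact: can_comp.
Qed.

(** [w0] has a descent everywhere, so [descent_word] can produce any last letter. *)
Lemma path_to_last i a : legal 1%g i -> run 1%g i = w0 n ->
  exists j F G, [/\ legal 1%g (rcons j (rev_ord a)), run 1%g (rcons j (rev_ord a)) = w0 n,
    crystal_map i (rcons j (rev_ord a)) F, crystal_map (rcons j (rev_ord a)) i G & cancel F G].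
Proof.
move=> L full; have desc : (run 1%g i (hi (rev_ord a)) < run 1%g i (lo (rev_ord a)))%N.
  by rewrite full /w0 !permE /=; have := ltn_ord a; lia.
have [j [Lj rj jj]] := descent_word L desc.
have [y tr] := jj [ffun=> 0%N].
have [F [G [f g k _]]] := transition_crystal_map L tr.
by exists j, F, G; rewrite rj.
Qed.

Lemma shifted_det (a : 'I_n.-1) (T : {set tile n}) x y z : (forall r, exists2 X, X \in T & tile_root X = r) ->
  shifted a T x y -> shifted a T x z -> y = z.
Proof.
move=> cov [c [[cT cmax cgr] ey]] [d [[dT dmax dgr] ez]].
have e : height T c x = height T d x by apply/eqP; rewrite eq_le cmax // dmax.
have ecd : c = d by apply/eqP; rewrite finset.eqEsubset dgr // cgr.
apply/ffunP => r; have [X XT <-] := cov r; apply/eqP; rewrite -eqz_nat.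
by rewrite ey // ez // ecd.
Qed.

Lemma cover_roots i (r : pos_root n) : legal 1%g i -> run 1%g i = w0 n ->
  exists2 X, X \in word_tiling i & tile_root X = r.
Proof.
move=> L full; have := @mem_roots_full _ i (val r).1 (val r).2 L full (valP r).
rewrite -surjective_pairing => /mapP[[r' V] hin e].
by exists (r, V) => //; rewrite mem_word_tiling /= e.
Qed.

(* Configurations are upward closed for the order in which a label above [a]
   may be added or lowered and a label below [a] may be removed or lowered. *)
Definition up_set (a : 'I_n.-1) (T : {set tile n}) (v : {set 'I_n}) : {set {set 'I_n}} :=
  [set V : {set 'I_n} | [&& V \in region a, V \in \bigcup_(X in T) tile_verts X,
    [forall l : 'I_n.+1, (#|[set x in v | a < x < l]| <= #|[set x in V | a < x < l]|)%N]
  & [forall l : 'I_n.+1, (#|[set x in V | l <= x < a]| <= #|[set x in v | l <= x < a]|)%N]]].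

Lemma in_up_set (a : 'I_n.-1) T (v V : {set 'I_n}) :
  (V \in up_set a T v) = [&& V \in region a, V \in \bigcup_(X in T) tile_verts X,
    [forall l : 'I_n.+1, (#|[set x in v | a < x < l]| <= #|[set x in V | a < x < l]|)%N]
  & [forall l : 'I_n.+1, (#|[set x in V | l <= x < a]| <= #|[set x in v | l <= x < a]|)%N]].
Proof. by rewrite [LHS]inE. Qed.

Lemma card_setU1_pred (P : pred 'I_n) (r : 'I_n) (V : {set 'I_n}) : r \notin V ->
  #|[set x in r |: V | P x]| = (P r + #|[set x in V | P x]|)%N.
Proof.
move=> rV; case Pr: (P r); last first.
  apply: eq_card => y; rewrite !inE; case: eqP => [->|//].
  by rewrite Pr !andbF.
rewrite (_ : [set x in r |: V | P x] = r |: [set x in V | P x]).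
  by rewrite cardsU1 inE (negbTE rV).
by apply/setP => y; rewrite !inE; case: eqP => [->|//]; rewrite Pr.
Qed.

Lemma up_set_config (a : 'I_n.-1) T (v : {set 'I_n}) :
  (forall X, X \in T -> (tile_s X \notin X.2) && (tile_t X \notin X.2)) ->
  v \in region a -> v \in \bigcup_(X in T) tile_verts X ->
  right_vertex a \in \bigcup_(X in T) tile_verts X ->
  up_set a T v \in config a T.
Proof.
move=> hT vR vV rV.
have rR : right_vertex a \in region a by rewrite in_region !inE /= ltnSn ltnn.
rewrite inE; apply/and4P; split.
- by apply/fintype.subsetP => V; rewrite in_up_set => /and4P[].
- by apply/fintype.subsetP => V; rewrite in_up_set => /and4P[].
- rewrite in_up_set rR rV /=; apply/andP; split; apply/forallP => l.
    by apply: subset_leq_card; apply/fintype.subsetP => x; rewrite !inE => /andP[_]; case/andP => -> ->.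
  rewrite (_ : [set x in right_vertex a | _] = finset.set0) ?cards0 //.
  by apply/setP => x; rewrite !inE; lia.
apply/forall_inP => X XT; have /andP[sS tS] := hT X XT.
have st : (tile_s X < tile_t X)%N := valP X.1.
have verts V : V \in tile_verts X -> V \in \bigcup_(X in T) tile_verts X.
  by move=> VX; apply/finset.bigcupP; exists X.
have v1 := verts _ (introT (tile_vertsP X X.2) (Or41 _ _ _ erefl)).
have v2 := verts _ (introT (tile_vertsP X _) (Or42 _ _ _ erefl)).
have v3 := verts _ (introT (tile_vertsP X _) (Or43 _ _ _ erefl)).
have v4 := verts _ (introT (tile_vertsP X _) (Or44 _ _ _ erefl)).
have edge (V : {set 'I_n}) (r : 'I_n) : r \notin V -> V \in \bigcup_(X in T) tile_verts X ->
   r |: V \in \bigcup_(X in T) tile_verts X ->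
   edge_cond (a < r)%N (V \in region a) (r |: V \in region a) (V \in up_set a T v) (r |: V \in up_set a T v).
  move=> rV' V1 V2; rewrite /edge_cond; apply/implyP => R1; apply/implyP => R2.
  case: ltnP => ar; apply/implyP; rewrite !in_up_set R1 R2 V1 V2 /= => /andP[/forallP h1 /forallP h2];
    apply/andP; split; apply/forallP => l; have := h1 l; have := h2 l.
  - by rewrite card_setU1_pred // => _ h; apply: leq_trans h (leq_addl _ _).
  - rewrite card_setU1_pred // => h _; have e : (l <= r < a)%N = false by rewrite [(r < a)%N]ltnNge (ltnW ar) andbF.
    by rewrite e.
  - have e : (a < r < l)%N = false by rewrite ltnNge ar.
    by move=> _; rewrite card_setU1_pred //= e.
  - by rewrite card_setU1_pred // => h _; apply: leq_trans (leq_addl _ _) h.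
have stS : tile_t X \notin tile_left X.
  by rewrite /tile_left in_setU1 negb_or tS andbT -val_eqE neq_ltn st orbT.
have tsS : tile_s X \notin tile_right X.
  by rewrite /tile_right in_setU1 negb_or sS andbT -val_eqE neq_ltn st.
have eT : tile_top X = tile_t X |: tile_left X by rewrite /tile_top /tile_left finset.setUCA.
rewrite /tile_cond /rhombus_cond; apply/and5P; split; rewrite ?eT.
- exact: edge.
- exact: edge.
- by apply: edge => //; rewrite -eT.
- by rewrite -eT; apply: edge.
apply/implyP => R1; apply/implyP => R2; apply/implyP => /eqP side; apply/implyP.
(* The label [a] itself counts neither as above nor as below; as a larger label it is excluded
   because the right vertex lies in the region. *)
have ta : (tile_t X != a :> nat).
  apply: contraTneq R2 => e; rewrite in_region /tile_right negb_and !negbK orbC.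
  by rewrite in_setU1 -val_eqE /= e eqxx.
rewrite !in_up_set R1 R2 v2 v3 /= => /andP[/forallP h1 /forallP h2].
apply/andP; split; apply/forallP => l; have := h1 l; have := h2 l.
  rewrite /tile_left /tile_right !card_setU1_pred // => g2 g1.
  apply: leq_trans g1 _; rewrite leq_add2r; move: side st; clear.
  by case: (ltnP a (tile_s X)) => h1; case: (ltnP a (tile_t X)) => h2 //= _ st; lia.
rewrite /tile_left /tile_right !card_setU1_pred // => g2 g1.
apply: leq_trans g2; rewrite leq_add2r; move: side st ta; clear.
by case: (ltnP a (tile_s X)) => h1; case: (ltnP a (tile_t X)) => h2 //= _ st; lia.
Qed.

End PathMaps.

(** * Closed paths of moves act trivially *)

Section Loops.
Variable n : nat.
Implicit Types (i j : seq 'I_n.-1) (x y z : {ffun pos_root n -> nat}).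
Implicit Types (T : {set tile n}) (w : 'S_n) (V : {set 'I_n}).

Lemma tile_notin i X : X \in word_tiling i -> (tile_s X \notin X.2) && (tile_t X \notin X.2).
Proof.
rewrite mem_word_tiling => /walk_split [i1 [p [i2 [_ e1 e2]]]].
have {}e1 : val X.1 = _ := e1; have {}e2 : X.2 = _ := e2.
by rewrite /tile_s /tile_t e1 e2 !notin_chain /= leqnn leqnSn.
Qed.

(** A configuration is carried back from a word ending in [rev_ord a]. It contains [right_vertex a],
    and all its members are vertices of the tiling. *)
Lemma right_vertex_vert i (a : 'I_n.-1) : legal 1%g i -> run 1%g i = w0 n ->
  right_vertex a \in \bigcup_(X in word_tiling i) tile_verts X.
Proof.
move=> L full; have [j [F [G [Lj fj _ [_ _ hG _] _]]]] := path_to_last a L full.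
have c0 : [set right_vertex a] \in config a (word_tiling (rcons j (rev_ord a))).
  by rewrite config_base // inE.
have [c' + _] := hG a [ffun=> 0%N] _ c0.
by rewrite inE => /and4P[_ /fintype.subsetP h vc _]; apply: h.
Qed.

Definition pair_coord x (st : 'I_n * 'I_n) : nat := if insub st is Some r then x r else 0%N.

Lemma pair_coord_val x (r : pos_root n) : pair_coord x (val r) = x r.
Proof. by rewrite /pair_coord valK. Qed.

Lemma last_nonzero w i x : has (fun b => pair_coord x b != 0%N) (map fst (walk w i)) ->
  exists i1 p i2, let w1 := run w i1 in [/\ i = i1 ++ p :: i2,
    pair_coord x (w1 (lo p), w1 (hi p)) != 0%N
    & forall b, b \in map fst (walk (step w1 p) i2) -> pair_coord x b = 0%N].
Proof.
elim: i w => //= p i IH w; case h: (has _ (map fst (walk (step w p) i))).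
  have [i1 [q [i2 [e1 e2 e3]]]] := IH _ h.
  by move=> _; exists (p :: i1), q, i2; rewrite e1.
rewrite orbF => nz; exists [::], p, i; split=> // b hb.
by apply/eqP; move/negbT/hasPn/(_ b hb): h; rewrite negbK.
Qed.

(** Take for [a+1] the least element of [V] above [s]. *)
Lemma separating_index (s t : 'I_n) V : (s < t)%N -> s \notin V -> t \in V ->
  exists a : 'I_n.-1, [/\ (s <= a)%N, (a < t)%N & V \in region a].
Proof.
move=> st sV tV; pose P m := [exists x in V, (x == m :> nat) && (s < m)%N].
have exP : exists m, P m by exists t; apply/existsP; exists t; rewrite tV eqxx.
case: (ex_minnP exP) => m /existsP[x /and3P[xV /eqP xm sm]] mmin.
have am : (m.-1 < n.-1)%N by have := ltn_ord x; rewrite xm; lia.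
have mt : (m <= t)%N by apply: mmin; apply/existsP; exists t; rewrite tV eqxx.
exists (Ordinal am); split; rewrite /=; try lia.
rewrite in_region; apply/andP; split.
  by rewrite (_ : hi _ = x) //; apply: val_inj; rewrite /= xm; lia.
apply/negP => aV; have [es|ns] := eqVneq (m.-1) (nat_of_ord s).
  by move: sV; rewrite (_ : s = lo (Ordinal am)) ?aV //; apply: val_inj.
have /mmin : P m.-1.
  apply/existsP; exists (lo (Ordinal am)); rewrite aV eqxx /=.
  by move: ns sm; lia.
by move: sm; lia.
Qed.

(** A vertex [V] of an earlier path inside [up_set] would have at least as many labels above [a] as
    [v] and at most as many below. By monotonicity its labels above [a] are bounded by those of the
    vertex of [w] at the same level: too few up to level [p.+1], and beyond it the two bounds add up
    to less than the level of [V]. *)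
Lemma up_set_avoid (a : 'I_n.-1) T i1 p i2 k :
  let w := run 1%g i1 in let v := w (hi p) |: chain w p in
  legal 1%g (i1 ++ p :: i2) -> (w (lo p) <= a)%N -> (a < w (hi p))%N ->
  v \in region a ->
  forall i0 i3, i1 = i0 ++ i3 -> (k <= n)%N -> chain (run 1%g i0) k \notin up_set a T v.
Proof.
move=> w v; rewrite legal_cat => /andP[L1 /= /andP[asc _]] sa at_ vR i0 i3 e0 kn.
set V := chain _ k; apply/negP; rewrite in_up_set => /and4P[VR _ /forallP hG /forallP hL].
have pn : (p.+1 < n)%N by case: (p) => m /=; case: (n).
pose N V := #|[set x in V | (a < x)%N]|; pose M V := #|[set x in V | (x < a)%N]|.
have NV : (N v <= N V)%N.
  have := hG ord_max; rewrite /N.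
  have e (W : {set 'I_n}) : [set x in W | (a < x < @ord_max n)%N] = [set x in W | (a < x)%N].
    by apply/setP => x; rewrite !inE /= ltn_ord andbT.
  by rewrite !e.
have MV : (M V <= M v)%N by have := hL ord0.
have NM (W : {set 'I_n}) : W \in region a -> (N W + M W = #|W|)%N.
  rewrite in_region => /andP[_ aW]; rewrite /N /M -cardsUI.
  rewrite (_ : _ :&: _ = finset.set0) ?cards0 ?addn0; last first.
    by apply/setP => x; rewrite !inE; lia.
  apply: eq_card => x; rewrite !inE; case xW: (x \in W) => //=.
  case: ltngtP => // e; move: aW; rewrite (_ : lo a = x) ?xW //; exact: val_inj.
have cV : #|V| = k by apply: card_chain.
have sS : w (lo p) \notin chain w p by rewrite notin_chain /=.
have tS : w (hi p) \notin chain w p by rewrite notin_chain /=.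
have cv : #|v| = p.+1 by rewrite cardsU1 tS card_chain // ltnW // ltnW.
have Nv : N v = (N (chain w p)).+1.
  by rewrite /N /v card_setU1_pred //= at_.
have dom : (N V <= N (chain w k))%N.
  have Li : legal (run 1%g i0) i3 by move: L1; rewrite e0 legal_cat => /andP[].
  have := upper_count_run a.+1 k Li; rewrite -run_cat -e0 -/w.
  by rewrite /upper_count.
have mono k1 k2 : (k1 <= k2)%N -> (N (chain w k1) <= N (chain w k2))%N.
  move=> le; apply: subset_leq_card; apply/fintype.subsetP => x; rewrite !inE => /andP[h ->].
  by rewrite (leq_trans h le).
have Ns : N (chain w p.+1) = N (chain w p).
  by rewrite /N chainS_lo card_setU1_pred //= ltnNge sa.
have [kp|kp] := leqP k p.+1.
  by have := mono _ _ kp; rewrite Ns; move: dom NV Nv; clear; lia.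
have step_N m : (m < n)%N -> (N (chain w m.+1) <= (N (chain w m)).+1)%N.
  move=> mn; rewrite -[m]/(nat_of_ord (Ordinal mn)) chainS /N card_setU1_pred ?notin_chain //.
  by apply: (@leq_add _ _ 1) => //; apply: leq_b1.
have N2 : N (chain w p.+2) = N v.
  rewrite Nv -Ns chainS_hi /N card_setU1_pred ?notin_chain //=.
  by rewrite at_.
have bound : (N (chain w k) <= N v + (k - p.+2))%N.
  have grow2 d : (p.+2 + d <= n)%N -> (N (chain w (p.+2 + d)) <= N (chain w p.+2) + d)%N.
    elim: d => [|d IH] h; first by rewrite !addn0.
    rewrite addnS in h *; apply: leq_trans (step_N _ h) _.
    by have := IH (ltnW h); lia.
  by have := grow2 (k - p.+2)%N; rewrite subnKC // N2; apply.
have := NM _ VR; have := NM _ vR; rewrite cV cv.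
by move: MV bound dom kp; clear; lia.
Qed.

(** Take the last swept tile with nonzero coordinate, an index [a] separating its labels, and the
    [up_set] of its right vertex. The slope there is 1, earlier tiles avoid the set, and later
    coordinates vanish, so the height is that one coordinate. *)
Lemma exists_positive i x : legal 1%g i -> run 1%g i = w0 n -> x != [ffun=> 0%N] ->
  exists a c, c \in config a (word_tiling i) /\ 0 < height (word_tiling i) c x.
Proof.
move=> L full nz.
have hasx : has (fun b => pair_coord x b != 0%N) (map fst (walk 1%g i)).
  apply/hasP; have [r xr] : exists r, x r != 0%N.
    apply/existsP; apply: contraNT nz; rewrite negb_exists => /forallP h.
    by apply/eqP/ffunP => r; rewrite ffunE; apply/eqP; move: (h r); rewrite negbK.
  exists (val r); last by rewrite pair_coord_val.
  have [[r1 V1] + e] := cover_roots r L full.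
  by rewrite mem_word_tiling => h; apply/mapP; exists (val r1, V1) => //; rewrite -e.
have [i1 [p [i2 [ei xp zeros]]]] := last_nonzero hasx.
set w := run 1%g i1 in xp zeros.
have Lp : ascent w p by move: L; rewrite ei legal_cat => /andP[_ /= /andP[]].
have sS : w (lo p) \notin chain w p by rewrite notin_chain /=.
have tS : w (hi p) \notin chain w p by rewrite notin_chain /=.
pose v := w (hi p) |: chain w p.
have sv : w (lo p) \notin v.
  by rewrite in_setU1 negb_or sS andbT -val_eqE neq_ltn -/(ascent w p) Lp.
have [a [sa at_ vR]] := separating_index Lp sv (finset.setU11 _ _).
pose X0 : tile n := (exist _ (w (lo p), w (hi p)) Lp, chain w p).
have X0T : X0 \in word_tiling i.
  by rewrite mem_word_tiling ei walk_cat mem_cat /= in_cons eqxx orbT.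
have rX0 : tile_right X0 = v by [].
have vV : v \in \bigcup_(X in word_tiling i) tile_verts X.
  by apply/finset.bigcupP; exists X0 => //; apply/tile_vertsP; constructor 3.
set T := word_tiling i in X0T vV *.
have cT : up_set a T v \in config a T.
  by apply: up_set_config => // [X|]; [exact: tile_notin|exact: right_vertex_vert].
exists a, (up_set a T v); split=> //.
have L' : legal 1%g (i1 ++ p :: i2) by rewrite -ei.
have avoid := up_set_avoid T L' sa at_ vR.
have pn : (p.+1 < n)%N by case: (p) => m /=; case: (n).
rewrite /height (big_setD1 X0) //= big1 => [|X].
  have -> : slope (up_set a T v) X0 = 1.
    have left_out : tile_left X0 \notin up_set a T v.
      rewrite [tile_left X0](_ : _ = chain w p.+1); last by rewrite chainS_lo.
      by apply: (avoid p.+1 i1 [::]); rewrite ?cats0 // ltnW.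
    rewrite /slope rX0 (negbTE left_out) in_up_set vR vV /=.
    by rewrite (_ : _ && _ = true) //; apply/andP; split; apply/forallP => l.
  rewrite mulr1 addr0 ltz_nat lt0n -pair_coord_val.
  by rewrite /tile_root.
rewrite finset.in_setD1 => /andP[XX0 XT].
have : (val X.1, X.2) \in walk 1%g (i1 ++ p :: i2) by rewrite -ei -mem_word_tiling.
rewrite walk_cat mem_cat /= in_cons -/w => /or3P[h|/eqP [e1 e2]|h].
- have out (V : {set 'I_n}) : V \in tile_verts X -> (V \in up_set a T v) = false.
    move=> VX; have [i0 [i3 [k [e0 kn ->]]]] := vert_walk h VX.
    exact/negbTE/(avoid k i0 i3).
  rewrite /slope !out ?subrr ?mulr0 //; apply/tile_vertsP; [constructor 2|constructor 3] => //.
- case/eqP: XX0; case: (X) e1 e2 => r V /= e1 ->; congr (_, _); exact: val_inj.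
- rewrite (_ : x (tile_root X) = 0%N) ?mul0r // -pair_coord_val.
  by apply: zeros; apply/mapP; exists (val X.1, X.2).
Qed.

Lemma weight_incr r x : weight (incr r x) = (weight x + ((val r).2 - (val r).1))%N.
Proof.
rewrite /weight (eq_bigr (fun r' => x r' * ((val r').2 - (val r').1) +
  (r' == r) * ((val r').2 - (val r').1))%N) => [|r' _]; last by rewrite ffunE mulnDl.
rewrite big_split /=; congr (_ + _)%N; rewrite (bigD1 r) //= eqxx mul1n big1 ?addn0 //.
by move=> r' /negbTE ->.
Qed.

(** Induction on the weight. For nonzero [x] some height is positive; in a word ending in
    [rev_ord a] this height bounds the coordinate of the simple root from below, so [x] is [f_a^*]
    of a vector of smaller weight, and [F] commutes with [f_a^*]. *)
Lemma loop_id i F : legal 1%g i -> run 1%g i = w0 n -> crystal_map i i F -> forall x, F x = x.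
Proof.
move=> L full [_ sF _ [F0 _]] x; have [m] := ubnP (weight x).
elim: m x => // m IH x hm.
have [->//|nz] := eqVneq x [ffun=> 0%N].
have [a [c [cT pos]]] := exists_positive L full nz.
have [j [F1 [G1 [Lj fj pF pG k]]]] := path_to_last a L full.
have [_ _ hF [_ wF]] := pF; have [_ sG _ [_ wG]] := pG.
have [c' + le] := hF a x c cT; rewrite config_base // inE => /eqP ec.
move: le; rewrite ec height_base // => le.
have ypos : (0 < F1 x (simple_root a))%N by rewrite -ltz_nat; apply: lt_le_trans pos le.
(* The truncated subtraction is exact by [ypos]. *)
pose y : {ffun pos_root n -> nat} := [ffun r => (F1 x r - (r == simple_root a))%N].
have ey : incr (simple_root a) y = F1 x.
  apply/ffunP => r; rewrite !ffunE; case: eqP => [->|_]; last by rewrite subn0 addn0.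
  by rewrite subnK.
have sh : shifted a (word_tiling i) (G1 y) x.
  by have := sG _ _ _ (shifted_base Lj fj y); rewrite ey k.
have wy : (weight y < weight x)%N.
  by rewrite -(wF x) -ey weight_incr /= subSn // subnn addn1.
have := sF _ _ _ sh; rewrite IH; last first.
  by rewrite wG; apply: leq_trans wy _; rewrite -ltnS.
move=> sh'; apply: shifted_det sh' sh => r.
exact: cover_roots.
Qed.

End Loops.

(** * Every configuration as a greatest maximizer *)

Section Realization.
Variables (n : nat) (a : 'I_n.-1).
Implicit Types (i j : seq 'I_n.-1) (x y z : {ffun pos_root n -> nat}).
Implicit Types (T : {set tile n}) (w : 'S_n) (V : {set 'I_n}) (c d : {set {set 'I_n}}).
Local Notation ptile := ('I_n * 'I_n * {set 'I_n})%type.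

Lemma big_word_tiling (R : Type) (idx : R) (op : Monoid.com_law idx) i (G : ptile -> R) :
  legal 1%g i ->
  \big[op/idx]_(X in word_tiling i) G (val X.1, X.2) = \big[op/idx]_(b <- walk 1%g i) G b.
Proof.
move=> L; pose f (X : tile n) : ptile := (val X.1, X.2).
have fI : injective f by move=> [r V] [r' V'] [/val_inj -> ->].
rewrite -[LHS]big_enum /= -(big_map f xpredT G); apply: perm_big.
apply: uniq_perm; first by rewrite map_inj_uniq ?enum_uniq.
  by have := uniq_walk_roots L; apply: map_uniq.
move=> b; apply/mapP/idP => [[X + ->]|hb]; first by rewrite mem_enum mem_word_tiling.
have lt : (b.1.1 < b.1.2)%N.
  move: L hb; elim: i 1%g => //= p i IH w /andP[asc L].
  by rewrite in_cons => /orP[/eqP -> //|]; apply: IH.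
exists (exist _ b.1 lt, b.2); last by rewrite /f /= -surjective_pairing.
by rewrite mem_enum mem_word_tiling /= -surjective_pairing.
Qed.

Definition pleft (b : ptile) : {set 'I_n} := b.1.1 |: b.2.
Definition pright (b : ptile) : {set 'I_n} := b.1.2 |: b.2.

Variable omega : {set 'I_n} -> int.

(* Along each level the value drops by [omega] at every vertex passed, so that
   by summation by parts the height becomes the total [omega] of the
   configuration, up to boundary terms. *)
Fixpoint levels (e : nat -> int) w i : seq (ptile * int) :=
  if i is p :: i' then
    (w (lo p), w (hi p), chain w p, e p.+1) ::
    levels (fun k => if k == p.+1 then e k - omega (chain (step w p) k) else e k) (step w p) i'
  else [::].

Lemma levels_walk e w i : map fst (levels e w i) = walk w i.
Proof. by elim: i e w => //= p i IH e w; rewrite IH. Qed.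

(** A step lowers one level by at most 1 and there are [size i] steps. Starting at [size i]
    therefore keeps the values nonnegative, as coordinates of a vector must be. *)
Lemma levels_ge0 e w i : (forall V, omega V <= 1) -> (forall k, (size i)%:Z <= e k) ->
  forall q, q \in levels e w i -> 0 <= q.2.
Proof.
move=> om; elim: i e w => //= p i IH e w he q; rewrite in_cons => /orP[/eqP -> /=|].
  by apply: le_trans (he _).
apply: IH => k; case: eqP => [->|_]; have := he k; last by lia.
by have := he p.+1; have := om (chain (step w p) p.+1); lia.
Qed.

Fixpoint last_level (e : nat -> int) w i : nat -> int :=
  if i is p :: i' then
    last_level (fun k => if k == p.+1 then e k - omega (chain (step w p) k) else e k) (step w p) i'
  else e.

Lemma levels_sum e w i c :
  \sum_(q <- levels e w i) q.2 * ((pright q.1 \in c)%:Z - (pleft q.1 \in c)%:Z) =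
  \sum_(k < n.+1) ((chain (run w i) k \in c)%:Z * last_level e w i k - (chain w k \in c)%:Z * e k)
  + \sum_(b <- walk w i) omega (pright b) * (pright b \in c)%:Z.
Proof.
elim: i e w => [|p i IH] e w.
  by rewrite /= !big_nil addr0 big1 // => k _; rewrite subrr.
rewrite [levels _ _ _]/= big_cons IH [walk _ _]/= [in RHS]big_cons.
rewrite -[run w (p :: i)]/(run (step w p) i).
set e' := fun k : nat => _; rewrite -[last_level e w _]/(last_level e' (step w p) i).
rewrite /pright /pleft [_.2]/= [_.1.1]/= [_.1.2]/=.
rewrite -chain_step_eq -chainS_lo.
have pn : (p.+1 < n.+1)%N by case: (p) => m /=; case: (n) => // n' h; apply: ltnW; rewrite !ltnS in h *.
pose k0 := Ordinal pn.
rewrite [X in _ + (X + _)](bigD1 k0) //= [in RHS](bigD1 k0) //= /e' eqxx.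
rewrite (eq_bigr (fun k : 'I_n.+1 => ((chain (run (step w p) i) k \in c)%:Z *
    last_level e' (step w p) i k - (chain w k \in c)%:Z * e k))); last first.
  by move=> k /negbTE kk; rewrite chain_step ?(negbTE (negbT kk)) // -/e' -[k == p.+1 :> nat]/(k == k0) kk.
ring.
Qed.

Lemma notin_region_initial k : chain 1%g k \notin region a.
Proof.
rewrite in_region !inE invg1 !perm1 /= -leqNgt; apply/negP => /andP[h1 h2].
by have := leq_trans h1 h2; rewrite ltnNge leqnSn.
Qed.

Lemma region_last k : (k <= n)%N -> chain (w0 n) k \in region a -> chain (w0 n) k = right_vertex a.
Proof.
move=> kn; rewrite in_region chain_w0 // !inE /= => h.
by apply/setP => x; rewrite !inE; lia.
Qed.

(** The left boundary has no vertex in the region, so each vertex of the region first appears as the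
    right vertex of a swept rhombus, where [omega] is counted. *)
Lemma region_right i X V : X \in word_tiling i -> V \in tile_verts X -> V \in region a ->
  exists2 b, b \in walk 1%g i & pright b = V.
Proof.
rewrite mem_word_tiling => XT VX VR; have [i1 [i2 [k [-> kn eV]]]] := vert_walk XT VX.
suff [b hb eb] : exists2 b, b \in walk 1%g i1 & pright b = V.
  by exists b => //; rewrite walk_cat mem_cat hb.
elim/last_ind: i1 eV => [|i1 p IH] eV; first by move: VR; rewrite eV (negbTE (notin_region_initial k)).
have [ek|nk] := eqVneq k p.+1.
  exists (run 1%g i1 (lo p), run 1%g i1 (hi p), chain (run 1%g i1) p).
    by rewrite -cats1 walk_cat mem_cat /= mem_head orbT.
  by rewrite eV ek -cats1 run_cat /pright /= chain_step_eq.
have [|b hb eb] := IH; first by rewrite eV -cats1 run_cat /run /= chain_step.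
by exists b => //; rewrite -cats1 walk_cat mem_cat hb.
Qed.

End Realization.

Section Realize.
Variables (n : nat) (a : 'I_n.-1) (i : seq 'I_n.-1).
Hypotheses (L : legal 1%g i) (full : run 1%g i = w0 n).
Let T := word_tiling i.
Implicit Types (c d : {set {set 'I_n}}).

(** Reward 1 on [c] and penalty 1 off it. Up to a constant the height becomes the total of [omega]
    over the right vertices in the configuration, so [c] is maximal and including a vertex outside
    [c] costs strictly. *)
Lemma realize c : c \in config a T -> exists x, greatest a T x c.
Proof.
move=> cT; pose omega V : int := if V \in c then 1 else -1.
pose lv := levels omega (fun _ => (size i)%:Z) 1%g i.
have lvw : map fst lv = walk 1%g i by apply: levels_walk.
have U : uniq (map (fst \o fst) lv) by rewrite map_comp lvw uniq_walk_roots.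
pose x : {ffun pos_root n -> nat} :=
  [ffun r => absz (nth 0 (map snd lv) (index (val r) (map (fst \o fst) lv)))].
have om1 V : omega V <= 1 by rewrite /omega; case: ifP.
have xE q : q \in lv -> (pair_coord x q.1.1)%:Z = q.2.
  move=> qlv; have lt : (q.1.1.1 < q.1.1.2)%N.
    have : q.1 \in walk 1%g i by rewrite -lvw; apply: map_f.
    move: (q.1) L => b; elim: (i) 1%g => //= p i' IH w /andP[asc L'].
    by rewrite in_cons => /orP[/eqP -> //|]; apply: IH.
  rewrite -[q.1.1]/(val (exist (fun st : 'I_n * 'I_n => (st.1 < st.2)%N) q.1.1 lt)) pair_coord_val ffunE /=.
  have -> : index q.1.1 (map (fst \o fst) lv) = index q lv.
    have hlt : (index q lv < size (map (fst \o fst) lv))%N by rewrite size_map index_mem.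
    rewrite -[RHS](index_uniq q.1.1 hlt U); congr (index _ _).
    by rewrite (nth_map q) ?index_mem // nth_index.
  rewrite (nth_map q) ?index_mem // nth_index //.
  by rewrite gez0_abs //; apply: (levels_ge0 om1 _ qlv).
have H d : height T d x = \sum_(k < n.+1) ((chain (w0 n) k \in d)%:Z * last_level omega (fun _ => (size i)%:Z) 1%g i k
     - (chain 1%g k \in d)%:Z * (size i)%:Z) + \sum_(b <- walk 1%g i) omega (pright b) * (pright b \in d)%:Z.
  rewrite -full -levels_sum -/lv.
  pose G (b : 'I_n * 'I_n * {set 'I_n}) : int :=
    (pair_coord x b.1)%:Z * ((pright b \in d)%:Z - (pleft b \in d)%:Z).
  have -> : height T d x = \sum_(b <- walk 1%g i) G b.
    rewrite -(big_word_tiling _ G L); apply: eq_bigr => X _.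
    by rewrite /G [_.1]/= pair_coord_val.
  rewrite -lvw big_map; apply: eq_big_seq => q qlv.
  by rewrite /G xE.
(* The boundary terms are the same for all configurations: none meets the left boundary, and each
   meets the right boundary in [right_vertex a] alone. *)
have bd d : d \in config a T -> \sum_(k < n.+1) ((chain (w0 n) k \in d)%:Z * last_level omega (fun _ => (size i)%:Z) 1%g i k
     - (chain 1%g k \in d)%:Z * (size i)%:Z) = \sum_(k < n.+1) ((chain (w0 n) k == right_vertex a)%:Z * last_level omega (fun _ => (size i)%:Z) 1%g i k).
  rewrite inE => /and4P[/fintype.subsetP r _ vd _]; apply: eq_bigr => k _.
  have -> : (chain 1%g k \in d) = false.
    by apply/negbTE/negP => /r; rewrite (negbTE (notin_region_initial a k)).
  rewrite mul0r subr0; congr (_%:Z * _); congr nat_of_bool.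
  apply/idP/eqP => [/r h|-> //]; apply: region_last h.
  by rewrite -ltnS.
have le V d : omega V * (V \in d)%:Z <= omega V * (V \in c)%:Z.
  by rewrite /omega; case: (V \in c); case: (V \in d).
exists x; split=> // [d dT|d dT].
  by rewrite !H !bd // lerD2l; apply: ler_sum => b _; apply: le.
rewrite !H !bd // => /addrI eqs; apply/fintype.subsetP => V Vd.
have VR : V \in region a by move: dT; rewrite inE => /and4P[/fintype.subsetP r _ _ _]; apply: r.
have /finset.bigcupP[X XT VX] : V \in \bigcup_(X in T) tile_verts X.
  by move: dT; rewrite inE => /and4P[_ /fintype.subsetP r _ _]; apply: r.
have [b hb eb] := region_right XT VX VR.
apply/negPn/negP => Vc.
have : \sum_(b <- walk 1%g i) omega (pright b) * (pright b \in d)%:Z <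
       \sum_(b <- walk 1%g i) omega (pright b) * (pright b \in c)%:Z.
  rewrite (big_rem _ hb) [X in _ < X](big_rem _ hb) /= ltr_leD //.
    by rewrite eb Vd (negbTE Vc) /omega (negbTE Vc).
  by apply: ler_sum => b' _; apply: le.
by rewrite eqs ltxx.
Qed.

Definition expo (c : {set {set 'I_n}}) : exponent n :=
  [ffun r => \sum_(X in T | tile_root X == r) rexp c X].

Lemma expoE c X : X \in T -> expo c (tile_root X) = rexp c X.
Proof.
move=> XT; rewrite ffunE (big_pred1 X) // => Y; apply/andP/eqP => [[YT /eqP e]|->] //.
exact: tile_root_inj L YT XT e.
Qed.

Lemma expo_eq c (y : exponent n) : (forall X, X \in T -> y (tile_root X) = rexp c X) -> y = expo c.
Proof.
move=> h; apply/ffunP => r; have [X XT <-] := cover_roots r L full.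
by rewrite h // expoE.
Qed.

(** Forwards, the paths in [fstar] to a word ending in [rev_ord a] and back form a loop, which acts
    trivially, so the result obeys [shifted]. Backwards, a vector realizing [c] is carried to such a
    word, incremented and carried back. *)
Lemma RstarP (y : exponent n) : Rstar a i y <-> exists2 c, c \in config a T & y = expo c.
Proof.
split=> [[x [x' [[j [z [rj [u ej] t1 t2]]] ey]]]|[c cT ->]].
  have [F1 [G1 [p1 _ _ e1]]] := transition_crystal_map L t1.
  have [Lj fj] := reduced_legal rj.
  have [F2 [G2 [p2 _ _ e2]]] := transition_crystal_map Lj t2.
  have lp := loop_id L full (crystal_map_comp p1 p2).
  have [_ s2 _ _] := p2; have Lj' := Lj; have fj' := fj; rewrite ej in Lj' fj'.
  have := s2 a z (incr (simple_root a) z); rewrite ej in s2 *.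
  move=> /(_ (shifted_base Lj' fj' z)); rewrite -e2 e1 -[F2 (F1 x)]/((F2 \o F1) x) lp.
  move=> [c [[cT _ _] h]]; exists c => //; apply: expo_eq => X XT.
  by rewrite ey h // addrC addKr.
have [x gx] := realize cT.
have [j [F [G [Lj fj pF pG k]]]] := path_to_last a L full.
have [tF _ _ _] := pF; have [tG sG _ _] := pG.
have sh : shifted a T x (G (incr (simple_root a) (F x))).
  by have := sG _ _ _ (shifted_base Lj fj (F x)); rewrite k.
exists x, (G (incr (simple_root a) (F x))); split.
  exists (rcons j (rev_ord a)), (F x); split=> //; first exact: legal_reduced.
  by exists j.
move=> r; have [X XT <-] := cover_roots r L full; rewrite expoE //.
have [d [[dT dmax dgr] h]] := sh; have [_ cmax cgr] := gx.
have e : height T c x = height T d x by apply/eqP; rewrite eq_le cmax // dmax.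
have -> : c = d by apply/eqP; rewrite finset.eqEsubset dgr // cgr.
by rewrite h // addrC addKr.
Qed.

End Realize.

(** * The sum over configurations *)

Section GenericSum.
Variables (n : nat) (a : 'I_n.-1).
Implicit Types (i j : seq 'I_n.-1) (x y z : {ffun pos_root n -> nat}).

(** Indexes the numerator of [f_{chi,a}]. It is the left vertex of the last rhombus when the word
    ends in [rev_ord a], not the top vertex of a tile. *)
Definition top_vertex : {set 'I_n} := lo a |: [set j : 'I_n | (a.+1 < j)%N].

Section Field.
Variables (K : fieldType) (g : 'M[K]_n).

Definition minor_ratio (X : tile n) : K := minor g (tile_left X) / minor g (tile_right X).

Definition config_sum (T : {set tile n}) : K :=
  \sum_(c in config a T) \prod_(X in T) minor_ratio X ^ rexp c X.

Hypothesis g0 : forall S, minor g S != 0.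

Lemma config_sum_hexagon T T' A B C S s t u :
  hexagon T T' A B C S s t u -> config_sum T = config_sum T'.
Proof.
move=> [eA eB eC [sS tS uS] [T0 [eT eT' T0P]]].
have pl := plucker s (flip_st eA) (flip_tu eC) sS tS uS (g0 S).
have vA1 : minor_ratio (A, S) = minor g (vs S s) / minor g (vt S t).
  by rewrite /minor_ratio; have [-> -> _] := flipA1 S eA.
have vB1 : minor_ratio (B, vt S t) = minor g (vst S s t) / minor g (vtu S t u).
  by rewrite /minor_ratio; have [-> -> _] := flipB1 S t eB.
have vC1 : minor_ratio (C, S) = minor g (vt S t) / minor g (vu S u).
  by rewrite /minor_ratio; have [-> -> _] := flipC1 S eC.
have vA2 : minor_ratio (A, vu S u) = minor g (vsu S s u) / minor g (vtu S t u).
  by rewrite /minor_ratio; have [-> -> _] := flipA2 S u eA.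
have vB2 : minor_ratio (B, S) = minor g (vs S s) / minor g (vu S u).
  by rewrite /minor_ratio; have [-> -> _] := flipB2 S eB.
have vC2 : minor_ratio (C, vs S s) = minor g (vst S s t) / minor g (vsu S s u).
  by rewrite /minor_ratio; have [-> -> _] := flipC2 S s eC.
have qE : minor_ratio (A, S) * minor_ratio (C, S) + minor_ratio (B, vt S t) =
   minor g (vt S t) * minor g (vsu S s u) / (minor g (vu S u) * minor g (vtu S t u)).
  rewrite vA1 vB1 vC1 /vt /vsu pl -/(vs S s) -/(vtu S t u) -/(vu S u) -/(vst S s t).
  by field; rewrite !g0.
have H := @flip_sum n a T T' T0 A B C S s t u eA eB eC sS tS uS eT eT' T0P K minor_ratio.
apply: H; rewrite ?qE ?vA1 ?vB1 ?vC1 ?vA2 ?vB2 ?vC2;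
  rewrite ?mulf_neq0 ?invr_neq0 ?mulf_neq0 //; by field; rewrite !g0.
Qed.

Lemma config_sum_transition i x j y : legal 1%g i -> transition i j x y ->
  config_sum (word_tiling i) = config_sum (word_tiling j).
Proof.
suff H p q : clos_refl_trans _ (@move n) p q -> legal 1%g p.1 ->
    config_sum (word_tiling p.1) = config_sum (word_tiling q.1) by move=> L h; apply: H h L.
elim=> [[i1 x1] [j1 y1] m L|//|p' b' c' h1 IH1 _ IH2 L].
  have [f [_ _ _ []]] := move_fun L m; first by move=> [-> _].
  by move=> [A [B [C [S [s [t [u [_ []]]]]]]]] h; rewrite (config_sum_hexagon h).
rewrite IH1 // IH2 //.
by case: p' b' h1 L {IH1 IH2} => [i1 x1] [j1 y1] h1 L; have [] := transition_legal h1 L.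
Qed.

(** Along a path to a word ending in [rev_ord a] the sum is constant; there the only configuration
    has exponent 1 at [[a,a+1]] and 0 elsewhere. *)
Lemma config_sum_generic i : legal 1%g i -> run 1%g i = w0 n ->
  config_sum (word_tiling i) = minor g top_vertex / minor g (right_vertex a).
Proof.
move=> L full; have [j [F [G [Lj fj [tF _ _ _] _ _]]]] := path_to_last a L full.
rewrite (config_sum_transition L (tF [ffun=> 0%N])) /config_sum config_base // big_set1.
have [X [XT eX eR eL]] := base_last Lj fj.
rewrite (bigD1 X) //= (rexp_baseE Lj fj XT) eX eqxx expr1z big1 ?mulr1; first by rewrite /minor_ratio eR eL.
move=> Y /andP[YT YX]; rewrite (rexp_baseE Lj fj YT) (_ : (_ == _) = false) //.
apply/eqP => e; case/eqP: YX; apply: (tile_root_inj Lj) => //; by rewrite eX.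
Qed.

End Field.

(** * Specialization from a generic pencil *)

Section Specialization.
Variable C : fieldType.
Local Notation KX := {fraction {poly C}}.

(* [f] is regular at 0 with value [c]. *)
Definition specializes (f : KX) (c : C) : Prop := exists p q : {poly C},
  [/\ q.[0] != 0, f = tofrac p / tofrac q & c = p.[0] / q.[0]].

Lemma frac_neq0 (q : {poly C}) : q.[0] != 0 -> tofrac q != 0 :> KX.
Proof. by apply: contraNneq => /eqP; rewrite tofrac_eq0 => /eqP ->; rewrite horner0. Qed.

Lemma specializes_poly (p : {poly C}) : specializes (tofrac p) p.[0].
Proof. by exists p, 1; rewrite hornerE oner_neq0 tofrac1 !divr1. Qed.

Lemma specializes0 : specializes 0 0.
Proof. by have := specializes_poly 0; rewrite tofrac0 horner0. Qed.

Lemma specializes1 : specializes 1 1.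
Proof. by have := specializes_poly 1; rewrite tofrac1 hornerE. Qed.

Lemma specializesD f f' c c' : specializes f c -> specializes f' c' -> specializes (f + f') (c + c').
Proof.
move=> [p [q [q0 -> ->]]] [p' [q' [q0' -> ->]]]; exists (p * q' + p' * q), (q * q').
rewrite !hornerE mulf_neq0 //; split=> //; rewrite ?tofracD ?tofracM addf_div ?frac_neq0 //.
Qed.

Lemma specializesM f f' c c' : specializes f c -> specializes f' c' -> specializes (f * f') (c * c').
Proof.
move=> [p [q [q0 -> ->]]] [p' [q' [q0' -> ->]]]; exists (p * p'), (q * q').
by split; rewrite ?hornerM ?mulf_neq0 ?tofracM // mulf_div.
Qed.

Lemma specializesV f c : c != 0 -> specializes f c -> specializes f^-1 c^-1.
Proof.
move=> c0 [p [q [q0 -> ec]]]; exists q, p; split; rewrite ?ec ?invf_div //.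
by move: c0; rewrite ec mulf_eq0 negb_or => /andP[].
Qed.

Lemma specializesX f c m : specializes f c -> specializes (f ^+ m) (c ^+ m).
Proof.
move=> h; elim: m => [|m IH]; first by rewrite !expr0; apply: specializes1.
by rewrite !exprS; apply: specializesM.
Qed.

Lemma specializesXz f c (m : int) : c != 0 -> specializes f c -> specializes (f ^ m) (c ^ m).
Proof.
move=> c0 h; case: m => m; first exact: specializesX.
by rewrite !NegzE -!exprnN; apply: specializesV; [rewrite expf_neq0|exact: specializesX].
Qed.

Lemma specializes_uniq f c c' : specializes f c -> specializes f c' -> c = c'.
Proof.
move=> [p [q [q0 e1 ->]]] [p' [q' [q0' e2 ->]]].
have : tofrac p / tofrac q = tofrac p' / tofrac q' :> KX by rewrite -e1.
move/eqP; rewrite eqr_div ?frac_neq0 // -!tofracM tofrac_eq => /eqP e.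
by apply/eqP; rewrite eqr_div // -!hornerM e.
Qed.

Variable g : 'M[C]_n.
Hypothesis char0 : forall m : nat, (m%:R == 0 :> C) = (m == 0%N).

(** The line through [g] at 0 and a Vandermonde matrix with nodes 0, 1, 2, ... at 1. All minors are
    nonzero at 1, hence nonzero as polynomials, whatever vanishes at [g]. *)
Definition pencil : 'M[{poly C}]_n :=
  (1 - 'X) *: map_mx polyC g + 'X *: \matrix_(k, l) ((l : nat)%:R ^+ k)%:P.

Lemma pencil0 : map_mx (horner_eval 0) pencil = g.
Proof. by apply/matrixP => k l; rewrite !mxE /horner_eval !hornerE subr0 mul1r. Qed.

Lemma minor_vandermonde S : minor (\matrix_(k < n, l < n) ((l : nat)%:R ^+ k) : 'M[C]_n) S != 0.
Proof.
set v := \row_(l < #|S|) ((enum_val l : 'I_n) : nat)%:R : 'rV[C]_#|S|.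
have -> : minor (\matrix_(k < n, l < n) ((l : nat)%:R ^+ k) : 'M[C]_n) S = \det (Vandermonde #|S| v).
  by rewrite /minor; congr (\det _); apply/matrixP => k l; rewrite !mxE.
rewrite det_Vandermonde; apply/prodf_neq0 => k _; apply/prodf_neq0 => l kl.
rewrite !mxE subr_eq0; apply/negP => /eqP e.
have inj (m1 m2 : nat) : (m1 <= m2)%N -> m2%:R = m1%:R :> C -> m2 = m1.
  move=> le /eqP; rewrite -subr_eq0 -natrB // char0 subn_eq0 => h.
  by apply/eqP; rewrite eqn_leq h le.
have e' : enum_val l = enum_val k.
  apply: val_inj; case: (leqP (enum_val l) (enum_val k)) => h; last exact: inj (ltnW h) e.
  by apply/esym; apply: inj h (esym e).
by move: kl; rewrite (enum_val_inj e') ltnn.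
Qed.

Lemma minor_pencil S : minor (map_mx (@tofrac {poly C}) pencil) S != 0 :> KX.
Proof.
rewrite minor_map tofrac_eq0; apply: contra_neq (minor_vandermonde S) => e.
rewrite (_ : \matrix_(k, l) _ = map_mx (horner_eval 1) pencil); last first.
  by apply/matrixP => k l; rewrite !mxE /horner_eval !hornerE subrr mul0r add0r ?mul1r.
by rewrite minor_map e /= /horner_eval horner0.
Qed.

Lemma specializes_minor S : specializes (minor (map_mx (@tofrac {poly C}) pencil) S) (minor g S).
Proof.
rewrite minor_map -[in X in specializes _ X]pencil0 minor_map.
exact: specializes_poly.
Qed.

(** Both sides specialize from the pencil, and values at 0 are unique. Only the minors appearing as
    denominators or as bases of powers in the final formula must be nonzero at [g], not those met
    along the path of flips. *)
Lemma config_sum_torus i : legal 1%g i -> run 1%g i = w0 n ->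
  (forall X, X \in word_tiling i -> minor g (tile_left X) != 0 /\ minor g (tile_right X) != 0) ->
  minor g (right_vertex a) != 0 ->
  config_sum g (word_tiling i) = minor g top_vertex / minor g (right_vertex a).
Proof.
move=> L full gT gr; apply: (@specializes_uniq (config_sum (map_mx (@tofrac {poly C}) pencil) (word_tiling i))).
  apply: (big_ind2 specializes); [exact: specializes0|move=> ? ? ? ?; apply: specializesD|move=> c _].
  apply: (big_ind2 specializes); [exact: specializes1|move=> ? ? ? ?; apply: specializesM|move=> X XT].
  have [l0 r0] := gT X XT.
  apply: specializesXz; first by rewrite mulf_neq0 ?invr_neq0.
  by apply: specializesM; [|apply: specializesV => //]; apply: specializes_minor.
rewrite config_sum_generic //; last exact: minor_pencil.
by apply: specializesM; [|apply: specializesV => //]; apply: specializes_minor.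
Qed.

End Specialization.

End GenericSum.

(** * Tilings of the polygon *)

Section Geometry.
Variables (R : realType) (n : nat).
Implicit Types (p q d : 'rV[R]_2) (S U V W : {set 'I_n}) (r s t : 'I_n) (X Y : tile n).

Definition cross p q : R := p 0 0 * q 0 1 - p 0 1 * q 0 0.

Lemma crossDl p p' q : cross (p + p') q = cross p q + cross p' q.
Proof. by rewrite /cross !mxE; ring. Qed.
Lemma crossDr p q q' : cross p (q + q') = cross p q + cross p q'.
Proof. by rewrite /cross !mxE; ring. Qed.
Lemma crossNr p q : cross p (- q) = - cross p q.
Proof. by rewrite /cross !mxE; ring. Qed.
Lemma crossZl k p q : cross (k *: p) q = k * cross p q.
Proof. by rewrite /cross !mxE; ring. Qed.
Lemma crossZr k p q : cross p (k *: q) = k * cross p q.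
Proof. by rewrite /cross !mxE; ring. Qed.
Lemma crossC p q : cross q p = - cross p q.
Proof. by rewrite /cross; ring. Qed.
Lemma crossvv p : cross p p = 0.
Proof. by rewrite /cross; ring. Qed.
Lemma cross_sumr p (I : finType) (P : pred I) (F : I -> 'rV[R]_2) :
  cross p (\sum_(j | P j) F j) = \sum_(j | P j) cross p (F j).
Proof.
apply: (big_morph (cross p)) => [? ?|]; first exact: crossDr.
by rewrite /cross !mxE; ring.
Qed.

Local Notation e := (edge_vec R).
Local Notation v := (vertex_pt R).

Definition angle r : R := pi - (r.*2.+1)%:R * pi / (n.*2)%:R.

Lemma angle_itv r : 0 < angle r < pi.
Proof.
have n0 : 0 < (n.*2)%:R :> R by rewrite ltr0n; case: r => r /=; lia.
have p0 := pi_gt0 R.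
rewrite /angle subr_gt0 ltrBlDr ltrDl; apply/andP; split; last first.
  by rewrite divr_gt0 // mulr_gt0 // ltr0n.
by rewrite ltr_pdivrMr // mulrC ltr_pM2l // ltr_nat; case: r => r /=; lia.
Qed.

Lemma angle_lt r s : (s < r)%N -> angle r < angle s.
Proof.
move=> sr; have n0 : 0 < (n.*2)%:R :> R by rewrite ltr0n; case: r sr => r /=; lia.
rewrite /angle ltrD2l ltrN2 ltr_pM2r ?invr_gt0 // ltr_pM2r ?pi_gt0 //.
by rewrite ltr_nat; lia.
Qed.

Lemma edge_sin r : e r 0 1 = sin (angle r). Proof. by rewrite mxE. Qed.
Lemma edge_cos r : e r 0 0 = cos (angle r). Proof. by rewrite mxE. Qed.

Lemma cross_lt r s : (s < r)%N -> 0 < cross (e r) (e s).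
Proof.
move=> sr; rewrite /cross !edge_sin !edge_cos.
have -> : cos (angle r) * sin (angle s) - sin (angle r) * cos (angle s) = sin (angle s - angle r).
  by rewrite sinB; ring.
have /andP[r0 _] := angle_itv r; have /andP[_ s1] := angle_itv s.
apply: sin_gt0_pi; rewrite subr_gt0 angle_lt //=.
by rewrite ltrBlDr (lt_trans s1) // ltrDl.
Qed.

Lemma cross_gt r s : (r < s)%N -> cross (e r) (e s) < 0.
Proof. by move=> rs; rewrite crossC oppr_lt0 cross_lt. Qed.

(** A direction to the right, transversal to every edge since all edges point upwards; it serves to
    look at the two sides of an edge. *)
Definition horizontal : 'rV[R]_2 := \row_c (c == 0)%:R.

Lemma cross_horizontal r : cross (e r) horizontal < 0.
Proof.
rewrite /cross edge_sin !mxE /= mulr0 sub0r mulr1 oppr_lt0.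
by apply: sin_gt0_pi; exact: angle_itv.
Qed.

Lemma vertexU1 r S : r \notin S -> v (r |: S) = e r + v S.
Proof. by move=> rS; rewrite /vertex_pt big_setU1. Qed.

Lemma hull_vertex (A : {set {set 'I_n}}) W : W \in A -> hull A (v W).
Proof.
move=> WA; exists (fun U => (U == W)%:R); split; first by move=> U; rewrite ler0n.
  by rewrite (bigD1 W) //= eqxx big1 ?addr0 // => U /andP[_ /negbTE->].
rewrite (bigD1 W) //= eqxx scale1r big1 ?addr0 // => U /andP[_ /negbTE->].
by rewrite scale0r.
Qed.

Lemma hull_convex (A : {set {set 'I_n}}) p q k : 0 <= k <= 1 ->
  hull A p -> hull A q -> hull A (p + k *: (q - p)).
Proof.
move=> /andP[k0 k1] [c [c0 c1 ->]] [c' [c0' c1' ->]].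
exists (fun U => (1 - k) * c U + k * c' U); split.
- by move=> U; rewrite addr_ge0 // mulr_ge0 // subr_ge0.
- by rewrite big_split /= -!mulr_sumr c1 c1'; ring.
rewrite -sumrB scaler_sumr -big_split /=; apply: eq_bigr => U _.
by rewrite scalerBr !scalerA -scalerBl -scalerDl addrC addrAC; congr (_ *: _); ring.
Qed.

(* The coordinates of [p] in the frame with origin the bottom of the tile and
   basis its two lower edges. *)
Definition coord_s X p : R :=
  cross (p - v X.2) (e (tile_t X)) / cross (e (tile_s X)) (e (tile_t X)).
Definition coord_t X p : R :=
  cross (e (tile_s X)) (p - v X.2) / cross (e (tile_s X)) (e (tile_t X)).

Definition proper_tile X := (tile_s X \notin X.2) && (tile_t X \notin X.2).

Lemma tile_s_lt_t X : (tile_s X < tile_t X)%N.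
Proof. exact: valP X.1. Qed.

Lemma cross_tile X : cross (e (tile_s X)) (e (tile_t X)) < 0.
Proof. exact/cross_gt/tile_s_lt_t. Qed.

Lemma coordK X p :
  p = v X.2 + coord_s X p *: e (tile_s X) + coord_t X p *: e (tile_t X).
Proof.
have := cross_tile X; rewrite /coord_s /coord_t /cross => /ltr0_neq0.
move: (e (tile_s X)) (e (tile_t X)) (v X.2) => u w z D0.
apply/rowP => c; have [->|->] : c = 0 \/ c = 1.
- by case: c => [[|[|c]] //] ?; [left|right]; apply: val_inj.
- by rewrite !mxE; field.
- by rewrite !mxE; field.
Qed.

Lemma coordE X a b p : p = v X.2 + a *: e (tile_s X) + b *: e (tile_t X) ->
  coord_s X p = a /\ coord_t X p = b.
Proof.
move=> ->; have /ltr0_neq0 D0 := cross_tile X.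
have e0 : v X.2 + a *: e (tile_s X) + b *: e (tile_t X) - v X.2
    = a *: e (tile_s X) + b *: e (tile_t X) by rewrite addrC -addrA addKr.
rewrite /coord_s /coord_t e0 !crossDl !crossDr !crossZl !crossZr !crossvv.
by rewrite !mulr0 addr0 add0r !mulfK.
Qed.

Lemma vertex_left X : proper_tile X -> v (tile_left X) = e (tile_s X) + v X.2.
Proof. by case/andP=> h _; rewrite /tile_left vertexU1. Qed.
Lemma vertex_right X : proper_tile X -> v (tile_right X) = e (tile_t X) + v X.2.
Proof. by case/andP=> _ h; rewrite /tile_right vertexU1. Qed.
Lemma s_neq_t X : tile_s X != tile_t X.
Proof. by have := tile_s_lt_t X; rewrite ltn_neqAle => /andP[]. Qed.
Lemma vertex_top X : proper_tile X ->
  v (tile_top X) = e (tile_s X) + (e (tile_t X) + v X.2).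
Proof.
case/andP=> h h'; rewrite /tile_top !vertexU1 // in_setU1 negb_or h.
by rewrite s_neq_t.
Qed.

Lemma sum_tile_verts (V : nmodType) X (F : {set 'I_n} -> V) : proper_tile X ->
  \sum_(W in tile_verts X) F W =
  F X.2 + F (tile_left X) + F (tile_right X) + F (tile_top X).
Proof.
move=> /andP[h h']; have st := s_neq_t X.
have c1 : #|tile_left X| = #|X.2|.+1 by rewrite cardsU1 h.
have c2 : #|tile_right X| = #|X.2|.+1 by rewrite cardsU1 h'.
have c3 : #|tile_top X| = #|X.2|.+2 by rewrite !cardsU1 h' in_setU1 negb_or h st.
have ne (U W : {set 'I_n}) : #|U| != #|W| -> U != W by apply: contraNneq => ->.
rewrite tile_vertsE -!finset.setUA !big_setU1 ?big_set1 //=.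
- by rewrite !addrA.
- by rewrite inE ne // c2 c3; lia.
- rewrite !inE negb_or (ne _ (tile_top X)) ?c1 ?c3 ?andbT; last by lia.
  apply: contraNneq h => e1; have := setU11 (tile_s X) X.2.
  by rewrite -/(tile_left X) e1 in_setU1 (negbTE st).
- by rewrite !inE !negb_or !ne // ?c1 ?c2 ?c3; lia.
Qed.

(** Barycentric weights on [A], extended by 0, give the coordinates in the frame of the tile.
    Applied to the vertices common to two tiles, this shows which vertices must be common. *)
Lemma hull_tile X (A : {set {set 'I_n}}) p : proper_tile X -> A \subset tile_verts X -> hull A p ->
  exists c : {set 'I_n} -> R,
  [/\ forall W, 0 <= c W, forall W, W \notin A -> c W = 0,
      c X.2 + c (tile_left X) + c (tile_right X) + c (tile_top X) = 1,
      coord_s X p = c (tile_left X) + c (tile_top X)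
    & coord_t X p = c (tile_right X) + c (tile_top X)].
Proof.
move=> pX sA [c [c0 c1 ep]]; pose c' W := if W \in A then c W else 0.
have sumA (V : nmodType) (F : {set 'I_n} -> V) : (forall W, W \notin A -> F W = 0) ->
    \sum_(W in A) F W = \sum_(W in tile_verts X) F W.
  move=> F0; rewrite [RHS](bigID (mem A)) /= [X in _ + X]big1 ?addr0; last by move=> W /andP[_ /F0].
  by apply: eq_bigl => W; apply/idP/andP => [h|[]//]; split=> //; apply: (fintype.subsetP sA).
have s1 : c' X.2 + c' (tile_left X) + c' (tile_right X) + c' (tile_top X) = 1.
  rewrite -sum_tile_verts // -sumA; last by move=> W /negbTE h; rewrite /c' h.
  by rewrite -c1; apply: eq_bigr => W h; rewrite /c' h.
have [es et] : coord_s X p = c' (tile_left X) + c' (tile_top X) /\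
    coord_t X p = c' (tile_right X) + c' (tile_top X).
  apply: coordE.
  have -> : p = \sum_(W in A) c' W *: v W.
    by rewrite ep; apply: eq_bigr => W h; rewrite /c' h.
  rewrite sumA; last by move=> W /negbTE h; rewrite /c' h scale0r.
  rewrite sum_tile_verts // vertex_left // vertex_right // vertex_top //.
  have -> : c' X.2 = 1 - c' (tile_left X) - c' (tile_right X) - c' (tile_top X).
    by rewrite -s1; ring.
  move: (c' _) (c' _) (c' _) (e (tile_s X)) (e (tile_t X)) (v X.2) => c2 c3 c4 u w z.
  by apply/rowP => k; rewrite !mxE; ring.
exists c'; split=> // W; first by rewrite /c'; case: ifP.
by move=> /negbTE h; rewrite /c' h.
Qed.

Lemma hull_tileP X p : proper_tile X ->
  hull (tile_verts X) p <-> 0 <= coord_s X p <= 1 /\ 0 <= coord_t X p <= 1.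
Proof.
move=> pX; split.
  move=> /(hull_tile pX (fintype.subxx _)) [c [c0 _ s1 -> ->]].
  have := c0 X.2; have := c0 (tile_left X); have := c0 (tile_right X); have := c0 (tile_top X).
  by move: s1; clear; split; apply/andP; split; lra.
have := coordK X p; move: (coord_s X p) (coord_t X p) => a b -> [/andP[a0 a1] /andP[b0 b1]].
have -> : v X.2 + a *: e (tile_s X) + b *: e (tile_t X) =
   (v X.2 + a *: (v (tile_left X) - v X.2)) + b *: ((v (tile_right X) + a *: (v (tile_top X) - v (tile_right X))) - (v X.2 + a *: (v (tile_left X) - v X.2))).
  rewrite vertex_left // vertex_right // vertex_top // !addrK.
  by move: (e (tile_s X)) (e (tile_t X)) (v X.2) => u w z; apply/rowP => k; rewrite !mxE; ring.
by apply: hull_convex; rewrite ?b0 //; apply: hull_convex; rewrite ?a0 //; apply: hull_vertex;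
  apply/tile_vertsP; [constructor 1|constructor 2|constructor 3|constructor 4].
Qed.

End Geometry.

Section Eventually.
Variable R : realType.
Implicit Types (P Q : R -> Prop) (a k : R).

Definition small_enough P := exists2 eps0 : R, 0 < eps0 & forall eps, 0 < eps < eps0 -> P eps.

Lemma small_and P Q : small_enough P -> small_enough Q -> small_enough (fun eps => P eps /\ Q eps).
Proof.
move=> [a a0 Pa] [b b0 Qb]; exists (Num.min a b); first by rewrite lt_min a0.
move=> eps /andP[e0]; rewrite lt_min => /andP[ea eb].
by split; [apply: Pa|apply: Qb]; rewrite e0.
Qed.

Lemma small_imp P Q : (forall eps, 0 < eps -> P eps -> Q eps) -> small_enough P -> small_enough Q.
Proof. by move=> PQ [a a0 Pa]; exists a => // eps /[dup] /Pa h /andP[e0 _]; apply: PQ. Qed.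

Lemma small_true : small_enough (fun=> True).
Proof. by exists 1. Qed.

Lemma small_ex P : small_enough P -> exists2 eps, 0 < eps & P eps.
Proof.
move=> [a a0 Pa]; exists (a / 2); first by rewrite divr_gt0.
by apply: Pa; rewrite divr_gt0 //= ltr_pdivrMr // ltr_pMr // ltr1n.
Qed.

Lemma small_pos a k : 0 < a -> small_enough (fun eps => 0 < a + eps * k).
Proof.
move=> a0; have k0 : 0 < `|k| + 1 by rewrite ltr_wpDl.
exists (a / (`|k| + 1)); first exact: divr_gt0.
move=> eps /andP[e0]; rewrite ltr_pdivlMr // => h.
have := ler_norm (- k); rewrite normrN => hk.
suff : - (eps * k) < a by rewrite -subr_gt0 opprK.
apply: le_lt_trans h; rewrite -mulrN ler_pM2l //.
by rewrite (le_trans hk) // lerDl.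
Qed.

Lemma small_pos0 a k : 0 <= a -> 0 < k -> small_enough (fun eps => 0 < a + eps * k).
Proof.
move=> a0 k0; apply: small_imp small_true => eps e0 _.
by rewrite ltr_wpDl // mulr_gt0.
Qed.

(** A strict violation at the base point persists under small shifts. *)
Lemma small_closed a k : small_enough (fun eps => 0 <= a + eps * k -> 0 <= a).
Proof.
have [a0|a0] := leP 0 a; first by apply: small_imp small_true.
apply: (small_imp _ (@small_pos (- a) (- k) _)); rewrite ?oppr_gt0 // => eps e0.
by rewrite mulrN -opprD oppr_gt0 => h h'; move: (lt_le_trans h h'); rewrite ltxx.
Qed.

Lemma small_all (I : eqType) (s : seq I) (Q : I -> R -> Prop) :
  (forall x, x \in s -> small_enough (Q x)) ->
  small_enough (fun eps => forall x, x \in s -> Q x eps).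
Proof.
elim: s => [|y s IH] h; first by apply: small_imp small_true.
have hy : small_enough (Q y) by apply: h; rewrite mem_head.
have hs : small_enough (fun eps => forall x, x \in s -> Q x eps).
  by apply: IH => x xs; apply: h; rewrite in_cons xs orbT.
apply: small_imp (small_and hy hs) => eps _ [q1 q2] x; rewrite in_cons => /orP[/eqP->//|].
exact: q2.
Qed.

End Eventually.

Section TileCombinatorics.
Variable n : nat.
Implicit Types (X Y : tile n) (d : edge n) (S W : {set 'I_n}) (r : 'I_n) (b : bool).

Definition left_edge X d := (d == (X.2, tile_s X)) || (d == (tile_left X, tile_t X)).
Definition right_edge X d := (d == (X.2, tile_t X)) || (d == (tile_right X, tile_s X)).

Lemma tile_edgesE X d : (d \in tile_edges X) = left_edge X d || right_edge X d.
Proof. by rewrite !inE -orbA orbACA. Qed.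

(* [border true] and [border false] give the left and the right boundary. *)
Definition border b r : {set 'I_n} := [set q : 'I_n | if b then (q < r)%N else (r < q)%N].

Definition side_edge b X d := if b then right_edge X d else left_edge X d.

(** Boundary edges have no tile on their outer side: the order of the two labels of such a tile
    would contradict the shape of [border b r]. *)
Lemma side_edge_border b X r : proper_tile X -> ~~ side_edge b X (border b r, r).
Proof.
move=> /andP[hs ht]; have st := tile_s_lt_t X; rewrite /side_edge /right_edge /left_edge.
case: b; apply/negP => /orP[] /eqP[e1 e2].
- by move: hs; rewrite -e1 inE e2 st.
- have : tile_t X \in tile_right X by rewrite setU11.
  by rewrite -e1 inE e2; lia.
- by move: ht; rewrite -e1 inE e2 st.
- have : tile_s X \in tile_left X by rewrite setU11.
  by rewrite -e1 inE e2; lia.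
Qed.

Lemma cards_tile X : proper_tile X ->
  [/\ #|tile_left X| = #|X.2|.+1, #|tile_right X| = #|X.2|.+1 & #|tile_top X| = #|X.2|.+2].
Proof.
move=> /andP[h h']; rewrite /tile_top !cardsU1 h h' in_setU1 negb_or h.
by rewrite s_neq_t.
Qed.

Lemma setU1_inj S r r' : r \notin S -> r |: S = r' |: S -> r = r'.
Proof. by move=> rS e; have := setU11 r S; rewrite e in_setU1 (negbTE rS) orbF => /eqP. Qed.

Lemma edge_of_verts X S r : proper_tile X -> r \notin S ->
  S \in tile_verts X -> r |: S \in tile_verts X -> (S, r) \in tile_edges X.
Proof.
move=> pX rS; have [c1 c2 c3] := cards_tile pX; move: (pX) => /andP[h h'].
have c4 : #|r |: S| = #|S|.+1 by rewrite cardsU1 rS.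
have no (U W : {set 'I_n}) (A : Prop) : U = W -> #|U| != #|W| -> A by move=> ->; rewrite eqxx.
case/tile_vertsP => eS; case/tile_vertsP => eV;
  try (by apply: (no _ _ _ eV); rewrite c4 eS ?c1 ?c2 ?c3; lia).
- by move: eV; rewrite eS => /(setU1_inj _) -> //; rewrite ?inE ?eqxx // -eS.
- by move: eV; rewrite eS => /(setU1_inj _) -> //; rewrite ?inE ?eqxx ?orbT // -eS.
- move: eV; rewrite eS /tile_top finset.setUCA -/(tile_left X) => /(setU1_inj _) -> //.
    by rewrite !inE eqxx !orbT.
  by rewrite -eS.
- move: eV; rewrite eS /tile_top -/(tile_right X) => /(setU1_inj _) -> //.
    by rewrite !inE eqxx !orbT.
  by rewrite -eS.
Qed.

Lemma tile_eq X Y : proper_tile X -> proper_tile Y -> X.2 = Y.2 -> tile_top X = tile_top Y -> X = Y.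
Proof.
move=> /andP[hs ht] /andP[hs' ht'] e2 e.
have st := tile_s_lt_t X; have st' := tile_s_lt_t Y.
have in_top (Z : tile n) r : r \notin Z.2 -> (r \in tile_top Z) = (r == tile_s Z) || (r == tile_t Z).
  by move=> rZ; rewrite !in_setU1 (negbTE rZ) orbF.
have es : (tile_s X == tile_s Y) || (tile_s X == tile_t Y).
  by rewrite -in_top -?e2 // -e in_top // eqxx.
have et : (tile_t X == tile_s Y) || (tile_t X == tile_t Y).
  by rewrite -in_top -?e2 // -e in_top // eqxx orbT.
have [{}es {}et] : tile_s X = tile_s Y /\ tile_t X = tile_t Y.
  case/orP: es et => /eqP es /orP[] /eqP et; rewrite es et in st *; try by [].
  - by rewrite ltnn in st.
  - by move: st st'; lia.
  - by rewrite ltnn in st.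
case: X Y es et e2 {hs ht hs' ht' st st' in_top e} => [[[s t] X1] X2] [[[s' t'] Y1] Y2].
by rewrite /tile_s /tile_t /= => es et <-; congr (_, _); apply: val_inj; rewrite /= es et.
Qed.

Lemma tile_eq_bot_top X Y : proper_tile X -> proper_tile Y ->
  X.2 \in tile_verts Y -> tile_top X \in tile_verts Y -> X = Y.
Proof.
move=> pX pY; have [c1 c2 c3] := cards_tile pX; have [d1 d2 d3] := cards_tile pY.
have no (U W : {set 'I_n}) (A : Prop) : U = W -> #|U| != #|W| -> A by move=> ->; rewrite eqxx.
case/tile_vertsP => eS; case/tile_vertsP => eV;
  try (by apply: (no _ _ _ eV); rewrite c3 eS ?d1 ?d2 ?d3; lia).
exact: tile_eq.
Qed.

Lemma tile_cap X : proper_tile X -> tile_left X :&: tile_right X = X.2.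
Proof.
move=> pX; apply/setP => r; rewrite !inE; have st := s_neq_t X.
by case: (r \in X.2); rewrite ?orbT ?orbF //; case: eqP => //= ->; apply/negbTE.
Qed.

Lemma tile_cup X : tile_left X :|: tile_right X = tile_top X.
Proof. by apply/setP => r; rewrite !inE; case: (r == tile_s X); case: (r == tile_t X); case: (r \in X.2). Qed.

(** Bottom and top are the intersection and the union of the left and the right vertex, so a shared
    diagonal between these determines the tile. *)
Lemma tile_eq_left_right X Y : proper_tile X -> proper_tile Y ->
  tile_left X \in tile_verts Y -> tile_right X \in tile_verts Y -> X = Y.
Proof.
move=> pX pY; have [c1 c2 c3] := cards_tile pX; have [d1 d2 d3] := cards_tile pY.
have no (U W : {set 'I_n}) (A : Prop) : U = W -> #|U| != #|W| -> A by move=> ->; rewrite eqxx.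
have cc : #|X.2| = #|tile_left X :&: tile_right X| by rewrite tile_cap.
have lr (U : {set 'I_n}) : tile_left X = U -> tile_right X = U -> False.
  by move=> e1 e2; move: cc; rewrite e1 e2 finset.setIid -e1 c1; lia.
case/tile_vertsP => eS; case/tile_vertsP => eV;
  try (by case: (lr _ eS eV));
  try (by apply: (no _ (tile_right X) _ (erefl _)); rewrite c2 -c1 eS eV ?d1 ?d2 ?d3; lia).
all: try (by have := c1; rewrite -c2 eS eV ?d1 ?d2 ?d3; lia).
- by apply: tile_eq; rewrite // -?tile_cap // -?tile_cup eS eV.
- by apply: tile_eq; rewrite // -?tile_cap // -?tile_cup eS eV ?(finset.setIC (tile_right Y))
    ?(finset.setUC (tile_right Y)).
Qed.

End TileCombinatorics.

(** * Tiles on the two sides of an edge *)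

Section Adjacency.
Variables (R : realType) (n : nat) (T : {set tile n}).
Hypothesis tilT : is_tiling R T.
Implicit Types (p d : 'rV[R]_2) (S W : {set 'I_n}) (q r : 'I_n) (X Y : tile n) (b : bool).

Local Notation e := (edge_vec R).
Local Notation v := (vertex_pt R).

Lemma tiling_proper X : X \in T -> proper_tile X.
Proof. by case: tilT => h _ _; apply: h. Qed.

(** For distinct tiles the point would be a combination of common vertices. An interior point needs
    positive weight on two opposite vertices, and a common diagonal forces the tiles to be equal. *)
Lemma interior_uniq X Y p : X \in T -> Y \in T ->
  0 < coord_s X p < 1 -> 0 < coord_t X p < 1 -> hull (tile_verts Y) p -> X = Y.
Proof.
move=> XT YT /andP[a0 a1] /andP[b0 b1] hY; apply/eqP; apply: contraT => XY.
have pX := tiling_proper XT; have pY := tiling_proper YT.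
have hX : hull (tile_verts X) p by apply/(hull_tileP _ pX); rewrite !ltW.
have [_ _ cap] := tilT; have := cap X Y XT YT XY p hX hY.
move=> /(hull_tile pX (finset.subsetIl _ _)) [c [c0 cA c1 es et]].
have mem W : c W != 0 -> W \in tile_verts Y.
  by apply: contraNT => h; rewrite cA // finset.in_setI negb_and h orbT.
have [ct|ct] := eqVneq (c (tile_top X)) 0.
  rewrite (tile_eq_left_right pX pY) ?eqxx // in XY.
    by apply: mem; rewrite gt_eqF //; move: es et ct; lra.
  by apply: mem; rewrite gt_eqF //; move: es et ct; lra.
have [cb|cb] := eqVneq (c X.2) 0.
  rewrite (tile_eq_left_right pX pY) ?eqxx // in XY.
    by apply: mem; rewrite gt_eqF //; move: es et cb c1; lra.
  by apply: mem; rewrite gt_eqF //; move: es et cb c1; lra.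
by rewrite (tile_eq_bot_top pX pY) ?eqxx ?mem // in XY.
Qed.

Definition slope_s X d : R := cross d (e (tile_t X)) / cross (e (tile_s X)) (e (tile_t X)).
Definition slope_t X d : R := cross (e (tile_s X)) d / cross (e (tile_s X)) (e (tile_t X)).

Lemma coord_s_line X p eps d : coord_s X (p + eps *: d) = coord_s X p + eps * slope_s X d.
Proof. by rewrite /coord_s /slope_s addrAC (crossDl (p - v X.2)) crossZl mulrDl mulrA. Qed.
Lemma coord_t_line X p eps d : coord_t X (p + eps *: d) = coord_t X p + eps * slope_t X d.
Proof. by rewrite /coord_t /slope_t addrAC (crossDr _ (p - v X.2)) crossZr mulrDl mulrA. Qed.

Lemma tile_hull_closed p d : small_enough (fun eps => forall X, X \in enum T ->
  hull (tile_verts X) (p + eps *: d) -> hull (tile_verts X) p).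
Proof.
apply: small_all => X; rewrite mem_enum => XT; have pX := tiling_proper XT.
have h1 := small_closed (coord_s X p) (slope_s X d).
have h2 := small_closed (1 - coord_s X p) (- slope_s X d).
have h3 := small_closed (coord_t X p) (slope_t X d).
have h4 := small_closed (1 - coord_t X p) (- slope_t X d).
apply: small_imp (small_and (small_and h1 h2) (small_and h3 h4)) => eps _ [[k1 k2] [k3 k4]].
move=> /(hull_tileP _ pX)[]; rewrite coord_s_line coord_t_line => /andP[l1 l2] /andP[l3 l4].
apply/(hull_tileP _ pX); rewrite k1 // k3 // -subr_ge0 k2 -1?subr_ge0 ?k4 //.
  by move: l4; rewrite -subr_ge0; lra.
by move: l2; rewrite -subr_ge0; lra.
Qed.

Lemma slope_horizontal X : slope_s X (horizontal R) < 0 /\ 0 < slope_t X (horizontal R).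
Proof.
have D0 := cross_tile R X.
rewrite /slope_s /slope_t (crossC (e (tile_t X))); split.
  by rewrite ltr_ndivrMr // mul0r oppr_gt0 cross_horizontal.
by rewrite ltr_ndivlMr // mul0r cross_horizontal.
Qed.

(* [p] is on the boundary of [X], just to the left ([b = false]) or to the
   right ([b = true]) of interior points of [X]. *)
Definition beside b X p := if b then [&& 0 <= coord_s X p, coord_s X p < 1, 0 < coord_t X p & coord_t X p <= 1]
  else [&& 0 < coord_s X p, coord_s X p <= 1, 0 <= coord_t X p & coord_t X p < 1].

Lemma beside_interior b X p : beside b X p ->
  small_enough (fun eps => 0 < coord_s X (p + eps *: ((-1) ^+ b *: horizontal R)) < 1 /\
     0 < coord_t X (p + eps *: ((-1) ^+ b *: horizontal R)) < 1).
Proof.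
have [hs ht] := slope_horizontal X.
have es : slope_s X ((-1) ^+ b *: horizontal R) = (-1) ^+ b * slope_s X (horizontal R).
  by rewrite /slope_s crossZl mulrA.
have et : slope_t X ((-1) ^+ b *: horizontal R) = (-1) ^+ b * slope_t X (horizontal R).
  by rewrite /slope_t crossZr mulrA.
case: b es et => /= [] es et /and4P[b1 b2 b3 b4].
- have := small_and (small_and (@small_pos0 _ (coord_s X p) (- slope_s X (horizontal R)) b1 _)
    (@small_pos _ (1 - coord_s X p) (slope_s X (horizontal R)) _))
   (small_and (@small_pos _ (coord_t X p) (- slope_t X (horizontal R)) b3)
    (@small_pos0 _ (1 - coord_t X p) (slope_t X (horizontal R)) _ ht)).
  rewrite oppr_gt0 subr_gt0 subr_ge0 => /(_ hs b2 b4); apply: small_imp => eps _ [[k1 k2] [k3 k4]].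
  by rewrite !coord_s_line !coord_t_line es et expr1 !mulN1r; split; apply/andP; split; lra.
- have := small_and (small_and (@small_pos _ (coord_s X p) (slope_s X (horizontal R)) b1)
    (@small_pos0 _ (1 - coord_s X p) (- slope_s X (horizontal R)) _ _))
   (small_and (@small_pos0 _ (coord_t X p) (slope_t X (horizontal R)) b3 ht)
    (@small_pos _ (1 - coord_t X p) (- slope_t X (horizontal R)) _)).
  rewrite oppr_gt0 subr_gt0 subr_ge0 => /(_ b2 hs b4); apply: small_imp => eps _ [[k1 k2] [k3 k4]].
  by rewrite !coord_s_line !coord_t_line es et expr0 !mul1r; split; apply/andP; split; lra.
Qed.

(** A small horizontal shift moves the point into the interior of both tiles. *)
Lemma beside_uniq b X Y p : X \in T -> Y \in T -> beside b X p -> beside b Y p -> X = Y.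
Proof.
move=> XT YT hX hY.
have [eps _ [[hs ht] [hs' ht']]] := small_ex (small_and (beside_interior hX) (beside_interior hY)).
apply: (interior_uniq XT YT hs ht); apply/(hull_tileP _ (tiling_proper YT)).
by split; apply/andP; split; apply: ltW; [case/andP: hs'|case/andP: hs'|case/andP: ht'|case/andP: ht'].
Qed.

Definition midpoint (d : edge n) : 'rV[R]_2 := v d.1 + 2^-1 *: e d.2.

Lemma coord_midpoint X (d : edge n) : proper_tile X ->
  [/\ d = (X.2, tile_s X) -> coord_s X (midpoint d) = 2^-1 /\ coord_t X (midpoint d) = 0,
      d = (tile_left X, tile_t X) -> coord_s X (midpoint d) = 1 /\ coord_t X (midpoint d) = 2^-1,
      d = (X.2, tile_t X) -> coord_s X (midpoint d) = 0 /\ coord_t X (midpoint d) = 2^-1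
    & d = (tile_right X, tile_s X) -> coord_s X (midpoint d) = 2^-1 /\ coord_t X (midpoint d) = 1].
Proof.
move=> pX; split=> ->; apply: coordE; rewrite /midpoint /= ?vertex_left ?vertex_right //;
 by move: (e (tile_s X)) (e (tile_t X)) (v X.2) => u w z; apply/rowP => k; rewrite !mxE; ring.
Qed.

Lemma side_edge_uniq b X Y (d : edge n) : X \in T -> Y \in T -> side_edge b X d -> side_edge b Y d -> X = Y.
Proof.
suff H Z : Z \in T -> side_edge b Z d -> beside b Z (midpoint d).
  by move=> XT YT hX hY; apply: (beside_uniq XT YT); apply: H; eassumption.
move=> /tiling_proper pZ; have [h1 h2 h3 h4] := coord_midpoint d pZ.
by rewrite /side_edge /beside; case: b => /orP[] /eqP ed;
 [have [-> ->] := h3 ed|have [-> ->] := h4 ed|have [-> ->] := h1 ed|have [-> ->] := h2 ed];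
 apply/and4P; split; lra.
Qed.

(** The left vertex of a tile has interior points of the tile immediately to its right, so
    [beside_uniq] applies to it as well. *)
Lemma tile_left_uniq X Y : X \in T -> Y \in T -> tile_left X = tile_left Y -> X = Y.
Proof.
suff H Z : Z \in T -> beside false Z (v (tile_left Z)).
  by move=> XT YT eXY; apply: (beside_uniq XT YT (H _ XT)); rewrite eXY; apply: H.
move=> /tiling_proper pZ; rewrite /beside; have [|-> ->] := @coordE R n Z 1 0 (v (tile_left Z)).
  by rewrite vertex_left // scale1r scale0r addr0 addrC.
by apply/and4P; split; lra.
Qed.

Lemma edge_vec_neq0 r : e r != 0.
Proof.
apply/negP => /eqP e0; have := cross_horizontal R r.
by rewrite e0 /cross !mxE !mul0r subrr ltxx.
Qed.

(** The sign of [cross (e r) (e q)] depends only on whether [q < r]. So among the vertices without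
    label [r], the one collecting all labels of the favourable sign is strictly extreme
    transversally to the edge. *)
Lemma border_max b r W : r \notin W -> W != border b r ->
  0 < (-1) ^+ (~~ b) * cross (e r) (v (border b r) - v W).
Proof.
move=> rW WB; rewrite crossDr crossNr /vertex_pt !cross_sumr.
pose c (q : 'I_n) := (-1) ^+ (~~ b) * cross (e r) (e q).
have cB (q : 'I_n) : q \in border b r -> 0 < c q.
  by rewrite inE /c; case: b {WB c} => /= h; rewrite ?mul1r ?expr1 ?mulN1r ?oppr_gt0 ?cross_lt ?cross_gt.
have cN (q : 'I_n) : q \notin border b r -> q != r -> c q < 0.
  rewrite inE /c -val_eqE /= => h h'; case: b {WB c cB} h => /= h.
    by rewrite mul1r cross_gt //; lia.
  by rewrite expr1 mulN1r oppr_lt0 cross_lt //; lia.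
rewrite mulrBr !mulr_sumr subr_gt0.
rewrite big_mkcond [X in _ < X]big_mkcond /=.
have [q0 q0P] : exists q, (q \in W) != (q \in border b r).
  apply/existsP; apply: contraNT WB; rewrite negb_exists => /forallP h.
  by apply/eqP/setP => q; move: (h q); rewrite negbK => /eqP.
have rB : r \notin border b r by rewrite inE; case: (b); rewrite ltnn.
have ne (q : 'I_n) : (q \in W) != (q \in border b r) -> q != r.
  by apply: contraNneq => ->; rewrite (negbTE rW) (negbTE rB).
have key q : (q \in W) != (q \in border b r) ->
    (if q \in W then c q else 0) < (if q \in border b r then c q else 0).
  move=> h; move: h (ne _ h) (cB q) (cN q).
  case: (q \in W); case: (q \in border b r) => //= _ h h1 h2; [exact: h2|exact: h1].
rewrite (bigD1 q0) //= [X in _ < X](bigD1 q0) //=.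
apply: ltr_leD; [exact: key|apply: ler_sum => q _].
by have [->|h] := eqVneq (q \in W) (q \in border b r); last exact/ltW/key.
Qed.

Lemma border_vert b r : border b r \in left_verts n :|: right_verts n.
Proof.
rewrite finset.in_setU; apply/orP; case: b; [left|right]; apply/imsetP.
  by exists (widen_ord (leqnSn n) r) => //; apply/setP => q; rewrite !inE.
by exists (lift ord0 r) => //; apply/setP => q; rewrite !inE /= /bump /= -ltnNge.
Qed.

Lemma side_of_edge X (d : edge n) p : X \in T -> hull (tile_verts X) p ->
  (left_edge X d -> cross (e d.2) (p - v d.1) <= 0) /\
  (right_edge X d -> 0 <= cross (e d.2) (p - v d.1)).
Proof.
move=> /tiling_proper pX /(hull_tileP _ pX)[]; have D0 := cross_tile R X.
have := coordK X p; move: (coord_s X p) (coord_t X p) => a b -> /andP[a0 a1] /andP[b0 b1].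
have H u f : u + v X.2 - (f + v X.2) = u - f :> 'rV[R]_2 by rewrite opprD addrACA subrr addr0.
have H0 u : u + v X.2 - v X.2 = u :> 'rV[R]_2 by rewrite addrK.
have K : v X.2 + a *: e (tile_s X) + b *: e (tile_t X) = a *: e (tile_s X) + b *: e (tile_t X) + v X.2.
  by rewrite -addrA addrC.
have D1 := crossC (e (tile_s X)) (e (tile_t X)).
by split=> /orP[] /eqP -> /=; rewrite ?vertex_left ?vertex_right // K ?H ?H0
  ?crossDr ?crossNr ?crossZr ?crossvv ?D1 ?mulr0 ?add0r ?addr0 ?oppr0; nra.
Qed.

Lemma hull_edge_midpoint X (d : edge n) : X \in T -> d \in tile_edges X -> hull (tile_verts X) (midpoint d).
Proof.
move=> /tiling_proper pX; rewrite tile_edgesE; have [h1 h2 h3 h4] := coord_midpoint d pX.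
move=> /orP[] /orP[] /eqP ed; apply/(hull_tileP _ pX);
 [have [-> ->] := h1 ed|have [-> ->] := h2 ed|have [-> ->] := h3 ed|have [-> ->] := h4 ed];
 by split; apply/andP; split; lra.
Qed.

Lemma edge_notin X (d : edge n) : X \in T -> d \in tile_edges X -> d.2 \notin d.1.
Proof.
move=> /tiling_proper /andP[hs ht]; have st := s_neq_t X.
rewrite tile_edgesE => /orP[] /orP[] /eqP -> //=.
  by rewrite in_setU1 negb_or eq_sym st.
by rewrite in_setU1 negb_or st.
Qed.

(** From the midpoint, move slightly towards the extreme vertex, strictly across the line of the
    edge. A tile covering the new point contains the midpoint by closedness; if it is not [X], it
    shares with [X] both ends of the edge. The position of the new point decides the side. *)
Lemma other_side b X (d : edge n) : X \in T -> d \in tile_edges X -> d.1 != border b d.2 ->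
  exists2 Y, Y \in T & side_edge b Y d.
Proof.
move=> XT dX dB; have dN := edge_notin XT dX; have pX := tiling_proper XT.
have hX := hull_edge_midpoint XT dX; have [_ cover cap] := tilT.
pose w := v (border b d.2); pose mu := midpoint d.
have hmu : hull (left_verts n :|: right_verts n) mu by apply/cover; exists X.
have [eps0 e0 near] := tile_hull_closed mu (w - mu).
pose eps := Num.min (eps0 / 2) 1.
have ep : 0 < eps by rewrite lt_min ltr01 divr_gt0.
have e1 : eps <= 1 by rewrite ge_min lexx orbT.
have ee : eps < eps0 by rewrite gt_min ltr_pdivrMr // ltr_pMr // ltr1n.
have /cover[Y YT hYp] : hull (left_verts n :|: right_verts n) (mu + eps *: (w - mu)).
  by apply: hull_convex; rewrite ?(ltW ep) //; apply/hull_vertex/border_vert.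
have hY : hull (tile_verts Y) mu by apply: (near eps); rewrite ?ep ?mem_enum.
exists Y => //.
have dY : d \in tile_edges Y.
  have [<- //|XY] := eqVneq X Y.
  have [c [c0 cA c1 es et]] := hull_tile pX (finset.subsetIl _ _) (cap _ _ XT YT XY _ hX hY).
  have mem W : 0 < c W -> W \in tile_verts Y.
    by apply: contraTT => h; rewrite cA ?ltxx // finset.in_setI negb_and h orbT.
  move: (c0 X.2) (c0 (tile_left X)) (c0 (tile_right X)) (c0 (tile_top X)) => p1 p2 p3 p4.
  have topE : tile_t X |: tile_left X = tile_top X by rewrite /tile_left finset.setUCA.
  have [h1 h2 h3 h4] := coord_midpoint d pX; move: dX; rewrite tile_edgesE.
  move=> /orP[] /orP[] /eqP ed;
    [case: (h1 ed)|case: (h2 ed)|case: (h3 ed)|case: (h4 ed)] => k1 k2;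
    rewrite k1 in es; rewrite k2 in et; rewrite ed /= in dN *;
    apply: edge_of_verts (tiling_proper YT) dN _ _; apply: mem;
    rewrite ?topE -?/(tile_left X) -?/(tile_right X) -?/(tile_top X);
    by move: p1 p2 p3 p4 c1 es et; clear; lra.
have key := border_max dN dB.
have := side_of_edge d YT hYp.
have -> : cross (e d.2) (mu + eps *: (w - mu) - v d.1) = eps * cross (e d.2) (v (border b d.2) - v d.1).
  rewrite /mu /w /midpoint !(crossDr, crossNr, crossZr) crossvv; ring.
move: dY key; rewrite tile_edgesE; case: (b) => /=; rewrite ?mul1r ?expr1 ?mulN1r ?oppr_gt0 => /orP[] //.
  by move=> dL h [/(_ dL)]; rewrite leNgt mulr_gt0.
by move=> dR h [_ /(_ dR)]; rewrite leNgt pmulr_rlt0 // h.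
Qed.

(** No vertex lies beyond the line of a left boundary edge. A tile covering the midpoint therefore
    writes it as a combination of the two ends of the edge alone, and needs both since the midpoint
    is neither. *)
Lemma left_border r : exists2 X, X \in T & left_edge X (border true r, r).
Proof.
have [_ cover cap] := tilT; pose B := border true r; pose mu := midpoint (B, r).
have rB : r \notin B by rewrite inE ltnn.
have BV : B \in left_verts n :|: right_verts n by apply: border_vert.
have BV' : r |: B \in left_verts n :|: right_verts n.
  rewrite finset.in_setU; apply/orP; left; apply/imsetP; exists (lift ord0 r) => //.
  by apply/setP => q; rewrite !inE -val_eqE /= /bump; lia.
have /cover[X XT hX] : hull (left_verts n :|: right_verts n) mu.
  have -> : mu = v B + 2^-1 *: (v (r |: B) - v B) by rewrite vertexU1 // addrK.
  by apply: hull_convex; [apply/andP; split; lra|exact: hull_vertex|exact: hull_vertex].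
have pX := tiling_proper XT; exists X => //.
have dX : (B, r) \in tile_edges X.
  have [c [c0 c1 emu]] := hX.
  have c00 : cross (e r) 0 = 0 by rewrite /cross !mxE !mulr0 subrr.
  have bmax W : r \notin W -> W != B -> 0 < cross (e r) (v B - v W).
    by move=> h1 h2; have := @border_max true r W h1 h2; rewrite expr0 mul1r.
  have ge W : 0 <= c W * (cross (e r) (v B - v W)).
    rewrite mulr_ge0 //; have [rW|rW] := boolP (r \in W); last first.
      have [->|WB] := eqVneq W B; first by rewrite subrr c00.
      exact/ltW/bmax.
    have rW' : r \notin W :\ r by rewrite finset.setD11.
    rewrite -(finset.setD1K rW) vertexU1 // opprD addrCA crossDr crossNr crossvv oppr0 add0r.
    have [->|WB] := eqVneq (W :\ r) B; first by rewrite subrr c00.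
    exact/ltW/bmax.
  have z : \sum_(W in tile_verts X) c W * cross (e r) (v B - v W) = 0.
    transitivity (cross (e r) (v B - mu)); last first.
      by rewrite /mu /midpoint opprD addNKr crossNr crossZr crossvv mulr0 oppr0.
    have e1 : v B = \sum_(W in tile_verts X) c W *: v B by rewrite -scaler_suml c1 scale1r.
    rewrite [in RHS]e1 emu -sumrB cross_sumr; apply: eq_bigr => W _.
    by rewrite -scalerBr crossZr.
  have zero W : W \in tile_verts X -> W != B -> W != r |: B -> c W = 0.
    move=> WX WB WB'; have := psumr_eq0P (fun W _ => ge W) z WX => /eqP.
    rewrite mulf_eq0 => /orP[/eqP//|]; suff: 0 < cross (e r) (v B - v W) by move/gt_eqF->.
    have [rW|rW] := boolP (r \in W); last exact: bmax.
    have rW' : r \notin W :\ r by rewrite finset.setD11.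
    rewrite -(finset.setD1K rW) vertexU1 // opprD addrCA crossDr crossNr crossvv oppr0 add0r.
    apply: bmax => //; by apply: contraNneq WB' => <-; rewrite finset.setD1K.
  have one U U' : (U == B) && (U' == r |: B) || (U == r |: B) && (U' == B) ->
      U \notin tile_verts X -> mu = v U'.
    move=> UU' UX; have z' W : W \in tile_verts X -> W != U' -> c W = 0.
      move=> WX WU; have WU0 : W != U by apply: contraTneq WX => ->.
      by apply: zero => //; case/orP: UU' WU WU0 => /andP[/eqP-> /eqP->].
    have U'X : U' \in tile_verts X.
      apply: contraT => h; move: c1; rewrite big1; first by move/eqP; rewrite eq_sym oner_eq0.
      by move=> W WX; apply: z' => //; apply: contraNneq h => <-.
    have cU' : c U' = 1.
      by rewrite -c1 (bigD1 U') //= big1 ?addr0 // => W /andP[WX WU]; apply: z'.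
    rewrite emu (bigD1 U') //= big1 ?addr0 ?cU' ?scale1r // => W /andP[WX WU].
    by rewrite (z' W) // scale0r.
  have en0 := edge_vec_neq0 r.
  apply: edge_of_verts => //; apply: contraT => h.
    have e0 : e r = 2^-1 *: e r.
      by apply: (addrI (v B)); rewrite addrC -vertexU1 // -(one B (r |: B)) // !eqxx.
    have : (1 - 2^-1) *: e r == 0 by rewrite scalerBl scale1r -e0 subrr.
    by rewrite scaler_eq0 (negbTE en0) orbF => /eqP; lra.
  have := @one (r |: B) B; rewrite !eqxx orbT => /(_ isT h) /eqP.
  by rewrite /mu /midpoint -subr_eq0 addrC addKr scaler_eq0 (negbTE en0) orbF invr_eq0 pnatr_eq0.
move: dX; rewrite tile_edgesE => /orP[//|h].
by have := side_edge_border true r pX; rewrite /side_edge h.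
Qed.

End Adjacency.

(** * Sweeping a tiling *)

Section Fronts.
Variable n : nat.
Implicit Types (w : 'S_n) (i j : seq 'I_n.-1) (p : 'I_n.-1) (X Y Z : tile n) (d : edge n).

Definition front w : {set edge n} := [set (chain w k, w k) | k : 'I_n].

Definition at_step w p X := val X.1 = (w (lo p), w (hi p)) /\ X.2 = chain w p.

Lemma front_next w p X d : at_step w p X -> d \in front w ->
  d \in front (step w p) \/ left_edge X d.
Proof.
move=> [e1 e2] /imsetP[k _ ->]; rewrite /left_edge /tile_left /tile_s /tile_t e1 e2 /=.
have [->|kp] := eqVneq k (lo p); first by right; rewrite eqxx.
have [->|kp'] := eqVneq k (hi p); first by right; rewrite /= chainS_lo eqxx orbT.
left; apply/imsetP; exists k => //; rewrite chain_step //.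
by rewrite step_out.
Qed.

Lemma front_prev w p X d : at_step w p X -> d \in front (step w p) ->
  d \in front w \/ right_edge X d.
Proof.
move=> [e1 e2] /imsetP[k _ ->]; rewrite /right_edge /tile_right /tile_s /tile_t e1 e2 /=.
have [->|kp] := eqVneq k (lo p).
  by right; rewrite step_lo chain_step ?eqxx //= neq_ltn ltnSn.
have [->|kp'] := eqVneq k (hi p).
  by right; rewrite step_hi /= chain_step_eq eqxx orbT.
by left; apply/imsetP; exists k => //; rewrite chain_step // step_out.
Qed.

Lemma front_right w p X d : at_step w p X -> right_edge X d -> d \in front (step w p).
Proof.
move=> [e1 e2]; rewrite /right_edge /tile_right /tile_s /tile_t e1 e2 /= => /orP[] /eqP ->; apply/imsetP.
  by exists (lo p); rewrite // step_lo chain_step //= neq_ltn ltnSn.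
by exists (hi p); rewrite // step_hi /= chain_step_eq.
Qed.

Lemma front_left w p X d : at_step w p X -> left_edge X d -> d \in front w.
Proof.
move=> [e1 e2]; rewrite /left_edge /tile_left /tile_s /tile_t e1 e2 /= => /orP[] /eqP ->; apply/imsetP.
  by exists (lo p).
by exists (hi p); rewrite //= chainS_lo.
Qed.

Lemma mem_tiling_rcons j p X :
  X \in word_tiling (rcons j p) <-> X \in word_tiling j \/ at_step (run 1%g j) p X.
Proof.
rewrite !mem_word_tiling -cats1 walk_cat mem_cat /= inE /at_step; split.
  by case/orP => [h|/eqP[e1 e2]]; [left|right].
by case=> [->//|[-> ->]]; rewrite eqxx orbT.
Qed.

Lemma legal_rcons j p : legal 1%g (rcons j p) = legal 1%g j && ascent (run 1%g j) p.
Proof. by rewrite -cats1 legal_cat /= andbT. Qed.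

Lemma run_rcons j p : run 1%g (rcons j p) = step (run 1%g j) p.
Proof. by rewrite -cats1 run_cat. Qed.

Definition on_left d := d.1 == border true d.2.

Lemma front1 d : (d \in front 1%g) = on_left d.
Proof.
apply/imsetP/eqP => [[k _ ->]|].
  by rewrite chain1 perm1; apply/setP => q; rewrite !inE.
case: d => S r /= ->; exists r => //; rewrite chain1 perm1; congr (_, _).
Qed.

Lemma on_leftE d : (d \in left_edges n) = on_left d.
Proof.
apply/imsetP/eqP => [[k _ ->]//|].
by case: d => S r /= ->; exists r.
Qed.

Definition at_right (U : {set tile n}) d := [exists (Y | Y \in U), right_edge Y d].
Definition at_left (U : {set tile n}) d := [exists (Y | Y \in U), left_edge Y d].

Lemma at_rightP (U : {set tile n}) d : reflect (exists2 Y, Y \in U & right_edge Y d) (at_right U d).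
Proof. exact: exists_inP. Qed.
Lemma at_leftP (U : {set tile n}) d : reflect (exists2 Y, Y \in U & left_edge Y d) (at_left U d).
Proof. exact: exists_inP. Qed.

Lemma word_tiling_nil : word_tiling [::] = finset.set0 :> {set tile n}.
Proof. by apply/setP => X; rewrite mem_word_tiling inE. Qed.

Lemma at_stepP j p : legal 1%g (rcons j p) -> exists2 X, X \in word_tiling (rcons j p) & at_step (run 1%g j) p X.
Proof.
rewrite legal_rcons => /andP[L asc].
pose X : tile n := (exist _ (run 1%g j (lo p), run 1%g j (hi p)) asc, chain (run 1%g j) p).
by exists X => //; apply/mem_tiling_rcons; right.
Qed.

Lemma front_origin j d : legal 1%g j -> d \in front (run 1%g j) ->
  on_left d || at_right (word_tiling j) d.
Proof.
elim/last_ind: j => [|j p IH] L; first by rewrite front1 => ->.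
have [X XT aX] := at_stepP L; move: L; rewrite run_rcons legal_rcons => /andP[L asc].
case/(front_prev aX) => [/(IH L)/orP[->//|/at_rightP[Y YT dY]]|dX].
  by apply/orP; right; apply/at_rightP; exists Y => //; apply/mem_tiling_rcons; left.
by apply/orP; right; apply/at_rightP; exists X.
Qed.

(** An edge that was once available leaves the front only when the tile to its right is swept. *)
Lemma front_reached j d : legal 1%g j -> on_left d || at_right (word_tiling j) d ->
  d \in front (run 1%g j) \/ at_left (word_tiling j) d.
Proof.
elim/last_ind: j => [|j p IH] L.
  rewrite front1 => /orP[|/at_rightP[X]]; first by left.
  by rewrite word_tiling_nil inE.
have [X XT aX] := at_stepP L; move: L; rewrite run_rcons legal_rcons => /andP[L asc] h.
have mono : at_left (word_tiling j) d -> at_left (word_tiling (rcons j p)) d.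
  by move/at_leftP => [Y YT dY]; apply/at_leftP; exists Y => //; apply/mem_tiling_rcons; left.
have [h0|h0] := boolP (on_left d || at_right (word_tiling j) d).
  have [/(front_next aX)[|dX]|/mono] := IH L h0; [by left|right|by right].
  by apply/at_leftP; exists X.
left; move: h h0; case: (on_left d) => //= /at_rightP[Y /mem_tiling_rcons[YT dY|[e1 e2] dY]].
  by move/negP; case; apply/at_rightP; exists Y.
by move=> _; apply: (front_right _ dY).
Qed.

Lemma left_right_edge X d : proper_tile X -> left_edge X d -> ~~ right_edge X d.
Proof.
move=> pX; have [c1 c2 c3] := cards_tile pX; have st := s_neq_t X.
move=> /orP[] /eqP ->; apply/negP => /orP[] /eqP [].
- by move/eqP; rewrite (negbTE st).
- by move=> e; move: c2; rewrite -e; lia.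
- by move=> e; move: c1; rewrite e; lia.
- by move=> _ /eqP; rewrite eq_sym (negbTE st).
Qed.

End Fronts.

Section Sweep.
Variables (R : realType) (n : nat) (T : {set tile n}).
Hypothesis tilT : is_tiling R T.
Implicit Types (w : 'S_n) (i j : seq 'I_n.-1) (p : 'I_n.-1) (X Y Z : tile n) (d : edge n).

Let proper X : X \in T -> proper_tile X.
Proof. exact: tiling_proper tilT X. Qed.

Lemma right_not_on_left X d : X \in T -> right_edge X d -> ~~ on_left d.
Proof.
move=> /proper pX dX; apply: contraL dX => /eqP e.
by have := side_edge_border true d.2 pX; rewrite -e -surjective_pairing.
Qed.

Lemma left_not_on_right X d : X \in T -> left_edge X d -> d.1 != border false d.2.
Proof.
move=> /proper pX dX; apply: contraL dX => /eqP e.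
by have := side_edge_border false d.2 pX; rewrite -e -surjective_pairing.
Qed.

Lemma left_uniq X Y d : X \in T -> Y \in T -> left_edge X d -> left_edge Y d -> X = Y.
Proof. by move=> XT YT dX dY; apply: (@side_edge_uniq _ _ _ tilT false X Y d). Qed.
Lemma right_uniq X Y d : X \in T -> Y \in T -> right_edge X d -> right_edge Y d -> X = Y.
Proof. by move=> XT YT dX dY; apply: (@side_edge_uniq _ _ _ tilT true X Y d). Qed.

Lemma front_edge j d : legal 1%g j -> word_tiling j \subset T -> d \in front (run 1%g j) ->
  exists2 X, X \in T & d \in tile_edges X.
Proof.
move=> L /fintype.subsetP sub /(front_origin L)/orP[/eqP e|/at_rightP[Y YT dY]].
  have [X XT dX] := left_border tilT d.2; exists X => //.
  by rewrite tile_edgesE; move: dX; rewrite -e -surjective_pairing => ->.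
by exists Y; [exact: sub|rewrite tile_edgesE dY orbT].
Qed.

(** Suppose no tile can be flipped. If the tile to the right of a path edge has it as its lower left
    edge, the same holds for the next path edge, since tiles with a common left vertex coincide; at
    the top this is impossible. So no path edge is of this kind. The first one cannot be an upper
    left edge either, hence lies on the right boundary, and this propagates upwards to give [w0]. *)
Lemma flippable j : legal 1%g j -> word_tiling j \subset T -> run 1%g j != w0 n ->
  exists2 X, X \in T & exists p, at_step (run 1%g j) p X.
Proof.
move=> L sub nw0; set w := run 1%g j.
case: (pselect (exists2 X, X \in T & exists p, at_step w p X)) => // no; exfalso.
pose lower (k : 'I_n) := exists2 Y, Y \in T & (chain w k, w k) = (Y.2, tile_s Y).
pose upper (k : 'I_n) := exists2 Y, Y \in T & (chain w k, w k) = (tile_left Y, tile_t Y).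
pose last_edge (k : 'I_n) := chain w k = border false (w k).
have trich (k : 'I_n) : [\/ lower k, upper k | last_edge k].
  have [|X XT dX] := @front_edge j (chain w k, w k) L sub; first by apply/imsetP; exists k.
  have [e|ne] := eqVneq (chain w k) (border false (w k)); first by constructor 3.
  have [Y YT /orP[]/eqP eY] := other_side tilT XT dX ne; first by constructor 1; exists Y.
  by constructor 2; exists Y.
have low p : lower (lo p) -> lower (hi p).
  move=> [Y YT [e1 e2]]; have eL : chain w p.+1 = tile_left Y by rewrite chainS_lo e2 e1.
  have := proper YT => /andP[hs ht]; have st := tile_s_lt_t Y.
  have [//|[Z ZT [e3 e4]]|e] := trich (hi p); exfalso.
    have YZ : Y = Z by apply: (tile_left_uniq tilT) => //; rewrite -eL -e3.
    case: no; exists Y => //; exists p; split=> //.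
    by rewrite [LHS]surjective_pairing e2 e4 -YZ.
  move: e; rewrite /last_edge /= eL => e; have : tile_s Y \in tile_left Y by rewrite setU11.
  have : tile_t Y \notin tile_left Y by rewrite in_setU1 negb_or eq_sym s_neq_t.
  by rewrite e !inE; lia.
have step_up (P : 'I_n -> Prop) k : (forall p, P (lo p) -> P (hi p)) -> P k ->
    forall l : 'I_n, (k <= l)%N -> P l.
  move=> Pp Pk l kl; have [m em] : exists m, l = (k + m)%N :> nat by exists (l - k)%N; lia.
  elim: m l {kl} em => [|m IH] l em; first by have -> : l = k by apply: val_inj; rewrite /= em addn0.
  have mn : (k + m < n.-1)%N by have := ltn_ord l; lia.
  have -> : l = hi (Ordinal mn) by apply: val_inj; rewrite /= em addnS.
  by apply: Pp; apply: IH.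
have no_lower k : ~ lower k.
  move=> lk; have n1 : (n.-1 < n)%N by have := ltn_ord k; lia.
  have [|Y YT [e1 e2]] := step_up _ _ low lk (Ordinal n1); first by have := ltn_ord k; rewrite /=; lia.
  have := proper YT => /andP[hs ht].
  have : tile_t Y \notin tile_left Y by rewrite in_setU1 negb_or eq_sym s_neq_t.
  rewrite /tile_left -e1 -e2 /= => /negP; apply; rewrite -(chainS w (Ordinal n1)) inE /=.
  by apply: leq_trans (ltn_ord _) _; lia.
have all_last p : last_edge (lo p) -> last_edge (hi p).
  move=> e; have [/no_lower//|[Z ZT [e3 e4]]|//] := trich (hi p); exfalso.
  have /andP[hs ht] := proper ZT; have st := tile_s_lt_t Z.
  have : tile_s Z \in tile_left Z by rewrite setU11.
  have : tile_t Z \notin tile_left Z by rewrite in_setU1 negb_or eq_sym s_neq_t.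
  rewrite -e3 /= chainS_lo; move: e; rewrite /last_edge /= => ->; rewrite !inE -!val_eqE /=; lia.
case/negP: nw0; apply/eqP/permP => k; rewrite -/w /w0 permE.
have n0 : (0 < n)%N by have := ltn_ord k; lia.
have first : last_edge (Ordinal n0).
  have [/no_lower//|[Z ZT [e3 e4]]|//] := trich (Ordinal n0); exfalso.
  have : tile_s Z \in tile_left Z by rewrite setU11.
  by rewrite -e3 inE.
have ek := step_up _ _ all_last first k isT.
apply: val_inj; rewrite /=; have := card_chain w (ltnW (ltn_ord k)); rewrite ek.
have -> : border false (w k) = ~: initial n (w k).+1.
  by apply/setP => q; rewrite !inE -leqNgt.
rewrite cardsCs finset.setCK card_ord -chain1 card_chain ?ltn_ord //.
by have := ltn_ord (w k); have := ltn_ord k; lia.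
Qed.

(** For an edge, the number of labels lying on the wrong side of [d.2] compared with the left
    boundary: its distance to that boundary along the strip of parallel edges. *)
Definition strip_depth d := 
  #|([set q : 'I_n | if q \in d.1 then (d.2 < q)%N else (q < d.2)%N] : {set 'I_n})|.

Lemma strip_left X d : X \in T -> right_edge X d ->
  exists2 d', left_edge X d' & (strip_depth d' < strip_depth d)%N.
Proof.
move=> /proper/andP[hs ht]; have st := tile_s_lt_t X.
rewrite /right_edge => /orP[]/eqP ->; rewrite /strip_depth /=.
  exists (tile_left X, tile_t X); first by rewrite /left_edge eqxx orbT.
  set A' := [set q | _] : {set 'I_n}; set A := [set q | _] : {set 'I_n}.
  have -> : A = tile_s X |: A'.
    apply/setP => q; rewrite !inE /=; case: eqP => [->|_] //=.
    by rewrite (negbTE hs).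
  by rewrite cardsU1 inE /= in_setU1 eqxx /= -leqNgt (ltnW st).
exists (X.2, tile_s X); first by rewrite /left_edge eqxx.
set A' := [set q | _] : {set 'I_n}; set A := [set q | _] : {set 'I_n}.
have -> : A = tile_t X |: A'.
  by apply/setP => q; rewrite !inE /=; case: eqP => [->|_] //=.
by rewrite cardsU1 inE /= (negbTE ht) -leqNgt (ltnW st).
Qed.

(** Induction on the strip depth of a left edge of [X]: the tile to the left of this edge is already
    in the word, so the edge was reached by the front. It is not on the final front, the right
    boundary, so a tile of the word with this left edge was swept, and that tile is [X]. *)
Lemma full_word j : legal 1%g j -> word_tiling j \subset T -> run 1%g j = w0 n -> T = word_tiling j.
Proof.
move=> L sub full; apply/eqP; rewrite finset.eqEsubset sub andbT; apply/fintype.subsetP => X XT.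
have [m] := ubnP (strip_depth (X.2, tile_s X)).
have : left_edge X (X.2, tile_s X) by rewrite /left_edge eqxx.
move: (X.2, tile_s X) => d; elim: m X XT d => // m IH X XT d dX lt.
have : on_left d || at_right (word_tiling j) d.
  have [//|nl] /= := boolP (on_left d).
  have [|Y YT dY] := @other_side _ _ _ tilT true X d XT _ nl; first by rewrite tile_edgesE dX.
  apply/at_rightP; exists Y => //; have [d' dY' lt'] := strip_left YT dY.
  by apply: (IH Y YT d') => //; apply: leq_trans lt' _; rewrite -ltnS.
move/(front_reached L) => [/imsetP[k _ ed]|/at_leftP[Z ZT dZ]]; last first.
  by rewrite (left_uniq XT (fintype.subsetP sub _ ZT) dX dZ).
case/negP: (left_not_on_right XT dX); rewrite ed /= full; apply/eqP.
rewrite chain_w0 ?(ltnW (ltn_ord _)) //; apply/setP => q; rewrite !inE /w0 permE /=.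
by have := ltn_ord k; have := ltn_ord q; lia.
Qed.

(** Flips are appended until the right boundary is reached; the swept rhombi have distinct label
    pairs, which bounds the number of flips. *)
Lemma tiling_word : exists2 j, legal 1%g j /\ run 1%g j = w0 n & T = word_tiling j.
Proof.
suff H m j : legal 1%g j -> word_tiling j \subset T -> (#|{: 'I_n * 'I_n}| - size j < m)%N ->
    exists2 j', legal 1%g j' /\ run 1%g j' = w0 n & T = word_tiling j'.
  by apply: (H _ [::] isT _ (ltnSn _)); rewrite word_tiling_nil finset.sub0set.
elim: m j => // m IH j L sub lt.
have [full|nfull] := eqVneq (run 1%g j) (w0 n); first by exists j => //; apply: full_word.
have [X XT [p [e1 e2]]] := flippable L sub nfull.
have L' : legal 1%g (rcons j p).
  by rewrite legal_rcons L; have := valP X.1; rewrite e1.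
apply: (IH (rcons j p)) => //.
  apply/fintype.subsetP => Y /mem_tiling_rcons[/(fintype.subsetP sub)//|[e3 e4]].
  suff -> : Y = X by [].
  by rewrite [Y]surjective_pairing [X]surjective_pairing e2 e4; congr (_, _); apply: val_inj; rewrite e1 e3.
have sz : size (map fst (walk 1%g (rcons j p))) = (size j).+1.
  by rewrite walk1_roots; elim: (j) => //= ? ? <-; rewrite size_map.
have : (size j < #|{: 'I_n * 'I_n}|)%N by rewrite -sz -(card_uniqP (uniq_walk_roots L')) max_card.
by rewrite size_rcons; lia.
Qed.

End Sweep.

(** * The layers and the order on tiles *)

Section Layers.
Variables (R : realType) (n : nat) (T : {set tile n}).
Hypothesis tilT : is_tiling R T.
Implicit Types (i j : seq 'I_n.-1) (p : 'I_n.-1) (X Y Z : tile n) (d : edge n).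

Definition swept (U : {set tile n}) (B : {set edge n}) := [/\ U \subset T,
  forall Z d, Z \in U -> left_edge Z d -> on_left d || at_right U d
  & forall d, (d \in B) = (on_left d || at_right U d) && ~~ at_left U d].

Lemma swept_right U B X d : swept U B -> X \in T -> X \notin U -> right_edge X d ->
  ~~ (on_left d || at_right U d).
Proof.
move=> [/fintype.subsetP UT _ _] XT XU dX; rewrite negb_or (right_not_on_left tilT XT dX) /=.
apply/at_rightP => -[Y YU dY]; case/negP: XU.
by rewrite (right_uniq tilT XT (UT _ YU) dX dY).
Qed.

(** A right edge of an unswept tile is never on the current boundary. Hence two edges on the
    boundary means that both left edges are available. *)
Lemma next_layerP U B X : swept U B ->
  reflect [/\ X \in T, X \notin U & forall d, left_edge X d -> on_left d || at_right U d]
    (X \in next_layer T U B).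
Proof.
move=> sw; have [/fintype.subsetP UT clo eB] := sw.
rewrite inE finset.in_setD; have [XU|XU] /= := boolP (X \in U); first by constructor; case.
have [XT|XT] /= := boolP (X \in T); last by constructor; case.
pose d1 : edge n := (X.2, tile_s X); pose d2 : edge n := (tile_left X, tile_t X).
have d12 : d1 != d2 by apply/negP => /eqP [_ /eqP]; rewrite (negbTE (s_neq_t X)).
pose D : {set edge n} := [set d1; d2].
have memD d : (d \in D) = left_edge X d by rewrite finset.in_set2.
have eI : tile_edges X :&: B = D :&: B.
  apply/setP => d; rewrite !finset.in_setI tile_edgesE memD andb_orl.
  have [dX|] := boolP (right_edge X d); rewrite ?orbF //= eB.
  by rewrite (negbTE (swept_right sw XT XU dX)) andbF.
have eL d : left_edge X d -> (d \in B) = on_left d || at_right U d.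
  move=> dX; rewrite eB andbC; case: (boolP (at_left U d)) => //= /at_leftP[Z ZU dZ].
  by case/negP: XU; rewrite (left_uniq tilT XT (UT _ ZU) dX dZ).
rewrite eI (_ : 2 = #|D|); last by rewrite cards2 d12.
rewrite (subset_leqif_cards (finset.subsetIl D B)).2.
apply: (iffP eqP) => [e|[_ _ h]].
  split=> // d dX; rewrite -eL //; have : d \in D by rewrite memD.
  by rewrite -e finset.in_setI => /andP[].
apply/setP => d; rewrite finset.in_setI memD andbC.
by case: (boolP (left_edge X d)) => [dX|]; rewrite ?andbF // eL ?h.
Qed.

Lemma sweepP k : swept (sweep T k).1 (sweep T k).2.
Proof.
elim: k => [|k IH] /=.
  split; [exact: finset.sub0set|by move=> Z d; rewrite inE|move=> d; rewrite on_leftE].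
  have -> : at_right finset.set0 d = false by apply/at_rightP => -[Y]; rewrite inE.
  by have -> : at_left finset.set0 d = false by [apply/at_leftP => -[Y]; rewrite inE]; rewrite orbF andbT.
case: (sweep T k) IH => U B /= sw; have [UT clo eB] := sw.
set L := next_layer T U B; set E := \bigcup_(X in L) _.
have LP X : X \in L -> [/\ X \in T, X \notin U & forall d, left_edge X d -> on_left d || at_right U d].
  by move/(next_layerP _ sw).
have rU d : at_right (U :|: L) d = at_right U d || at_right L d.
  apply/at_rightP/orP => [[Y]|].
    by rewrite finset.in_setU => /orP[h|h] dY; [left|right]; apply/at_rightP; exists Y.
  by case=> /at_rightP[Y YU dY]; exists Y; rewrite // finset.in_setU YU ?orbT.
have lU d : at_left (U :|: L) d = at_left U d || at_left L d.
  apply/at_leftP/orP => [[Y]|].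
    by rewrite finset.in_setU => /orP[h|h] dY; [left|right]; apply/at_leftP; exists Y.
  by case=> /at_leftP[Y YU dY]; exists Y; rewrite // finset.in_setU YU ?orbT.
have EE d : (d \in E) = at_left L d || at_right L d.
  apply/bigcupP/orP => [[X XL]|].
    by rewrite tile_edgesE => /orP[h|h]; [left; apply/at_leftP|right; apply/at_rightP]; exists X.
  by case=> [/at_leftP|/at_rightP] [X XL dX]; exists X; rewrite // tile_edgesE dX ?orbT.
split.
- by rewrite finset.subUset UT; apply/fintype.subsetP => X /LP[].
- move=> Z d; rewrite finset.in_setU rU orbA => /orP[/clo h /h ->//|/LP[_ _ h] /h ->//].
move=> d; rewrite finset.in_setU !finset.in_setD EE rU lU eB negb_or orbA.
have h1 : at_left L d -> on_left d || at_right U d.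
  by move/at_leftP => [X /LP[_ _ h] /h].
have h2 : at_left L d -> ~~ at_left U d.
  move/at_leftP => [X /LP[XT XU _] dX]; apply/at_leftP => -[Z ZU dZ].
  by case/negP: XU; rewrite (left_uniq tilT XT (fintype.subsetP UT _ ZU) dX dZ).
have h3 : at_right L d -> ~~ (on_left d || at_right U d).
  by move/at_rightP => [X /LP[XT XU _] dX]; apply: (swept_right sw XT XU dX).
have h4 : at_left U d -> on_left d || at_right U d by move/at_leftP => [Z]; apply: clo.
move: h1 h2 h3 h4; case: (on_left d || at_right U d); case: (at_left L d);
  case: (at_right L d); case: (at_left U d) => //=;
  by [move=> ? ? /(_ isT)|move=> /(_ isT)|move=> ? /(_ isT)|move=> ? ? ? /(_ isT)].
Qed.

Lemma sweepS k : (sweep T k.+1).1 = (sweep T k).1 :|: layer T k.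
Proof. by rewrite /layer /=; case: (sweep T k). Qed.

Lemma mem_sweep k X : X \in (sweep T k).1 -> exists2 l, (l < k)%N & X \in layer T l.
Proof.
elim: k => [|k IH]; first by rewrite inE.
by rewrite sweepS finset.in_setU => /orP[/IH[l lk Xl]|]; [exists l => //; apply: ltnW|exists k].
Qed.

(** The left edges of the next rhombus are available once the earlier ones are swept, so each layer
    advances by at least one letter. *)
Lemma word_swept j1 j2 : legal 1%g (j1 ++ j2) -> T = word_tiling (j1 ++ j2) ->
  word_tiling j1 \subset (sweep T (size j1)).1.
Proof.
elim/last_ind: j1 j2 => [|j1 p IH] j2 L eT; first by rewrite word_tiling_nil finset.sub0set.
rewrite cat_rcons in L eT; have /fintype.subsetP sub := IH _ L eT.
have L1 : legal 1%g j1 by move: L; rewrite legal_cat => /andP[].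
apply/fintype.subsetP => X XX; rewrite size_rcons sweepS finset.in_setU.
have [//|XU] /= := boolP (X \in (sweep T (size j1)).1).
apply/(next_layerP _ (sweepP _)); split=> //.
  by rewrite eT -cat_rcons mem_word_tiling walk_cat mem_cat -mem_word_tiling XX.
move=> d dX; case/mem_tiling_rcons: XX => [/sub h|aX]; first by rewrite h in XU.
have := front_origin L1 (front_left aX dX); case: (on_left d) => //= /at_rightP[Y YT dY].
by apply/at_rightP; exists Y => //; apply: sub.
Qed.

(** The edge is available when [X] enters its layer, and only [Y] can have made it so; hence [Y]
    lies in a strictly earlier layer. *)
Lemma tile_step_edge X Y d : X \in T -> Y \in T -> right_edge Y d -> left_edge X d -> tile_step T Y X.
Proof.
move=> XT YT dY dX; have [j [L full] eT] := tiling_word tilT.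
have all_swept : T \subset (sweep T (size j)).1.
  by have := @word_swept j [::]; rewrite cats0 => /(_ L eT); rewrite -eT.
have [l lk Xl] := mem_sweep (fintype.subsetP all_swept X XT).
have /(next_layerP _ (sweepP _))[_ _ h] := Xl.
have := h _ dX; rewrite (negbTE (right_not_on_left tilT YT dY)) /= => /at_rightP[Z ZU dZ].
have [sub _ _] := sweepP l; have ZT := fintype.subsetP sub Z ZU.
have [k kl Zk] := mem_sweep ZU; rewrite -(right_uniq tilT YT ZT dY dZ) in Zk.
split; last by exists k, l.
by apply/finset.set0Pn; exists d; rewrite finset.in_setI !tile_edgesE dY dX orbT.
Qed.

Lemma size_walk w i : size (map fst (walk w i)) = size i.
Proof. by rewrite size_map; elim: i w => //= p i IH w; rewrite IH. Qed.

Lemma mem_walk_tiling j (r : pos_root n) : val r \in map fst (walk 1%g j) ->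
  exists2 X, X \in word_tiling j & tile_root X = r.
Proof.
move=> /mapP[[b V] h e]; exists (r, V) => //.
by rewrite mem_word_tiling /= e.
Qed.

(** Induction on prefixes. Let [X] be the tile of [T] with the next root. Its neighbour across the
    lower left edge precedes it in the tiling order, hence in the word, and is already swept; so
    this edge is on the front, where its label fixes the bottom vertex of [X]. *)
Lemma tiling_of_word_eq i : reduced_word i ->
  (forall X Y, X \in T -> Y \in T -> tile_le T X Y -> word_le i (tile_root X) (tile_root Y)) ->
  T = word_tiling i.
Proof.
move=> red refine; have [L full] := reduced_legal red.
have [j [Lj fj] eT] := tiling_word tilT.
apply: (full_word tilT L _ full).
suff H i1 i2 : i = i1 ++ i2 -> word_tiling i1 \subset T by apply: (H i [::]); rewrite cats0.
elim/last_ind: i1 i2 => [|i1 p IH] i2 ei; first by rewrite word_tiling_nil finset.sub0set.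
rewrite cat_rcons in ei; have sub := IH _ ei; have subP := fintype.subsetP sub.
have L1 : legal 1%g i1 by move: L; rewrite ei legal_cat => /andP[].
have Lp : legal 1%g (rcons i1 p).
  by rewrite legal_rcons L1 /=; move: L; rewrite ei legal_cat /= => /and3P[].
apply/fintype.subsetP => X0 /mem_tiling_rcons[/subP//|[e1 e2]].
have roots_i : map fst (walk 1%g i) = map fst (walk 1%g i1) ++ val X0.1 :: map fst (walk (step (run 1%g i1) p) i2).
  by rewrite ei walk_cat map_cat /= e1.
have notin : val X0.1 \notin map fst (walk 1%g i1).
  have := uniq_walk_roots L; rewrite roots_i cat_uniq /= negb_or.
  by case/and3P => _ /andP[].
have idx : index (val X0.1) (map fst (walk 1%g i)) = size i1.
  by rewrite roots_i index_cat (negbTE notin) /= eqxx addn0 size_walk.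
have [X XT eX] : exists2 X, X \in T & tile_root X = X0.1.
  rewrite eT; apply: mem_walk_tiling; case: X0.1 => -[s t] /= st.
  exact: mem_roots_full.
have Xi1 : X \notin word_tiling i1.
  apply: contra notin; rewrite mem_word_tiling -eX => h.
  by apply/mapP; exists (val X.1, X.2).
suff /imsetP[k _ [eV es]] : (X.2, tile_s X) \in front (run 1%g i1).
  suff -> : X0 = X by [].
  rewrite [X0]surjective_pairing [X]surjective_pairing -eX; congr (_, _).
  rewrite e2 eV; congr (chain _ _); move: es; rewrite /tile_s -/(tile_root X) eX e1 /=.
  by move/perm_inj => <-.
set d := (X.2, tile_s X); have dX : left_edge X d by rewrite /left_edge eqxx.
suff : on_left d || at_right (word_tiling i1) d.
  move/(front_reached L1) => [//|/at_leftP[Z Zi dZ]]; case/negP: Xi1.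
  by rewrite (left_uniq tilT XT (subP _ Zi) dX dZ).
have [//|nl] /= := boolP (on_left d).
have [|Y YT dY] := @other_side _ _ _ tilT true X d XT _ nl; first by rewrite tile_edgesE dX.
apply/at_rightP; exists Y => //; apply: contraT => Yi.
have le : word_le i (tile_root Y) (tile_root X).
  by apply: refine => //; apply: rt_step; apply: (tile_step_edge XT YT dY dX).
have Yroot : val Y.1 \notin map fst (walk 1%g i1).
  apply: contra Yi => /mem_walk_tiling[Z Zi eZ].
  by have ZT := subP _ Zi; rewrite eT in ZT YT; rewrite (tile_root_inj Lj YT ZT (esym eZ)).
(* A root not yet swept but no later than that of [X] is the root of [X] itself; then [d] would be a
   left and a right edge of one tile. *)
move: le; rewrite /word_le -walk1_roots eX idx roots_i index_cat /tile_root (negbTE Yroot) size_walk.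
rewrite -[leqRHS]addn0 leq_add2l /=; case: eqP => // /val_inj e _.
have YX : Y = X by move: XT YT; rewrite eT => XT YT; apply: (tile_root_inj Lj) => //; rewrite eX.
by move: dY; rewrite YX /side_edge (negbTE (left_right_edge (tiling_proper tilT XT) dX)).
Qed.

End Layers.

(** * Comparison of the two sums *)

Section ExponentVectors.
Variables (n : nat) (i : seq 'I_n.-1).
Hypotheses (L : legal 1%g i) (full : run 1%g i = w0 n).
Local Notation T := (word_tiling i).
Implicit Types (a : 'I_n.-1) (c d : {set {set 'I_n}}) (X : tile n) (V : {set 'I_n}).

(** In the order of the sweep the bottom, left and top vertices of a rhombus are already decided,
    and the exponent then decides its right vertex. *)
Lemma rexp_chain c c' : (forall k, (chain 1%g k \in c) = (chain 1%g k \in c')) ->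
  (forall X, X \in T -> rexp c X = rexp c' X) ->
  forall V, V \in \bigcup_(X in T) tile_verts X -> (V \in c) = (V \in c').
Proof.
move=> h0 h V /finset.bigcupP[X XT VX].
have := XT; rewrite mem_word_tiling => XW; have [i1 [i2 [k [ei _ ->]]]] := vert_walk XW VX.
elim/last_ind: i1 i2 k ei {X V XT XW VX} => [|i1 p IH] i2 k ei; first exact: h0.
rewrite cat_rcons in ei; rewrite run_rcons.
have [->|kp] := eqVneq k p.+1; last by rewrite chain_step // (IH _ k ei).
have Lp : legal 1%g (rcons i1 p).
  by move: L; rewrite ei -cat_rcons legal_cat => /andP[].
have [X XT [e1 e2]] := at_stepP Lp.
have {}XT : X \in T by rewrite ei -cat_rcons mem_word_tiling walk_cat mem_cat -mem_word_tiling XT.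
have eB : X.2 = chain (run 1%g i1) p by [].
have eL : tile_left X = chain (run 1%g i1) p.+1 by rewrite chainS_lo /tile_left /tile_s e1 e2.
have eR : tile_right X = chain (step (run 1%g i1) p) p.+1.
  by rewrite chain_step_eq /tile_right /tile_t e1 e2.
have eT : tile_top X = chain (run 1%g i1) p.+2.
  by rewrite chainS_hi chainS_lo finset.setUCA /tile_top /tile_s /tile_t e1 e2.
have := h X XT; rewrite /rexp eB eL eR eT -!(IH _ _ ei).
move: (_ \in c) => l; do 3![move: (_ \in c) => ?].
by case: (_ \in c'); case: l => //; lia.
Qed.

(** The index is recovered because [right_vertex a] belongs to every configuration for [a] and to
    the region of no other index. *)
Lemma expo_inj a a' c c' : c \in config a T -> c' \in config a' T -> expo i c = expo i c' ->
  a = a' /\ c = c'.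
Proof.
move=> cT cT' e.
have := cT; rewrite inE => /and4P[/fintype.subsetP rc /fintype.subsetP vc hv _].
have := cT'; rewrite inE => /and4P[/fintype.subsetP rc' /fintype.subsetP vc' _ _].
have H : forall V, V \in \bigcup_(X in T) tile_verts X -> (V \in c) = (V \in c').
  apply: rexp_chain => [k|X XT]; last by rewrite -!(expoE L) // e.
  have -> : (chain 1%g k \in c) = false.
    by apply/negbTE/negP => /rc; rewrite (negbTE (notin_region_initial a k)).
  by apply/esym/negbTE/negP => /rc'; rewrite (negbTE (notin_region_initial a' k)).
split.
  have /rc' : right_vertex a \in c' by rewrite -H ?vc.
  by rewrite in_region !inE /= => h; apply: val_inj => /=; lia.
apply/setP => V; apply/idP/idP => h; first by rewrite -H ?vc.
by rewrite H ?vc'.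
Qed.

(** For 2 or -2 two opposite vertices would be in [c] and the other two not, with all four in the
    region. The two edges with label [s] obey implications in the same direction, and one of them
    fails. *)
Lemma rexp_range a c X : c \in config a T -> X \in T ->
  [\/ rexp c X = -1, rexp c X = 0 | rexp c X = 1].
Proof.
rewrite inE => /and4P[/fintype.subsetP rc _ _ /forall_inP tc] XT.
have := tc X XT; rewrite /tile_cond /rexp.
have /andP[hs ht] := tile_notin XT; have st := s_neq_t X.
have f1 : tile_left X \in region a -> tile_right X \in region a ->
    (X.2 \in region a) && (tile_top X \in region a).
  rewrite !in_region !inE => /andP[h1 h2] /andP[h3 h4]; move: h1 h2 h3 h4 hs ht st.
  case: (hi a \in X.2); case: (lo a \in X.2); rewrite ?orbT ?orbF //=.
    by move=> _ /negbTE-> _ /negbTE->.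
  by move=> /eqP-> _ /eqP->; rewrite eqxx.
have f2 : X.2 \in region a -> tile_top X \in region a ->
    (tile_left X \in region a) && (tile_right X \in region a).
  rewrite !in_region !inE => /andP[-> h2] /andP[_]; rewrite !negb_or => /and3P[-> -> _].
  by rewrite !orbT h2.
move: (rc X.2) (rc (tile_left X)) (rc (tile_right X)) (rc (tile_top X)) f1 f2.
rewrite /rhombus_cond /edge_cond.
case: (X.2 \in c); case: (tile_left X \in c); case: (tile_right X \in c); case: (tile_top X \in c);
  try by move=> *; (constructor 1 + constructor 2 + constructor 3).
  move=> /(_ isT) h1 _ _ /(_ isT) h2 _ /(_ h1 h2)/andP[h3 h4]; rewrite h1 h2 h3 h4.
  by case: (a < tile_s X)%N; case: (a < tile_t X)%N.
move=> _ /(_ isT) h1 /(_ isT) h2 _ /(_ h1 h2)/andP[h3 h4] _; rewrite h1 h2 h3 h4.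
by case: (a < tile_s X)%N; case: (a < tile_t X)%N.
Qed.

Definition exponents a : seq (exponent n) := [seq expo i c | c <- enum (config a T)].

Lemma RstarE a : Rstar a i = [set` exponents a]%classic.
Proof.
apply/seteqP; split=> y /=; rewrite (RstarP a L full).
  by move=> [c cT ->]; apply/map_f; rewrite mem_enum.
by move=> /mapP[c]; rewrite mem_enum => cT ->; exists c.
Qed.

Lemma uniq_exponents a : uniq (exponents a).
Proof.
rewrite map_inj_in_uniq ?enum_uniq // => c c'; rewrite !mem_enum => h h' e.
by have [] := expo_inj h h' e.
Qed.

End ExponentVectors.

Section TorusPoints.
Variables (R : realType) (n : nat) (i : seq 'I_n.-1).
Hypotheses (L : legal 1%g i) (full : run 1%g i = w0 n).
Local Notation T := (word_tiling i).
Implicit Types (a : 'I_n.-1) (g : 'M[R[i]]_n) (x : tile n -> R[i]).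

Lemma enum_val_initial k (l : 'I_#|initial n k|) : (k <= n)%N -> enum_val l = l :> nat.
Proof.
move=> kn; rewrite /enum_val; set x0 := enum_default _.
rewrite -(nth_map x0 0%N val) ?cardE ?ltn_ord //; last by rewrite -cardE.
have -> : map val (enum (initial n k)) = iota 0 k.
  rewrite {1}/enum_mem -enumT.
  rewrite (eq_filter (a2 := preim val (fun j => j < k)%N)); last first.
    by move=> j; rewrite -[LHS]/(j \in initial n k) !inE.
  rewrite -filter_map val_enum_ord; apply: (irr_sorted_eq ltn_trans ltnn).
  - by rewrite sorted_filter ?iota_ltn_sorted //; apply: ltn_trans.
  - exact: iota_ltn_sorted.
  - by move=> j; rewrite mem_filter !mem_iota; lia.
rewrite nth_iota ?add0n //; apply: leq_trans (ltn_ord l) _.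
by rewrite -chain1 card_chain.
Qed.

Lemma minor_initial g k : unitriangular g -> (k <= n)%N -> minor g (initial n k) = 1.
Proof.
move=> gU kn; rewrite /minor -det_tr det_trig.
  by rewrite big1 // => l _; rewrite !mxE gU ?enum_val_initial // -val_eqE /= enum_val_initial ?eqxx.
apply/is_trig_mxP => l m lm; rewrite !mxE gU ?enum_val_initial ?(ltnW lm) //.
by rewrite -val_eqE /= enum_val_initial // gtn_eqF.
Qed.

Lemma minor_torus g X V : cluster_torus T g -> X \in T -> V \in tile_verts X -> minor g V != 0.
Proof.
move=> [[gU _] gT] XT VX; have [/imsetP[k _ ->]|VL] := boolP (V \in left_verts n).
  by rewrite minor_initial ?oner_neq0 // -ltnS.
by apply: gT; rewrite finset.in_setD VL; apply/finset.bigcupP; exists X.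
Qed.

Lemma NA_ratio g X : cluster_torus T g -> NA g X = minor_ratio g X.
Proof.
move=> [[gU _] _]; suff H S : cluster_coord g S = minor g S by rewrite /NA !H.
by rewrite /cluster_coord; case: ifP => // /imsetP[k _ ->]; rewrite minor_initial // -ltnS.
Qed.

Lemma varrho_sum a x : varrho a i T x = \sum_(c in config a T) monomial T x (expo i c).
Proof.
by rewrite /varrho RstarE // -fsbig_seq ?uniq_exponents // big_map big_enum.
Qed.

Lemma fchi_varrho a g : cluster_torus T g -> fchi a g = varrho a i T (NA g).
Proof.
move=> gT; rewrite varrho_sum.
transitivity (config_sum a g T).
  rewrite (config_sum_torus _ L full) //.
  - by move=> m; rewrite pnatr_eq0.
  - by move=> X XT; split; apply: (minor_torus gT XT); apply/tile_vertsP; [constructor 2|constructor 3].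
  have /finset.bigcupP[X XT VX] := right_vertex_vert a L full.
  exact: minor_torus gT XT VX.
apply: eq_bigr => c cT; apply: eq_bigr => X XT.
by rewrite expoE // NA_ratio.
Qed.

Definition potential_exponents : seq (exponent n) :=
  [seq expo i c | a <- enum 'I_n.-1, c <- enum (config a T)].

Lemma mem_potential y : reflect (exists a, Rstar a i y) (y \in potential_exponents).
Proof.
apply: (iffP allpairsPdep) => [[a [c [_ cT ->]]]|[a /(RstarP _ L full)[c cT ->]]].
  by exists a; apply/(RstarP _ L full); exists c => //; rewrite -mem_enum.
by exists a, c; rewrite !mem_enum.
Qed.

Lemma Rstar_disjoint a a' y : Rstar a i y -> Rstar a' i y -> a = a'.
Proof.
move=> /(RstarP _ L full)[c cT ->] /(RstarP _ L full)[c' cT' e].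
by have [] := expo_inj L cT cT' e.
Qed.

Lemma uniq_potential : uniq potential_exponents.
Proof.
apply: allpairs_uniq_dep => [|a _|]; rewrite ?enum_uniq //.
move=> _ _ /allpairsPdep[a [c [_ + ->]]] /allpairsPdep[a' [c' [_ + ->]]] /=.
by rewrite !mem_enum => cT cT' /(expo_inj L cT cT')[ea ec]; subst a' c'.
Qed.

Definition potential_poly : laurent n :=
  [fsfun y in [fset y | y in potential_exponents]%fset => (1 : int) | 0].

Lemma potential_polyE y : potential_poly y = (y \in potential_exponents)%:Z.
Proof. by rewrite fsfunE in_fset /=; case: ifP. Qed.

(** Different indices have disjoint exponent sets, so at most one summand is nonzero. *)
Lemma potential_poly_sum y :
  potential_poly y = \sum_(a < n.-1) (`[< Rstar a i y >] : nat)%:Z.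
Proof.
rewrite potential_polyE; case: mem_potential => [[a ha]|no].
  rewrite (bigD1 a) //= asboolT // big1 // => a' /eqP ne; rewrite asboolF //.
  by move=> ha'; apply: ne; apply: Rstar_disjoint ha' ha.
by rewrite big1 // => a _; rewrite asboolF // => ha; apply: no; exists a.
Qed.

Lemma potential_poly_eval x : laurent_eval potential_poly T x = \sum_(a < n.-1) varrho a i T x.
Proof.
under eq_bigr => a _ do rewrite varrho_sum.
have -> : laurent_eval potential_poly T x = \sum_(y <- potential_exponents) monomial T x y.
  transitivity (\sum_(y <- potential_exponents) (potential_poly y)%:~R * monomial T x y); last first.
    by apply: eq_big_seq => y h; rewrite potential_polyE h mul1r.
  apply: perm_big; apply: uniq_perm; rewrite ?fset_uniq ?uniq_potential // => y.
  by rewrite mem_finsupp potential_polyE; case: (y \in _).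
rewrite big_allpairs_dep big_enum; apply: eq_bigr => a _.
by rewrite big_enum.
Qed.

End TorusPoints.

(** Finiteness of [Rstar a i] is asserted because [varrho] is a finite support sum. The Laurent
    polynomial is pinned down coefficient by coefficient, not merely by its values on the torus. *)
Theorem theorem5p13 (R : realType) (n : nat) (hn : (2 <= n)%N)
    (i : seq 'I_n.-1) (hi : reduced_word i)
    (T : {set tile n}) (hT : tiling_of_word R i T) :
  (forall a : 'I_n.-1,
     finite_set (Rstar a i) /\
     forall g : 'M[R[i]]_n, cluster_torus T g ->
       fchi a g = varrho a i T (NA g)) /\
  (exists P : laurent n,
     [/\ forall y : exponent n,
           P y = \sum_(a < n.-1) (`[< Rstar a i y >] : nat)%:Z,
         forall g : 'M[R[i]]_n, cluster_torus T g ->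
           BK_potential g = \sum_(a < n.-1) varrho a i T (NA g) /\
           BK_potential g = laurent_eval P T (NA g),
         forall y : exponent n, P y = 0 \/ P y = 1
       & forall y : exponent n, P y != 0 ->
           forall r : pos_root n, [\/ y r = -1, y r = 0 | y r = 1]]).
Proof.
have [tilT refine] := hT; have [L full] := reduced_legal hi.
have {refine} eT := tiling_of_word_eq tilT hi refine; subst T.
split=> [a|].
  by split=> [|g gT]; [rewrite RstarE //; exact: finite_seq|exact: fchi_varrho].
have BK g : cluster_torus (word_tiling i) g ->
    BK_potential g = \sum_(a < n.-1) varrho a i (word_tiling i) (NA g).
  by move=> gT; apply: eq_bigr => a _; apply: fchi_varrho.
exists (potential_poly i); split.
- exact: potential_poly_sum.
- by move=> g gT; rewrite potential_poly_eval //; split; apply: BK.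
- by move=> y; rewrite potential_polyE; case: (y \in _); [right|left].
move=> y; rewrite potential_polyE; case: mem_potential => // -[a /(RstarP _ L full)[c cT ->]] _ r.
have [X XT <-] := cover_roots r L full; rewrite expoE //.
exact: rexp_range cT XT.
Qed.
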